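(* In the setting described in the context, for given initial condition $\mathcal I_0=\{g_0,H_0,B_0,P_0\}$, the value of the finite-time horizon minimization problem $$\min_{\{u_k:0\le k\le T\}}\ \sum_{k=0}^{T}\mathbb{E}[\mathrm{tr}(P_{k+1})]\quad\text{s.t. } 0\le u_k\le B_k\ \text{(a.s.)},\ 0\le k\le T,$$ over admissible controls is $V_0(\mathcal I_0)$, i.e. $V_0(\pi,g_0,H_0,B_0)$ with $\pi$ the unit point mass at $P_0$, where $V_k$ is computed recursively from the backward Bellman dynamic programming equation $$V_k(\pi,g,H,B)=\min_{0\le u\le B}\Bigl\{\mathbb{E}\bigl[\mathrm{tr}(\mathcal L(P,\gamma))\mid\pi,g,u\bigr]+\mathbb{E}\bigl[V_{k+1}\bigl(\Phi[\pi,\hat\gamma,g,u],\tilde g,\tilde H,\min\{B-u+\tilde H,B_{\max}\}\bigr)\mid\pi,g,H,u\bigr]\Bigr\}$$ for $0\le k\le T-1$ and $\pi\in\Pi$, with terminal condition $$V_T(\pi,g,H,B)=\min_{0\le u\le B}\mathbb{E}\bigl[\mathrm{tr}(\mathcal L(P,\gamma))\mid\pi,g,u\bigr]=\mathbb{E}\bigl[\mathrm{tr}(\mathcal L(P,\gamma))\mid\pi,g,B\bigr],$$ so that all available energy is used for transmission at the final time $T$.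
   Context: Process: $x_{k+1}=Ax_k+w_k$, $x_k\in\mathbb{R}^n$, $w_k$ i.i.d. Gaussian with mean zero and covariance $Q>0$; $x_0$ Gaussian with covariance $P_{x_0}$, independent of $\{w_k\}$. Measurements: $y_k=Cx_k+v_k\in\mathbb{R}^m$, $v_k$ i.i.d. Gaussian with mean zero and covariance $R\ge0$, independent of $x_0,\{w_k\}$. Standing assumption: $(A,Q^{1/2})$ stabilizable and $(A,C)$ detectable. Forward channel: $\gamma_k\in\{0,1\}$ indicates reception of $y_k$, with $\mathbb{P}(\gamma_k=1\mid g_k,u_k)=h(g_ku_k)$, $h:[0,\infty)\to[0,1]$ monotonically increasing and continuous, $g_k$ the channel gain, $u_k$ the transmission energy; given $g_k,u_k$, $\gamma_k$ does not depend on the past. The channel gains $\{g_k\}$ and the harvested energies $\{H_k\}$ are mutually independent stationary first-order homogeneous Markov processes with transition laws $\mathbb{G}$ and $\mathbb{H}$, independent of the other random variables. Battery: $B_{k+1}=\min\{B_k-u_k+H_{k+1},B_{\max}\}$, $0\le B_0\le B_{\max}$. The receiver's Kalman prediction error covariance satisfies $P_{k+1}=\mathcal L(P_k,\gamma_k)$, $P_0=P_{x_0}$, where $\mathcal L(P,\gamma)=APA^T+Q-\gamma APC^T(CPC^T+R)^{-1}CPA^T$. Feedback: after transmitting $y_k$ the sensor sees $\hat\gamma_k\in\{0,1,2\}$, with $\mathbb{P}(\hat\gamma=2\mid\gamma)=\eta$, $\mathbb{P}(\hat\gamma=\gamma\mid\gamma)=(1-\epsilon)(1-\eta)$, $\mathbb{P}(\hat\gamma=1-\gamma\mid\gamma)=\epsilon(1-\eta)$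 for $\gamma\in\{0,1\}$; $\eta,\epsilon\in[0,1]$; erasures and errors are independent of all other random processes. Admissible controls: $u_k$ is measurable with respect to $\sigma(\mathcal I_k)$, $\mathcal I_k=\{(\hat\gamma_{t-1},g_t,H_t,B_t):1\le t\le k\}\cup\mathcal I_0$, and $0\le u_k\le B_k$ a.s.; the expectations in the problem are for the given $\mathcal I_0$. $\Pi$ is the space of probability densities on the set $\mathcal S_+^n$ of nonnegative definite $n\times n$ matrices, with Dirac deltas (point masses) allowed, so densities are read as probability measures. For $\pi\in\Pi$, $\hat\gamma\in\{0,1,2\}$, gain $g$ and energy $u$, $$\Phi[\pi,\hat\gamma,g,u]=\sum_{\gamma\in\{0,1\}}\frac{\mathbb{P}(\hat\gamma\mid\gamma)\,\mathbb{P}(\gamma\mid g,u)}{\sum_{\gamma'\in\{0,1\}}\mathbb{P}(\hat\gamma\mid\gamma')\,\mathbb{P}(\gamma'\mid g,u)}\;\mathcal L(\cdot,\gamma)_*\pi,$$ where $\mathcal L(\cdot,\gamma)_*\pi$ is the law of $\mathcal L(P,\gamma)$ when $P\sim\pi$, $\mathbb{P}(\gamma=1\mid g,u)=h(gu)$ and $\mathbb{P}(\gamma=0\mid g,u)=1-h(gu)$ (values $\hat\gamma$ of probability zero are irrelevant). In $\mathbb{E}[\cdot\mid\pi,g,u]$, $P\sim\pi$ and $\gamma$ is independent of $P$ with $\mathbb{P}(\gamma=1)=h(gu)$. In $\mathbb{E}[\cdot\mid\pi,g,H,u]$, $\hat\gamma$ has law $\mathbb{P}(\hat\gamma)=\sum_\gamma\mathbb{P}(\hat\gamma\mid\gamma)\mathbb{P}(\gamma\mid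 g,u)$, and independently $\tilde g\sim\mathbb{G}(\cdot\mid g)$, $\tilde H\sim\mathbb{H}(\cdot\mid H)$ (the next-step channel gain and harvested energy). *)

(* Defs.v *)
From HB Require Import structures.
From mathcomp Require Import all_boot all_order all_algebra.
From mathcomp Require Import all_classical all_reals all_analysis.
From mathcomp Require Import measurable_realfun complex ring.

Set Implicit Arguments.
Unset Strict Implicit.
Unset Printing Implicit Defensive.

Import Order.TTheory GRing.Theory Num.Theory.
Import numFieldTopology.Exports numFieldNormedType.Exports.

Local Open Scope classical_set_scope.
Local Open Scope ring_scope.
Local Open Scope complex_scope.

Section linear_systems.
Context {R : realType}.

Definition psd n (S : 'M[R]_n) : Prop :=
  S^T = S /\ forall z : 'cV[R]_n, 0 <= (z^T *m S *m z) 0 0.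

Definition posdef n (S : 'M[R]_n) : Prop :=
  S^T = S /\ forall z : 'cV[R]_n, z != 0 -> 0 < (z^T *m S *m z) 0 0.

Lemma posdef_psd n (S : 'M[R]_n) : posdef S -> psd S.
Proof.
case=> St S0; split=> // z; have [->|/S0/ltW//] := eqVneq z 0.
by rewrite mulmx0 mxE.
Qed.

Definition schur_stable n (F : 'M[R]_n) : Prop :=
  forall lam : R[i],
    eigenvalue (map_mx (real_complex R) F) lam -> `|lam| < 1.

Definition stabilizable n p (A : 'M[R]_n) (B : 'M[R]_(n, p)) : Prop :=
  exists K : 'M[R]_(p, n), schur_stable (A - B *m K).

Definition detectable n p (A : 'M[R]_n) (C : 'M[R]_(p, n)) : Prop :=
  exists K : 'M[R]_(n, p), schur_stable (A - K *m C).

(* [pinvmx] is the inverse on invertible matrices ([pinvmxE]).  When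
   [C P C^T + Rv] is singular (possible since only [Rv >= 0] is assumed), it is
   a generalized inverse, and the product below does not depend on which one
   because the columns of [C P] lie in the range of [C P C^T + Rv]. *)
Definition riccati n m (A : 'M[R]_n) (C : 'M[R]_(m, n)) (Q : 'M[R]_n)
    (Rv : 'M[R]_m) (P : 'M[R]_n) (gam : bool) : 'M[R]_n :=
  A *m P *m A^T + Q
  - gam%:R *: (A *m P *m C^T *m pinvmx (C *m P *m C^T + Rv) *m C *m P *m A^T).

End linear_systems.

Section riccati_theory.
Context {R : realType}.

Lemma sqr_mx_ge0 n (z : 'cV[R]_n) : 0 <= (z^T *m z) 0 0.
Proof. by rewrite mxE sumr_ge0// => i _; rewrite mxE -expr2 sqr_ge0. Qed.

Lemma sqr_mx_eq0 n (z : 'cV[R]_n) : (z^T *m z) 0 0 = 0 -> z = 0.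
Proof.
rewrite mxE => /eqP; rewrite psumr_eq0; last first.
  by move=> i _; rewrite mxE -expr2 sqr_ge0.
move=> /allP z0; apply/matrixP => i j; rewrite ord1 [RHS]mxE.
have := z0 i (mem_index_enum i); rewrite mxE /= -expr2 sqrf_eq0 => /eqP.
by [].
Qed.

Lemma psd_form_eq0 n (S : 'M[R]_n) (z : 'cV[R]_n) :
  psd S -> (z^T *m S *m z) 0 0 = 0 -> S *m z = 0.
Proof.
move=> [St S0] z0; apply: sqr_mx_eq0.
set y := S *m z; set q := _ 0 0; pose c := (y^T *m S *m y) 0 0.
have c0 : 0 <= c by exact: S0.
have q0 : 0 <= q by exact: sqr_mx_ge0.
have key t : 0 <= 2 * t * q + t ^+ 2 * c.
  have := S0 (z + t *: y).
  suff -> : ((z + t *: y)^T *m S *m (z + t *: y)) 0 0 = 2 * t * q + t ^+ 2 * c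
    by [].
  have e1 : z^T *m S *m y = y^T *m y by rewrite /y trmx_mul St.
  have e2 : y^T *m S *m z = y^T *m y by rewrite -mulmxA.
  have -> : (z + t *: y)^T = z^T + t *: y^T by rewrite linearD/= linearZ.
  rewrite !mulmxDl !mulmxDr -!scalemxAl -!scalemxAr e1 e2.
  have E (a b : 'M[R]_1) : (a + b) 0 0 = a 0 0 + b 0 0 by rewrite mxE.
  have F k (a : 'M[R]_1) : (k *: a) 0 0 = k * a 0 0 by rewrite mxE.
  rewrite !(E, F) z0 -/q -/c; ring.
have c1 : 0 < c + 1 by rewrite ltr_wpDl.
have := key (- q / (c + 1)).
have -> : 2 * (- q / (c + 1)) * q + (- q / (c + 1)) ^+ 2 * c =
   - (q ^+ 2 * (c + 2) / (c + 1) ^+ 2).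
  by field; rewrite gt_eqF.
rewrite oppr_ge0 => h.
have : q ^+ 2 * (c + 2) <= 0.
  by rewrite -(pmulr_lle0 _ (_ : 0 < ((c + 1) ^+ 2)^-1)) ?invr_gt0 ?exprn_gt0.
rewrite pmulr_lle0 ?ltr_wpDl// => h2.
have : q ^+ 2 == 0 by rewrite eq_le h2 sqr_ge0.
by rewrite sqrf_eq0 => /eqP.
Qed.

Lemma psdD n (S T : 'M[R]_n) : psd S -> psd T -> psd (S + T).
Proof.
move=> [St S0] [Tt T0]; split=> [|z]; first by rewrite linearD/= St Tt.
by rewrite mulmxDr mulmxDl mxE addr_ge0.
Qed.

Lemma psd_conj n p (B : 'M[R]_(p, n)) (S : 'M[R]_n) :
  psd S -> psd (B *m S *m B^T).
Proof.
move=> [St S0]; split=> [|z]; first by rewrite !trmx_mul trmxK St mulmxA.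
by have := S0 (B^T *m z); rewrite trmx_mul trmxK !mulmxA.
Qed.

Variables (n m : nat) (A : 'M[R]_n) (C : 'M[R]_(m, n)).
Variables (Q : 'M[R]_n) (Rv : 'M[R]_m).
Hypotheses (Q0 : psd Q) (Rv0 : psd Rv).

Lemma innov_psd (P : 'M[R]_n) : psd P -> psd (C *m P *m C^T + Rv).
Proof. by move=> P0; apply: psdD => //; exact: psd_conj. Qed.

Lemma innov_range (P : 'M[R]_n) :
  psd P -> (P *m C^T <= (C *m P *m C^T + Rv)%R)%MS.
Proof.
move=> P0; pose S := C *m P *m C^T + Rv; rewrite -/S submxE; apply/eqP.
apply/row_matrixP => i; apply/rowP => j.
suff z0 (x : 'cV[R]_m) : P *m C^T *m (cokermx S *m x) = 0.
  have := z0 (delta_mx j 0); rewrite mulmxA => /matrixP/(_ i 0).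
  by rewrite -colE !mxE.
set z := cokermx S *m x.
have : (z^T *m S *m z) 0 0 = 0.
  by rewrite /z mulmxA -(mulmxA _ S) mulmx_coker mulmx0 mul0mx mxE.
rewrite mulmxDr mulmxDl mxE => /eqP; rewrite paddr_eq0; last 2 first.
- by have [_] := psd_conj C P0; exact.
- by have [_] := Rv0; exact.
case/andP => /eqP e _; rewrite -mulmxA; apply: psd_form_eq0 => //.
by rewrite -e trmx_mul trmxK !mulmxA.
Qed.

Lemma riccati_psd (P : 'M[R]_n) (gam : bool) :
  psd P -> psd (riccati A C Q Rv P gam).
Proof.
move=> P0; case: gam; last first.
  by rewrite /riccati scale0r subr0; apply: psdD => //; exact: psd_conj.
rewrite /riccati scale1r; set S := C *m P *m C^T + Rv.
have Pt : P^T = P by case: P0.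
pose G := A *m P *m C^T; pose K := G *m pinvmx S.
have KS : K *m S = G.
  rewrite /K mulmxKpV// /G -mulmxA.
  by apply: (submx_trans (submxMl _ _)); exact: innov_range.
suff -> : A *m P *m A^T + Q - (G *m pinvmx S *m C *m P *m A^T) =
  (A - K *m C) *m P *m (A - K *m C)^T + Q + K *m Rv *m K^T.
  by apply: psdD; [apply: psdD|] => //; exact: psd_conj.
have e : K *m (C *m P *m C^T + Rv) *m K^T = G *m K^T by rewrite -/S KS.
move: e; rewrite -/K mulmxDr mulmxDl => /(canRL (addKr _)) ->.
have -> : (A - K *m C)^T = A^T - C^T *m K^T by rewrite linearB/= trmx_mul.
rewrite mulmxBr !mulmxBl /G !mulmxA.
move: (A *m P *m A^T) (K *m C *m P *m A^T) => a b.
move: (A *m P *m C^T *m K^T) (K *m C *m P *m C^T *m K^T) => c d.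
apply/matrixP => i j; rewrite !mxE; ring.
Qed.

End riccati_theory.

Section psdmx.
Variables (R : realType) (n : nat).

(* S_+^n, with the sigma-algebra generated by the entries (the Borel one). *)
Record psdmx := PSDmx { psdmx_val :> 'M[R]_n ; psdmxP : psd psdmx_val }.

Lemma psd0 : psd (0 : 'M[R]_n).
Proof. by split=> [|z]; rewrite ?trmx0// mulmx0 mul0mx mxE. Qed.

HB.instance Definition _ := gen_eqMixin psdmx.
HB.instance Definition _ := gen_choiceMixin psdmx.
HB.instance Definition _ := isPointed.Build psdmx (PSDmx psd0).

Definition psdmx_gen : set (set psdmx) :=
  \bigcup_(ij in [set: 'I_n * 'I_n])
    preimage_set_system setT (fun P : psdmx => psdmx_val P ij.1 ij.2) measurable.

Definition psdmx_display : measure_display.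
Proof. by constructor. Qed.

HB.instance Definition _ := @isMeasurable.Build psdmx_display psdmx
  <<s psdmx_gen >> (@sigma_algebra0 _ setT psdmx_gen)
  (@sigma_algebraC _ psdmx_gen) (@sigma_algebra_bigcup _ setT psdmx_gen).

Lemma psdmx_inj (P P' : psdmx) : psdmx_val P = P' -> P = P'.
Proof.
case: P P' => [P P0] [P' P0'] /= e; subst P'.
by congr PSDmx; exact: Prop_irrelevance.
Qed.

End psdmx.

Section measurable_psdmx.
Context d (T : measurableType d) (R : realType).

Lemma measurable_psdmx_entry n (i j : 'I_n) :
  measurable_fun [set: psdmx R n] (fun P : psdmx R n => psdmx_val P i j).
Proof.
move=> _ A mA; apply: sub_sigma_algebra; exists (i, j) => //=.
by exists A.
Qed.

Lemma measurable_to_psdmx n (f : T -> psdmx R n) :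
  (forall i j, measurable_fun setT (fun t => psdmx_val (f t) i j)) ->
  measurable_fun setT f.
Proof.
move=> mf; apply: (measurability (@psdmx_gen R n)) => //.
move=> _ [_ [[i j] _ [A mA <-]] <-]; rewrite setTI -comp_preimage setTI.
by rewrite -[X in measurable X]setTI; exact: mf.
Qed.

Definition measurable_mx p q (F : T -> 'M[R]_(p, q)) :=
  forall i j, measurable_fun setT (fun t => F t i j).

Lemma measurable_mx_cst p q (M : 'M[R]_(p, q)) : measurable_mx (fun=> M).
Proof. by move=> i j; exact: measurable_cst. Qed.

Lemma measurable_mxD p q (F G : T -> 'M[R]_(p, q)) :
  measurable_mx F -> measurable_mx G -> measurable_mx (fun t => F t + G t).
Proof.
move=> mF mG i j.
rewrite (_ : (fun _ => _) = (fun t => F t i j + G t i j)); last first.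
  by apply/funext => t; rewrite mxE.
exact: measurable_funD.
Qed.

Lemma measurable_mxZ p q (f : T -> R) (G : T -> 'M[R]_(p, q)) :
  measurable_fun setT f -> measurable_mx G -> measurable_mx (fun t => f t *: G t).
Proof.
move=> mF mG i j.
rewrite (_ : (fun _ => _) = (fun t => f t * G t i j)); last first.
  by apply/funext => t; rewrite mxE.
exact: measurable_funM.
Qed.

Lemma measurable_mxM p q r (F : T -> 'M[R]_(p, q)) (G : T -> 'M[R]_(q, r)) :
  measurable_mx F -> measurable_mx G -> measurable_mx (fun t => F t *m G t).
Proof.
move=> mF mG i j.
rewrite (_ : (fun _ => _) = (fun t => \sum_k F t i k * G t k j)); last first.
  by apply/funext => t; rewrite mxE.
by apply: measurable_sum => k; exact: measurable_funM.
Qed.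

Lemma measurable_det p (F : T -> 'M[R]_p) :
  measurable_mx F -> measurable_fun setT (fun t => \det (F t)).
Proof.
move=> mF; apply: measurable_sum => s; apply: measurable_funM => //.
exact: measurable_prod.
Qed.

Lemma measurable_fun_invr (f : T -> R) : (forall t, f t != 0) ->
  measurable_fun setT f -> measurable_fun setT (fun t => (f t)^-1).
Proof.
move=> f0 mf; apply: (measurable_comp (F := [set x : R | x != 0])) => //.
- apply: open_measurable; exact: open_neq.
- by move=> _ [t _ <-] /=.
- apply: open_continuous_measurable_fun; first exact: open_neq.
  by move=> x /[!inE]/= x0; exact: inv_continuous.
Qed.

Lemma measurable_invmx p (F : T -> 'M[R]_p) : (forall t, F t \in unitmx) ->
  measurable_mx F -> measurable_mx (fun t => invmx (F t)).
Proof.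
move=> uF mF.
rewrite (_ : (fun _ => _) = (fun t => (\det (F t))^-1 *: \adj (F t))); last first.
  by apply/funext => t; rewrite /invmx uF.
apply: measurable_mxZ.
  apply: measurable_fun_invr; last exact: measurable_det.
  by move=> t; rewrite -unitfE -unitmxE uF.
move=> i j; rewrite (_ : (fun _ => _) = (fun t => cofactor (F t) j i)); last first.
  by apply/funext => t; rewrite mxE.
apply: measurable_funM => //; apply: measurable_det => k l.
rewrite (_ : (fun _ => _) = (fun t => F t (lift j k) (lift i l)))//.
by apply/funext => t; rewrite !mxE.
Qed.

End measurable_psdmx.
Section measurable_riccati.
Context {R : realType}.

Lemma sqr_mxE n (z : 'cV[R]_n) : (z^T *m z) 0 0 = \sum_l z l 0 ^+ 2.
Proof. by rewrite mxE; apply: eq_bigr => l _; rewrite mxE -expr2. Qed.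

Lemma psd_shift_form n (S : 'M[R]_n) (t : R) (z : 'cV[R]_n) :
  (z^T *m (S + t%:M) *m z) 0 0 = (z^T *m S *m z) 0 0 + t * (z^T *m z) 0 0.
Proof. by rewrite mulmxDr mulmxDl mul_mx_scalar -scalemxAl !mxE. Qed.

Lemma psd_shift_unit n (S : 'M[R]_n) (t : R) :
  psd S -> 0 < t -> S + t%:M \in unitmx.
Proof.
move=> S0 t0; rewrite -row_free_unit -kermx_eq0.
apply/eqP/row_matrixP => i; rewrite row0.
set z := (row i (kermx (S + t%:M)))^T.
apply: trmx_inj; rewrite -/z trmx0; apply: sqr_mx_eq0.
have : (z^T *m (S + t%:M) *m z) 0 0 = 0.
  by rewrite /z trmxK -row_mul mulmx_ker row0 mul0mx mxE.
rewrite psd_shift_form => /eqP; rewrite paddr_eq0; last 2 first.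
- by have [_] := S0; exact.
- by rewrite mulr_ge0 ?sqr_mx_ge0// ltW.
by case/andP => _; rewrite mulf_eq0 gt_eqF//= => /eqP.
Qed.

Lemma resolvent_le1 n (S : 'M[R]_n) (t : R) i j : psd S -> 0 < t ->
  `|(t *: invmx (S + t%:M)) i j| <= 1.
Proof.
move=> S0 t0; set M := t *: _.
pose z := col j M.
have zz : (z^T *m z) 0 0 <= M j j.
  have : (z^T *m (S + t%:M) *m z) 0 0 = t * M j j.
    rewrite -mulmxA.
    have -> : (S + t%:M) *m z = t *: delta_mx j 0.
      rewrite /z colE mulmxA /M -scalemxAr mulmxV ?psd_shift_unit//.
      by rewrite -scalemxAl mul1mx.
    by rewrite -scalemxAr -colE !mxE.
  rewrite psd_shift_form => e.
  have h : t * (z^T *m z) 0 0 <= t * M j j.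
    by rewrite -e lerDr; have [_] := S0; exact.
  by rewrite ler_pM2l in h.
have zi k : M k j ^+ 2 <= M j j.
  apply: le_trans zz.
  have -> : (z^T *m z) 0 0 = \sum_l M l j ^+ 2.
    by rewrite sqr_mxE; apply: eq_bigr => l _; rewrite /z colE -colE mxE.
  by rewrite (bigD1 k)//= lerDl sumr_ge0// => l _; rewrite sqr_ge0.
have j1 : M j j <= 1.
  rewrite leNgt; apply/negP => j1; have := zi j.
  by rewrite expr2 ger_pMr ?(lt_trans _ j1)// leNgt j1.
rewrite -(@ler_pXn2r _ 2) ?nnegrE// expr1n -normrX ger0_norm ?sqr_ge0//.
exact: le_trans j1.
Qed.

Variables (n m : nat) (A : 'M[R]_n) (C : 'M[R]_(m, n)).
Variables (Q : 'M[R]_n) (Rv : 'M[R]_m).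
Hypothesis Rv0 : psd Rv.

Let reg (t : R) (P : 'M[R]_n) : 'M[R]_n := A *m P *m A^T + Q
  + (-1) *: (A *m P *m C^T *m invmx (C *m P *m C^T + Rv + t%:M) *m C *m P *m A^T).

Let reg_cvg (P : 'M[R]_n) i j : psd P ->
  (fun k => reg k.+1%:R^-1 P i j) @ \oo --> riccati A C Q Rv P true i j.
Proof.
move=> P0; pose S := C *m P *m C^T + Rv.
have S0 : psd S by exact: innov_psd.
have Pt : P^T = P by case: P0.
have St : S^T = S by case: S0.
pose G := A *m P *m C^T; pose K := G *m pinvmx S.
have KS : K *m S = G.
  rewrite /K mulmxKpV// /G -mulmxA.
  by apply: (submx_trans (submxMl _ _)); exact: innov_range.
have Gt : C *m P *m A^T = G^T by rewrite /G !trmx_mul trmxK Pt mulmxA.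
have GKt : G^T = S *m K^T by rewrite -KS trmx_mul St.
pose M (t : R) := t *: invmx (S + t%:M).
have regE t : 0 < t ->
    reg t P = riccati A C Q Rv P true + t *: (K *m (1%:M - M t) *m K^T).
  move=> t0; have uS : S + t%:M \in unitmx by exact: psd_shift_unit.
  have VS : invmx (S + t%:M) *m S = 1%:M - M t.
    have := mulVmx uS; rewrite mulmxDr mul_mx_scalar => /(canRL (addrK _)) ->.
    by [].
  have SVS : S *m invmx (S + t%:M) *m S = S - t *: (1%:M - M t).
    have := mulmxV uS; rewrite mulmxDl mul_scalar_mx => /(canRL (addrK _)) ->.
    by rewrite mulmxBl mul1mx -scalemxAl VS.
  have e1 : G *m invmx (S + t%:M) *m G^T =
      K *m S *m K^T - t *: (K *m (1%:M - M t) *m K^T).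
    have -> : G *m invmx (S + t%:M) *m G^T =
        K *m (S *m invmx (S + t%:M) *m S) *m K^T by rewrite GKt -KS !mulmxA.
    by rewrite SVS mulmxBr mulmxBl -scalemxAr -scalemxAl.
  have e2 : G *m pinvmx S *m G^T = K *m S *m K^T by rewrite GKt -[G *m pinvmx S]/K !mulmxA.
  rewrite /reg /riccati scale1r scaleN1r -/S.
  have flat X : A *m P *m C^T *m X *m C *m P *m A^T = G *m X *m G^T.
    by rewrite -Gt /G !mulmxA.
  rewrite !flat e1 e2 opprB.
  by rewrite [LHS]addrA [LHS]addrAC.
pose c := \sum_k (\sum_l `|K i l| * 2) * `|K j k|.
have bnd t : 0 < t -> `|(K *m (1%:M - M t) *m K^T) i j| <= c.
  move=> t0; rewrite mxE (le_trans (ler_norm_sum _ _ _))// ler_sum// => k _.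
  rewrite [K^T k j]mxE normrM ler_wpM2r// mxE.
  rewrite (le_trans (ler_norm_sum _ _ _))// ler_sum// => l _.
  rewrite normrM ler_wpM2l//.
  have -> : (1%:M - M t) l k = (l == k)%:R - M t l k by rewrite [LHS]mxE mxE [X in _ + X]mxE.
  rewrite (le_trans (ler_normB _ _))// -[2]/(1 + 1) lerD ?resolvent_le1//.
  by rewrite normr_nat lern1 leq_b1.
have lim0 : (fun k => k.+1%:R^-1 * c) @ \oo --> (0 : R).
  rewrite -[X in _ --> X](mul0r c); apply: cvgMr_tmp; exact: cvg_harmonic.
apply/cvgrPdist_le => e e0; near=> k.
have k0 : 0 < k.+1%:R^-1 :> R by rewrite invr_gt0.
rewrite (regE _ k0) [X in _ - X]mxE opprD addNKr normrN [X in `|X|]mxE.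
rewrite normrM (ger0_norm (ltW k0)).
apply: (@le_trans _ _ (k.+1%:R^-1 * c)); first by rewrite ler_pM2l// bnd.
rewrite -[leLHS]ger0_norm; last first.
  by rewrite mulr_ge0 ?(ltW k0)// (le_trans _ (bnd _ k0)).
near: k; move/cvgr0Pnorm_le : lim0; exact.
Unshelve. all: by end_near.
Qed.


Lemma measurable_riccati (gam : bool) :
  measurable_mx (fun P : psdmx R n => riccati A C Q Rv P gam).
Proof.
pose T := psdmx R n.
have mP : measurable_mx (fun P : T => psdmx_val P).
  by move=> i j; exact: measurable_psdmx_entry.
have mAPA : measurable_mx (fun P : T => A *m psdmx_val P *m A^T + Q).
  apply: measurable_mxD; last exact: measurable_mx_cst.
  by repeat (apply: measurable_mxM => //); exact: measurable_mx_cst.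
case: gam; last first.
  rewrite (_ : (fun _ => _) = (fun P : T => A *m psdmx_val P *m A^T + Q))//.
  by apply/funext => P; rewrite /riccati scale0r subr0.
move=> i j.
apply: (@measurable_fun_cvg _ _ _ _ (fun k P => reg k.+1%:R^-1 (psdmx_val P) i j)).
  move=> k; rewrite -/(measurable_mx _); move: i j.
  apply: measurable_mxD => //; apply: measurable_mxZ; first exact: measurable_cst.
  have mc p q (M : 'M[R]_(p, q)) : measurable_mx (fun _ : T => M).
    exact: measurable_mx_cst.
  do 3 (apply: measurable_mxM => //).
  apply: measurable_mxM; first by do 2 (apply: measurable_mxM => //).
  apply: measurable_invmx => [P|].
    by apply: psd_shift_unit; [exact: innov_psd (psdmxP P)|rewrite invr_gt0].
  do 2 (apply: measurable_mxD => //); do 2 (apply: measurable_mxM => //).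
by move=> P _; exact: reg_cvg (psdmxP P).
Qed.

End measurable_riccati.

(* The existence of an initial law making the homogeneous Markov process with
   transition law [K] on [0, +oo[ stationary. *)
Definition has_stationary_law (R : realType) (K : R.-pker R ~> R) : Prop :=
  exists mu : probability R R, mu `[0, +oo[%classic = 1%E /\
    forall A, measurable A -> (\int[mu]_x K x A = mu A)%E.

Record model (R : realType) (n m : nat) := Model {
  dynA : 'M[R]_n ;
  obsC : 'M[R]_(m, n) ;
  covQ : 'M[R]_n ;
  sqrtQ : 'M[R]_n ;
  covR : 'M[R]_m ;
  recv : R -> R ;                  (* h, only used on [0, +oo[ *)
  gainK : R.-pker R ~> R ;         (* transition law of the channel gains *)
  harvK : R.-pker R ~> R ;         (* transition law of the harvested energies *)
  erasure : R ;                    (* eta *)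
  fberror : R ;                    (* epsilon *)
  Bmax : R ;
  covQ_posdef : posdef covQ ;
  sqrtQ_psd : psd sqrtQ ;
  sqrtQE : sqrtQ *m sqrtQ = covQ ;
  covR_psd : psd covR ;
  model_stabilizable : stabilizable dynA sqrtQ ;
  model_detectable : detectable dynA obsC ;
  recv01 : forall x, 0 <= x -> 0 <= recv x <= 1 ;
  recv_nondecreasing : {in `[0, +oo[ &, {homo recv : x y / x <= y}} ;
  recv_continuous : {within `[0, +oo[%classic, continuous recv} ;
  gainK_ge0 : forall x, 0 <= x -> gainK x `[0, +oo[%classic = 1%E ;
  gainK_stationary : has_stationary_law gainK ;
  harvK_ge0 : forall x, 0 <= x -> harvK x `[0, +oo[%classic = 1%E ;
  harvK_stationary : has_stationary_law harvK ;
  erasure01 : 0 <= erasure <= 1 ;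
  fberror01 : 0 <= fberror <= 1 }.

Section dynamic_programming.
Context {R : realType} {n m : nat}.
Variable M : model R n m.

Definition kalman (gam : bool) (P : psdmx R n) : psdmx R n :=
  PSDmx (riccati_psd (dynA M) (obsC M) (posdef_psd (covQ_posdef M))
           (covR_psd M) gam (psdmxP P)).

Lemma measurable_kalman gam : measurable_fun setT (kalman gam).
Proof.
apply: measurable_to_psdmx.
exact: (measurable_riccati (dynA M) (obsC M) (covQ M) (covR_psd M) gam).
Qed.

HB.instance Definition _ gam :=
  isMeasurableFun.Build _ _ _ _ (kalman gam) (measurable_kalman gam).

(* P(gamma | g, u); the maximum is [g * u] for nonnegative gain and energy. *)
Definition chan (gam : bool) (g u : R) : R :=
  let p := recv M (Num.max 0 (g * u)) in if gam then p else 1 - p.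

(* P(hatgamma = j | gamma) *)
Definition fback (j : 'I_3) (gam : bool) : R :=
  if j == 2 :> nat then erasure M
  else if j == gam :> nat then (1 - fberror M) * (1 - erasure M)
  else fberror M * (1 - erasure M).

(* P(hatgamma = j | g, u) *)
Definition fback_marg (j : 'I_3) (g u : R) : R :=
  \sum_(gam : bool) fback j gam * chan gam g u.

Lemma chan_ge0 gam g u : 0 <= chan gam g u.
Proof.
have : 0 <= recv M (Num.max 0 (g * u)) <= 1.
  by apply: recv01; rewrite le_max lexx.
by rewrite /chan => /andP[p0 p1]; case: gam => //=; rewrite subr_ge0.
Qed.

Lemma fback_ge0 j gam : 0 <= fback j gam.
Proof.
have /andP[h0 h1] := erasure01 M; have /andP[e0 e1] := fberror01 M.
by rewrite /fback; do 2 (case: ifP => // _); rewrite mulr_ge0// subr_ge0.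
Qed.

Lemma fback_marg_ge0 j g u : 0 <= fback_marg j g u.
Proof. by apply: sumr_ge0 => gam _; rewrite mulr_ge0 ?fback_ge0 ?chan_ge0. Qed.

Section filter.
Variables (pi : probability (psdmx R n) R) (j : 'I_3) (g u : R).

(* The law [distribution pi (kalman gam)] is the push-forward of [pi].  The
   feedback values of probability zero, which are irrelevant, leave [pi]
   unchanged, so that [Phi] is a probability measure. *)
Definition Phi : set (psdmx R n) -> \bar R := fun S =>
  if fback_marg j g u == 0 then pi S else
  (\sum_(gam : bool) (fback j gam * chan gam g u / fback_marg j g u)%:E *
     distribution pi (kalman gam) S)%E.

Let w gam : {nonneg R} := NngNum
  (divr_ge0 (mulr_ge0 (fback_ge0 j gam) (chan_ge0 gam g u))
            (fback_marg_ge0 j g u)).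

Let PhiE : fback_marg j g u != 0 -> Phi =
  measure_add (mscale (w true) (distribution pi (kalman true)))
              (mscale (w false) (distribution pi (kalman false))).
Proof.
move=> h0; apply/funext => S; rewrite /Phi (negbTE h0) measure_addE.
by rewrite big_bool.
Qed.

Let Phi0 : Phi set0 = 0%E.
Proof.
have [h0|h0] := eqVneq (fback_marg j g u) 0; last by rewrite PhiE ?measure0.
by rewrite /Phi h0 eqxx measure0.
Qed.

Let Phi_ge0 S : (0 <= Phi S)%E.
Proof.
have [h0|h0] := eqVneq (fback_marg j g u) 0; last by rewrite PhiE.
by rewrite /Phi h0 eqxx.
Qed.

Let Phi_sigma_additive : semi_sigma_additive Phi.
Proof.
have [h0|h0] := eqVneq (fback_marg j g u) 0; last first.
  by rewrite PhiE//; exact: measure_semi_sigma_additive.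
have -> : Phi = pi by apply/funext => S; rewrite /Phi h0 eqxx.
exact: measure_semi_sigma_additive.
Qed.

HB.instance Definition _ :=
  isMeasure.Build _ _ _ Phi Phi0 Phi_ge0 Phi_sigma_additive.

Let Phi1 : Phi setT = 1%E.
Proof.
rewrite /Phi; case: ifPn => [_|h0]; first exact: probability_setT.
rewrite big_bool !probability_setT !mule1 /= -EFinD -mulrDl.
have := h0; rewrite /fback_marg big_bool /= => h1.
by rewrite divff.
Qed.

HB.instance Definition _ := Measure_isProbability.Build _ _ _ Phi Phi1.

End filter.

(* E[tr(L(P, gamma)) | pi, g, u] *)
Definition stage_cost (pi : probability (psdmx R n) R) (g u : R) : \bar R :=
  (\sum_(gam : bool)
     (chan gam g u)%:E * \int[pi]_P (\tr (kalman gam P))%:E)%E.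

Definition value_fun : Type :=
  probability (psdmx R n) R -> R -> R -> R -> \bar R.

(* The product measure expresses the independence of the next gain [z.1] and
   harvested energy [z.2]; the sum is the expectation over [hgam]. *)
Definition bellman_obj (V : value_fun) (pi : probability (psdmx R n) R)
    (g H B u : R) : \bar R :=
  (stage_cost pi g u +
   \sum_(j < 3) (fback_marg j g u)%:E *
     \int[gainK M g \x harvK M H]_z
       V (Phi pi j g u) z.1 z.2 (Num.min (B - u + z.2) (Bmax M))%R)%E.

(* [l] is the number of stages after the current one.  The infima are minima
   for g, H >= 0 and 0 <= B <= Bmax; this has to be proved. *)
Fixpoint value_to_go (l : nat) : value_fun := fun pi g H B =>
  match l with
  | 0 => ereal_inf [set stage_cost pi g u | u in [set u | 0 <= u <= B]]
  | l'.+1 => ereal_inf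
      [set bellman_obj (value_to_go l') pi g H B u | u in [set u | 0 <= u <= B]]
  end.

Definition value (T k : nat) : value_fun := value_to_go (T - k).

End dynamic_programming.

Definition is_minimum (R : realType) (S : set (\bar R)) (v : \bar R) : Prop :=
  S v /\ lbound S v.

Section probability.
Context d {Omega : measurableType d} {R : realType}.
Variable P : probability Omega R.

Definition sigma_of (X : set (Omega -> R)) : set (set Omega) :=
  <<s \bigcup_(f in X) preimage_set_system setT f measurable >>.

Definition coords n (X : Omega -> 'cV[R]_n) : set (Omega -> R) :=
  [set f | exists i, f = (fun om => X om i 0)].

(* The injections [s] range over the finite subfamilies of [F]. *)
Definition mutually_independent (I : Type) (F : I -> set (set Omega)) : Prop :=
  forall (N : nat) (s : 'I_N -> I) (E : 'I_N -> set Omega),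
    injective s -> (forall i, F (s i) (E i)) ->
    (P (\bigcap_i E i) = \prod_(i < N) P (E i))%E.

(* [p] is a version of the conditional probability of [E] given [F]. *)
Definition cond_prob (F : set (set Omega)) (E : set Omega) (p : Omega -> \bar R)
    : Prop :=
  (forall A, measurable A -> F (p @^-1` A)) /\
  (forall D, F D -> (P (D `&` E) = \int[P]_(om in D) p om)%E).

(* Normal law with mean [mu] and variance [v]; a point mass when [v = 0]. *)
Definition gauss1 (mu v : R) : set R -> \bar R :=
  if v == 0 then \d_mu else normal_prob mu (Num.sqrt v).

(* [X] is a Gaussian vector: every linear form in [X] is normal. *)
Definition gaussian n (X : Omega -> 'cV[R]_n) (mu : 'cV[R]_n) (S : 'M[R]_n)
    : Prop :=
  (forall f, coords X f -> measurable_fun setT f) /\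
  forall (a : 'rV[R]_n) A, measurable A ->
    P [set om | A ((a *m X om) 0 0)] =
      gauss1 ((a *m mu) 0 0) ((a *m S *m a^T) 0 0) A.

(* The start is the constant [x0] because all probabilities and expectations
   are those given the initial information. *)
Definition markov_chain (K : R.-pker R ~> R) (x0 : R)
    (X : nat -> {RV P >-> R}) : Prop :=
  (forall om, X 0%N om = x0) /\
  forall k A, measurable A ->
    cond_prob (sigma_of [set f : Omega -> R | exists2 t, (t <= k)%N & f = X t])
      (X k.+1 @^-1` A) (fun om => K (X k om) A).

End probability.

Section control.
Context {R : realType} {n m : nat} (M : model R n m).
Context d {Omega : measurableType d} (P : probability Omega R).

(* x_{k+1} = A x_k + w_k and y_k = C x_k + v_k with Gaussian x_0, w_k, v_k *)
Record plant (P0 : 'M[R]_n) (x w : nat -> Omega -> 'cV[R]_n)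
    (y v : nat -> Omega -> 'cV[R]_m) : Prop := {
  plant_state : forall k om, x k.+1 om = dynA M *m x k om + w k om ;
  plant_obs : forall k om, y k om = obsC M *m x k om + v k om ;
  plant_init : exists mu, gaussian P (x 0%N) mu P0 ;
  plant_w : forall k, gaussian P (w k) 0 (covQ M) ;
  plant_v : forall k, gaussian P (v k) 0 (covR M) }.

(* The indices of the mutually independent primitive random elements.  The
   sequence [Aux] is only there to make [Omega] rich enough to carry channel
   and feedback outcomes for every control. *)
Inductive source := Init | ProcNoise of nat | MeasNoise of nat
  | Gain | Harvest | Aux of nat.

Definition source_vars (x w : nat -> Omega -> 'cV[R]_n)
    (v : nat -> Omega -> 'cV[R]_m) (g H U : nat -> Omega -> R) (s : source)
    : set (Omega -> R) :=
  match s with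
  | Init => coords (x 0%N)
  | ProcNoise k => coords (w k)
  | MeasNoise k => coords (v k)
  | Gain => range g
  | Harvest => range H
  | Aux k => [set U k]
  end.

Section closed_loop.
Variables (P0 : psdmx R n) (B0 : R).
Variables (x w : nat -> Omega -> 'cV[R]_n) (v : nat -> Omega -> 'cV[R]_m).
Variables (g H : nat -> Omega -> R).
Variables (gam : nat -> Omega -> bool) (hgam : nat -> Omega -> 'I_3).
Variable u : nat -> Omega -> R.

Fixpoint battery (k : nat) (om : Omega) : R :=
  if k is k'.+1 then Num.min (battery k' om - u k' om + H k om) (Bmax M) else B0.

Fixpoint error_cov (k : nat) (om : Omega) : psdmx R n :=
  if k is k'.+1 then kalman M (gam k' om) (error_cov k' om) else P0.

Let rgam k om : R := (gam k om)%:R.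
Let rhgam k om : R := (hgam k om)%:R.

(* The generators of sigma(I_k); the first set is I_0. *)
Definition info (k : nat) : set (Omega -> R) :=
  [set f | [\/ f = g 0%N, f = H 0%N, f = battery 0%N
             | exists i j, f = cst (P0 i j)]] `|`
  [set f | exists2 t, (1 <= t <= k)%N &
             [\/ f = rhgam t.-1, f = g t, f = H t | f = battery t]].

(* Besides the channel and feedback outcomes before time [k], this contains the
   whole plant, gain and energy trajectories: conditioning on their future as
   well expresses that these processes are independent of the mechanisms that
   produce [gam k] (given [g k] and [u k]) and [hgam k] (given [gam k]).  The
   energies [u t], t <= k, are functions of these variables by [adm_u]. *)
Definition past (k : nat) : set (Omega -> R) :=
  coords (x 0%N) `|` (\bigcup_t coords (w t)) `|` (\bigcup_t coords (v t)) `|`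
  range g `|` range H `|`
  [set f | exists2 t, (t < k)%N & f = rgam t \/ f = rhgam t].

Record admissible (T : nat) : Prop := {
  adm_gam : forall k, (k <= T)%N -> measurable_fun setT (rgam k) ;
  adm_hgam : forall k, (k <= T)%N -> measurable_fun setT (rhgam k) ;
  adm_u : forall k, (k <= T)%N ->
    forall A, measurable A -> sigma_of (info k) (u k @^-1` A) ;
  adm_energy : forall k, (k <= T)%N ->
    {ae P, forall om, 0 <= u k om <= battery k om} ;
  adm_channel : forall k, (k <= T)%N ->
    cond_prob P (sigma_of (past k)) [set om | gam k om]
      (fun om => (chan M true (g k om) (u k om))%:E) ;
  adm_feedback : forall k, (k <= T)%N -> forall j : 'I_3,
    cond_prob P (sigma_of (past k `|` [set rgam k])) [set om | hgam k om = j]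
      (fun om => (fback M j (gam k om))%:E) }.

Definition total_cost (T : nat) : \bar R :=
  (\sum_(k < T.+1) 'E_P[fun om => \tr (error_cov k.+1 om)])%E.

End closed_loop.
End control.

(* Main.v *)
Require Import Defs.
From HB Require Import structures.
From mathcomp Require Import all_boot all_order all_algebra.
From mathcomp Require Import all_classical all_reals all_analysis.
From mathcomp Require Import measurable_realfun lra ring.

Set Implicit Arguments.
Unset Strict Implicit.
Unset Printing Implicit Defensive.

Import Order.TTheory GRing.Theory Num.Theory.
Import numFieldTopology.Exports numFieldNormedType.Exports.

Local Open Scope classical_set_scope.
Local Open Scope ring_scope.

(** The value of the control problem is found by the verification argument of
    dynamic programming, carried out on a countable family of numbers instead of
    the belief itself. A belief [pi] enters the costs only through its cost
    profile, the expected traces [path_trace] of the error covariances reached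
    from [P] of law [pi] along the finite words [s] of receptions. On profiles the
    filter [Phi] acts linearly up to a normalization ([belief_profile_Phi]), and
    Bellman's recursion becomes the recursion [W]. Since [W] is positively
    homogeneous ([W_scale]), the normalization cancels against the probability
    of the feedback.

    On finite profiles [W] is jointly measurable and sequentially continuous
    ([regular_W]): the energies in [0, B] are parametrized by the compact unit
    interval, dominated convergence gives the continuity of the function that is
    minimised, and its least minimiser is a measurable function of the data
    ([measurable_arg01]). A belief may have an infinite profile; it is then the
    increasing limit of finite ones. By compactness the minimum commutes with
    this limit ([min01_sup]), so that the value functions are limits of [W] and
    their infima are attained ([value_limitP], [value_minimum]). At the last
    stage the cost decreases with the energy because a reception lowers the
    trace of the error covariance ([stage_cost_nonincreasing]).

    Under an admissible control, the profile updated along the feedback is the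
    conditional expectation of the traces, given the feedback, the gains and the
    energies ([belief_costP]), and the feedback says nothing on the next gain and
    energy beyond the present ones ([markov]). Hence the expected cost of a stage
    plus the expected value after it is the expectation of the function minimised
    by [W] ([expected_recursion]). It is at least the expected value before the
    stage, with equality when the energy is a minimiser; summation over the
    stages bounds the cost of every control by the value ([expected_value_le])
    and gives equality for the minimising control ([expected_value_eq]). That
    control is a function of the available information ([measurable_opt]), and
    its receptions and feedbacks are drawn by comparing independent uniform
    variables with the prescribed conditional probabilities
    ([opt_admissible]). *)

(** * Minimisation over the unit interval *)

(** A neighbourhood of [l] whose preimage is not in [F] is missed at some point of
    every [U k], hence along a sequence. Continuity can therefore be derived
    from dominated convergence, which speaks of sequences. *)
Lemma cvg_of_sequences (I : Type) (Y : topologicalType) (F : set_system I)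
    (FF : Filter F) (U : nat -> set I) (f : I -> Y) (l : Y) :
  (forall k, F (U k)) ->
  (forall s : nat -> I, (forall k, U k (s k)) -> f (s k) @[k --> \oo] --> l) ->
  f @ F --> l.
Proof.
move=> FU fs A Al; apply: contrapT => nFA.
have bad k : exists i, U k i /\ ~ A (f i).
  apply: contrapT => nk; apply: nFA; apply: (@filterS _ F _ (U k)) (FU k) => i Ui.
  by apply: contrapT => nA; apply: nk; exists i.
have [s sP] := choice bad.
have /(_ _ Al) [N _ sN] := fs s (fun k => (sP k).1).
by have [_] := sP N; apply; apply: sN => /=.
Qed.

Section cvg_max_min.
Context {R : realType} {I : Type} {F : set_system I} {FF : Filter F}.
Implicit Types f g : I -> R.

Lemma cvg_maxr f g a b : f @ F --> a -> g @ F --> b ->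
  Num.max (f x) (g x) @[x --> F] --> Num.max a b.
Proof.
move=> fa gb; rewrite maxr_absE; under eq_fun do rewrite maxr_absE.
by apply: cvgMr_tmp; apply: cvgD; [exact: cvgD|apply: cvg_norm; exact: cvgB].
Qed.

Lemma cvg_minr f g a b : f @ F --> a -> g @ F --> b ->
  Num.min (f x) (g x) @[x --> F] --> Num.min a b.
Proof.
move=> fa gb; rewrite minr_absE; under eq_fun do rewrite minr_absE.
by apply: cvgMr_tmp; apply: cvgB; [exact: cvgD|apply: cvg_norm; exact: cvgB].
Qed.

Lemma cvg_sum_bool (f : bool -> I -> R) (a : bool -> R) :
  (forall b, f b @ F --> a b) ->
  (\sum_(b : bool) f b x) @[x --> F] --> \sum_(b : bool) a b.
Proof.
by move=> fa; rewrite big_bool; under eq_fun do rewrite big_bool; exact: cvgD.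
Qed.

End cvg_max_min.

Section unit_interval.
Context {R : realType}.
Implicit Types (F : R -> \bar R) (t : R).

Definition unitI : set R := [set t | 0 <= t <= 1].

Definition min01 F : \bar R := ereal_inf (F @` unitI).

(** The least minimiser; a canonical choice is needed for measurability. *)
Definition arg01 F : R := inf [set t | unitI t /\ (F t <= min01 F)%E].

Lemma cvg_ball_seq (s : nat -> R) t :
  (forall k, ball t k.+1%:R^-1 (s k)) -> s k @[k --> \oo] --> t.
Proof.
move=> st; apply/cvgrPdist_lt => e e0.
near=> k; apply: (@lt_trans _ _ k.+1%:R^-1); first exact: (st k).
by near: k; exact: near_infty_natSinv_lt (PosNum e0).
Unshelve. all: by end_near. Qed.

Lemma continuous_of_sequences (Y : topologicalType) (f : R -> Y) t :
  (forall s : nat -> R, s k @[k --> \oo] --> t -> f (s k) @[k --> \oo] --> f t) ->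
  {for t, continuous f}.
Proof.
move=> fs; apply: (@cvg_of_sequences _ _ _ _ (fun k => ball t k.+1%:R^-1)).
  by move=> k; apply: (@nbhsx_ballx _ R^o); rewrite invr_gt0.
by move=> s /cvg_ball_seq; exact: fs.
Qed.

Lemma min01_le F t : unitI t -> (min01 F <= F t)%E.
Proof. by move=> t01; apply: ereal_inf_lbound; exists t. Qed.

Lemma le_min01 F m : (forall t, unitI t -> (m <= F t)%E) -> (m <= min01 F)%E.
Proof. by move=> h; apply: le_ereal_inf_tmp => _ [t t01 <-]; exact: h. Qed.

Lemma min01_ge0 F : (forall t, 0 <= F t)%E -> (0 <= min01 F)%E.
Proof. by move=> F0; apply: le_min01 => t _. Qed.

Section attained.
Variable F : R -> \bar R.
Hypotheses (F0 : forall t, (0 <= F t)%E) (Foo : forall t, (F t < +oo)%E).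
Hypothesis cF : continuous F.

Let finF t : F t \is a fin_num.
Proof. by rewrite ge0_fin_numE. Qed.

Let cfF : continuous (fine \o F).
Proof.
move=> t; suff /fine_cvgP[] : F x @[x --> t] --> (fine (F t))%:E by [].
by rewrite fineK//; exact: cF.
Qed.

Lemma min01_attained : exists2 t, unitI t & F t = min01 F.
Proof.
have [t t01 tF] := EVT_min (@ler01 R) (continuous_subspaceT cfF).
exists t; first by move: t01; rewrite in_itv.
apply/eqP; rewrite eq_le min01_le ?andbT; last by move: t01; rewrite in_itv.
apply: le_min01 => u u01; rewrite -(fineK (finF t)) -(fineK (finF u)) lee_fin.
by apply: tF; rewrite in_itv.
Qed.

Lemma arg01P : unitI (arg01 F) /\ F (arg01 F) = min01 F.
Proof.
set S := [set t | unitI t /\ (F t <= min01 F)%E].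
have S0 : S !=set0.
  by have [t t01 tF] := min01_attained; exists t; split=> //; rewrite tF.
have lbS : has_lbound S by exists 0 => t [/andP[]].
have cS : closed S.
  have -> : S = `[0, 1]%classic `&` [set t | (fine (F t) <= fine (min01 F))].
    have [t0 _ t0F] := min01_attained.
    apply/seteqP; split=> t /=; rewrite in_itv/=.
      by case=> t01 Ft; split => //; rewrite fine_le// -t0F.
    by case=> t01 Ft; split => //; rewrite -(fineK (finF t)) -t0F -(fineK (finF t0)) lee_fin t0F.
  apply: closedI; first exact: interval_closed.
  rewrite (_ : [set _ | _] = (fine \o F) @^-1` [set x | x <= fine (min01 F)])//.
  by apply: closed_comp => // t _; exact: cfF.
have : S (inf S).
  apply: cS => A /nbhs_ballP[e /= e0 eA].
  have [t St te] := inf_adherent e0 (conj S0 lbS).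
  exists t; split=> //; apply: eA; rewrite /ball/= ltr_norml.
  have h : inf S <= t := ge_inf lbS St.
  by apply/andP; split; lra.
by case=> h1 h2; split => //; apply/eqP; rewrite eq_le h2 min01_le.
Qed.

End attained.

(** Convergence along all sequences of indices and points is convergence along
    the product filter at each point; compactness makes the lower bound
    uniform. *)
Lemma min01_cvg (Fn : nat -> R -> \bar R) (F : R -> \bar R) :
  (forall n t, (0 <= Fn n t)%E) -> (forall n t, (Fn n t < +oo)%E) ->
  (forall n, continuous (Fn n)) ->
  (forall t, (0 <= F t)%E) -> (forall t, (F t < +oo)%E) -> continuous F ->
  (forall (phi : nat -> nat) (s : nat -> R) t,
     (forall k, k <= phi k)%N -> s k @[k --> \oo] --> t ->
     Fn (phi k) (s k) @[k --> \oo] --> F t) ->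
  min01 (Fn n) @[n --> \oo] --> min01 F.
Proof.
move=> Fn0 Fnoo cFn F0 Foo cF FnF.
have [t0 t001 t0F] := min01_attained F0 Foo cF.
have fm : min01 F \is a fin_num by rewrite -t0F ge0_fin_numE.
have fn n : min01 (Fn n) \is a fin_num.
  have [t _ <-] := min01_attained (Fn0 n) (Fnoo n) (cFn n).
  by rewrite ge0_fin_numE.
rewrite -(fineK fm); apply/fine_cvgP; split; first exact: nearW.
have joint t : (fun p : R * nat => Fn p.2 p.1) @ filter_prod (nbhs t) \oo --> F t.
  apply: (@cvg_of_sequences _ _ _ _
    (fun k => [set p : R * nat | ball t k.+1%:R^-1 p.1 /\ (k <= p.2)%N])).
    move=> k; exists (ball t k.+1%:R^-1, [set n | (k <= n)%N]) => //=.
    by split; [apply: (@nbhsx_ballx _ R^o); rewrite invr_gt0|exists k].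
  move=> s sP; apply: FnF; first by move=> k; have [] := sP k.
  by apply: cvg_ball_seq => k; have [] := sP k.
apply/cvgrPdist_lt => e e0.
have low : \forall n \near \oo, unitI `<=`
    [set t | (min01 F - e%:E < Fn n t)%E].
  have cpt : compact unitI.
    rewrite (_ : unitI = `[0, 1]%classic); first exact: segment_compact.
    by apply/seteqP; split=> t; rewrite /unitI /= in_itv.
  apply: (compact_near_coveringP unitI).1 => //.
  move=> t t01; apply: (joint t [set x | (min01 F - e%:E < x)%E]).
  apply: open_nbhs_nbhs; split.
    exact: (@open_ereal_gt_ereal _ (min01 F - e%:E)%E).
  rewrite /=; apply: (lt_le_trans _ (min01_le F t01)).
  by rewrite -(fineK fm) -EFinD lte_fin; have : 0 < e by []; lra.
have up : \forall n \near \oo, (Fn n t0 < min01 F + e%:E)%E.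
  apply: (FnF id (fun=> t0) t0 (fun k => leqnn k) (cvg_cst _)
    [set x | (x < min01 F + e%:E)%E]).
  apply: open_nbhs_nbhs; split.
    exact: (@open_ereal_lt_ereal _ (min01 F + e%:E)%E).
  by rewrite /= t0F lteDl// lte_fin.
near=> n.
have lown : unitI `<=` [set t | (min01 F - e%:E < Fn n t)%E] by near: n.
have upn : (Fn n t0 < min01 F + e%:E)%E by near: n.
have [t t01 tF] := min01_attained (Fn0 n) (Fnoo n) (cFn n).
have := lown t t01; rewrite /= tF => {}lown.
have {}upn := le_lt_trans (min01_le _ t001) upn.
move: lown upn; rewrite -(fineK fm) -(fineK (fn n)) -EFinB -EFinD !lte_fin.
by rewrite ltr_norml /= => h1 h2; apply/andP; split; lra.
Unshelve. all: by end_near. Qed.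

(** If each point of the unit interval had some [Fn n] above the supremum [m] of
    the minima, then by compactness a single [Fn n] would lie above [m] on the
    whole interval and its minimum would exceed [m]. *)
Lemma min01_sup (Fn : nat -> R -> \bar R) :
  (forall n t, (0 <= Fn n t)%E) -> (forall n t, (Fn n t < +oo)%E) ->
  (forall n, continuous (Fn n)) ->
  (forall t n p, (n <= p)%N -> (Fn n t <= Fn p t)%E) ->
  exists2 t, unitI t &
    ereal_sup [set Fn n t | n in setT] = ereal_sup [set min01 (Fn n) | n in setT].
Proof.
move=> Fn0 Fnoo cFn Fnd; set m := ereal_sup [set min01 (Fn n) | n in setT].
have mle t : unitI t -> (m <= ereal_sup [set Fn n t | n in setT])%E.
  move=> t01; apply: ge_ereal_sup => _ [n _ <-].
  by apply: (le_trans (min01_le _ t01)); apply: ereal_sup_ubound; exists n.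
suff [t t01 tm] : exists2 t, unitI t & forall n, (Fn n t <= m)%E.
  exists t => //; apply/eqP; rewrite eq_le mle// andbT.
  by apply: ge_ereal_sup => _ [n _ <-].
apply: contrapT => nt.
have cpt : compact unitI.
  rewrite (_ : unitI = `[0, 1]%classic); first exact: segment_compact.
  by apply/seteqP; split=> t; rewrite /unitI /= in_itv.
have : \forall n \near \oo, unitI `<=` [set t | (m < Fn n t)%E].
  apply: (compact_near_coveringP unitI).1 => // t t01.
  have [n mn] : exists n, (m < Fn n t)%E.
    apply: contrapT => h; apply: nt; exists t => // n; rewrite leNgt.
    by apply/negP => mn; apply: h; exists n.
  exists ([set u | (m < Fn n u)%E], [set p | (n <= p)%N]) => /=.
    split; last by exists n.
    apply: (cFn n t [set x | (m < x)%E]); apply: open_nbhs_nbhs; split => //.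
    exact: open_ereal_gt_ereal.
  by move=> [u p] /= [mu np]; exact: lt_le_trans (Fnd _ _ _ np).
case=> N _ /(_ N (leqnn N)) mN.
have [t t01 tF] := min01_attained (Fn0 N) (Fnoo N) (cFn N).
have := mN t t01; rewrite /= tF ltNge => /negP; apply.
by apply: ereal_sup_ubound; exists N.
Qed.

Section measurable.
Context d (X : measurableType d).
Variable F : X -> R -> \bar R.
Hypotheses (F0 : forall x t, (0 <= F x t)%E) (Foo : forall x t, (F x t < +oo)%E).
Hypotheses (cF : forall x, continuous (F x)).
Hypothesis mF : forall t, measurable_fun setT (F ^~ t).

Let clamp (t : R) : R := Num.max 0 (Num.min t 1).

Let clamp01 t : unitI (clamp t).
Proof. by rewrite /unitI /clamp /= le_max lexx/= ge_max ler01 ge_min lexx orbT. Qed.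

Let clampK t : unitI t -> clamp t = t.
Proof. by case/andP=> t0 t1; rewrite /clamp min_l// max_r. Qed.

Let continuous_clamp : continuous clamp.
Proof.
move=> t; apply: cvg_maxr; first exact: cvg_cst.
by apply: cvg_minr; [exact: cvg_id|exact: cvg_cst].
Qed.

(** The infimum over rational points is the same by continuity. Clamping sends
    the rational points into the unit interval. *)
Lemma measurable_min01 : measurable_fun setT (fun x => min01 (F x)).
Proof.
move=> _; apply: (measurability _ (ErealGenInftyO.measurableE R)) => //.
move=> _ [_ [y ->] <-]; rewrite setTI.
rewrite [X in measurable X](_ : _ = \bigcup_(q : rat)
    [set x | (F x (clamp (ratr q)) < y%:E)%E]); last first.
  apply/seteqP; split=> x /=; rewrite in_itv/=; last first.
    by case=> q _; apply: le_lt_trans; exact: min01_le.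
  case/ereal_inf_lt => _ [t t01 <-] Fty.
  have cG : continuous (F x \o clamp).
    by move=> u; apply: continuous_comp; [exact: continuous_clamp|exact: cF].
  have op : open ((F x \o clamp) @^-1` [set z | (z < y%:E)%E]).
    by apply: open_comp => [u _|]; [exact: cG|exact: open_ereal_lt_ereal].
  have [|u [] uy [q _ qu]] := @dense_rat R _ _ op.
    by exists t; rewrite /= clampK.
  by exists q => //; rewrite /= qu.
apply: bigcupT_measurable_rat => q.
by rewrite -[X in measurable X]setTI; exact: emeasurable_fun_infty_o.
Qed.

End measurable.

(** The least minimiser exceeds [a] exactly when the minimum over [0, a] exceeds
    the minimum over the unit interval, and both minima are measurable. *)
Lemma measurable_arg01 d (X : measurableType d) (F : X -> R -> \bar R) :
  (forall x t, (0 <= F x t)%E) -> (forall x t, (F x t < +oo)%E) ->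
  (forall x, continuous (F x)) ->
  (forall t, measurable_fun setT (F ^~ t)) ->
  measurable_fun setT (fun x => arg01 (F x)).
Proof.
move=> F0 Foo cF mF _; apply: (measurability _ (RGenOInfty.measurableE R)) => //.
move=> _ [_ [a ->] <-]; rewrite setTI.
have argP x := arg01P (F0 x) (Foo x) (cF x).
have [a0|a0] := ltP a 0.
  rewrite (_ : _ @^-1` _ = setT)//; apply/seteqP; split=> x //= _.
  by rewrite in_itv/= andbT; have [/andP[+ _] _] := argP x; exact: lt_le_trans.
have [a1|a1] := ltP 1 a.
  rewrite (_ : _ @^-1` _ = set0)//; apply/seteqP; split=> x //=.
  rewrite in_itv/= andbT; have [/andP[_ r1] _] := argP x => ar.
  by move: (lt_trans a1 (lt_le_trans ar r1)); rewrite ltxx.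
pose Fa x s := F x (a * s).
have cFa x : continuous (Fa x).
  by move=> s; apply: continuous_comp; [exact: mulrl_continuous|exact: cF].
have m1 : measurable_fun setT (fun x => min01 (Fa x)).
  by apply: measurable_min01 => // t; exact: mF.
have m2 : measurable_fun setT (fun x => min01 (F x)) by exact: measurable_min01.
rewrite (_ : _ @^-1` _ = [set x | (min01 (F x) < min01 (Fa x))%E]); last first.
  apply/seteqP; split=> x /=; rewrite in_itv/= andbT; have [/andP[r0 r1] rF] := argP x.
    (* A minimiser in [0, a] would be smaller than the least one. *)
    move=> ar; rewrite ltNge; apply/negP => h.
    have [s /andP[s0 s1] sF] := min01_attained (fun s => F0 x (a * s))
      (fun s => Foo x (a * s)) (cFa x).
    have : arg01 (F x) <= a * s.
      apply: ge_inf; first by exists 0 => t [/andP[]].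
      split; last by move: h; rewrite -sF.
      by rewrite /unitI /= mulr_ge0//= mulr_ile1.
    by move/(lt_le_trans ar); rewrite ltNge ler_piMr.
  rewrite !ltNge; apply: contra => ra; rewrite -rF.
  have [a00|a0'] := eqVneq a 0.
    have -> : arg01 (F x) = a * 0.
      by rewrite mulr0; apply/eqP; rewrite eq_le r0 -a00 ra.
    by apply: (@min01_le (Fa x)); rewrite /unitI/= lexx ler01.
  have -> : arg01 (F x) = a * (arg01 (F x) / a) by rewrite mulrCA divff// mulr1.
  apply: (@min01_le (Fa x)).
  have ap : 0 < a by rewrite lt0r a0' a0.
  by rewrite /unitI /= divr_ge0//= ler_pdivrMr// mul1r.
rewrite -[X in measurable X]setTI.
exact: measurable_lte.
Qed.

End unit_interval.

(** * Kernels with parameters *)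

Section kernel_pullback.
Context d d1 d2 (X : measurableType d) (S : measurableType d1)
  (T : measurableType d2) {R : realType}.
Variables (k : R.-pker S ~> T) (f : X -> S) (mf : measurable_fun setT f).

(* The measurability proof is an argument so that the instances below can depend
   on it. *)
Definition kpull of measurable_fun setT f : X -> {measure set T -> \bar R} :=
  fun x => k (f x).

Let kpull_measurable U : measurable U ->
  measurable_fun [set: X] (kpull mf ^~ U).
Proof. by move=> mU; exact: measurableT_comp (measurable_kernel k _ mU) mf. Qed.

HB.instance Definition _ :=
  isKernel.Build _ _ X T R (kpull mf) kpull_measurable.

Let kpull_setT x : kpull mf x setT = 1%E.
Proof. exact: prob_kernel. Qed.

HB.instance Definition _ :=
  Kernel_isProbability.Build _ _ X T R (kpull mf) kpull_setT.

Lemma measurable_integral_kpull (h : X * T -> \bar R) :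
  (forall z, 0 <= h z)%E -> measurable_fun setT h ->
  measurable_fun setT (fun x => \int[k (f x)]_y h (x, y))%E.
Proof.
by move=> h0 mh; exact: (measurable_fun_integral_sfinite_kernel h (kpull mf)).
Qed.

End kernel_pullback.

(** A copy of [k x] that carries the structure of a probability measure. *)
Section kernel_probability.
Context {d d'} {X : measurableType d} {Y : measurableType d'} {R : realType}.

Definition kprob (k : R.-pker X ~> Y) (x : X) : set Y -> \bar R := k x.

HB.instance Definition _ (k : R.-pker X ~> Y) x := Measure.on (kprob k x).
HB.instance Definition _ (k : R.-pker X ~> Y) x :=
  Measure_isProbability.Build _ _ _ (kprob k x) (@prob_kernel _ _ _ _ _ k x).

End kernel_probability.

Section kernel_pair.
Context d1 d2 d3 d4 (S1 : measurableType d1) (T1 : measurableType d2)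
  (S2 : measurableType d3) (T2 : measurableType d4) {R : realType}.
Variables (k1 : R.-pker S1 ~> T1) (k2 : R.-pker S2 ~> T2).

Definition kpair (z : S1 * S2) : {measure set (T1 * T2) -> \bar R} :=
  (kprob k1 z.1 \x kprob k2 z.2)%E.

Let kpair_measurable U : measurable U ->
  measurable_fun [set: S1 * S2]
    (kpair ^~ U).
Proof.
move=> mU.
have m1 : measurable_fun [set: S1 * S2] fst by exact: measurable_fst.
have m2 : measurable_fun [set: (S1 * S2) * T1] (fun p => p.1.2).
  exact: measurableT_comp.
apply: (measurable_integral_kpull k1 m1
  (h := fun p : (S1 * S2) * T1 => k2 p.1.2 (xsection U p.2))) => //.
pose A : set (((S1 * S2) * T1) * T2) := [set q | U (q.1.2, q.2)].
have mA : measurable A.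
  rewrite -[A]setTI.
  apply: (_ : measurable_fun setT (fun q : ((S1 * S2) * T1) * T2 => (q.1.2, q.2))) => //.
  by apply: measurable_fun_pair; [exact: measurableT_comp|exact: measurable_snd].
have := @measurable_fun_xsection_finite_kernel _ _ _ _ _ (kpull k2 m2) A.
by rewrite inE => /(_ mA).
Qed.

HB.instance Definition _ :=
  isKernel.Build _ _ (S1 * S2)%type (T1 * T2)%type R kpair kpair_measurable.

Let kpair_setT x : kpair x setT = 1%E.
Proof.
transitivity ((kprob k1 x.1 \x kprob k2 x.2)%E (setT `*` setT)).
  by rewrite setXTT.
transitivity (kprob k1 x.1 setT * kprob k2 x.2 setT)%E.
  exact: product_measure1E.
rewrite (_ : kprob k1 x.1 setT = 1%E); last exact: prob_kernel.
by rewrite (_ : kprob k2 x.2 setT = 1%E) ?mule1//; exact: prob_kernel.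
Qed.

HB.instance Definition _ :=
  Kernel_isProbability.Build _ _ (S1 * S2)%type (T1 * T2)%type R kpair kpair_setT.

End kernel_pair.

(** * The dynamic programming recursion on cost profiles *)

Section recursion.
Context {R : realType} {n m : nat} (M : model R n m).
Implicit Types (c : seq bool -> R) (g H B u : R).

(** The cost profile after the feedback [j], times the probability of [j]. The
    reception of the current stage becomes the first letter of the words. *)
Definition upd (j : 'I_3) g u c : seq bool -> R :=
  fun s => \sum_(gam : bool) fback M j gam * chan M gam g u * c (gam :: s).

Definition step_cost g u c : R := \sum_(gam : bool) chan M gam g u * c [:: gam].

(** The function that Bellman's equation minimises, in terms of profiles. The
    weights of the feedback values are inside the arguments [upd j g u c] of [V],
    which is legitimate for homogeneous [V]. *)
Definition Qf (V : (seq bool -> R) -> R -> R -> R -> \bar R) c g H B u : \bar R :=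
  ((step_cost g u c)%:E +
   \sum_(j < 3) \int[kprob (kpair (gainK M) (harvK M)) (g, H)]_z
     V (upd j g u c) z.1 z.2 (Num.min (B - u + z.2) (Bmax M))%R)%E.

(** The index [l] counts the stages that remain, the current one included. The
    energies in [0, B] are the multiples [t * B] with [t] in the unit interval, so
    that the domain of the minimum does not depend on [B]; the maximum with 0
    makes the recursion meaningful for all real [B]. *)
Fixpoint W (l : nat) c g H B : \bar R :=
  if l is l'.+1 then min01 (fun t => Qf (W l') c g H B (t * Num.max 0 B))
  else 0%E.

Definition ge0_profile c := forall s, 0 <= c s.

(** All the probabilities are replaced by 1; the factor 3 counts the values of the
    feedback. *)
Fixpoint cost_bound (l : nat) c : R :=
  if l is l'.+1 then c [:: true] + c [:: false] +
    3 * cost_bound l' (fun s => c (true :: s) + c (false :: s))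
  else 0.

Lemma chanD g u : chan M true g u + chan M false g u = 1.
Proof. by rewrite /chan /= addrC subrK. Qed.

Lemma chan_le1 gam g u : chan M gam g u <= 1.
Proof.
rewrite -(chanD g u); case: gam; first by rewrite lerDl chan_ge0.
by rewrite lerDr chan_ge0.
Qed.

Lemma fback_sum gam : \sum_(j < 3) fback M j gam = 1.
Proof.
by rewrite !big_ord_recl big_ord0 /fback /=; case: gam => /=; ring.
Qed.

Lemma fback_le1 j gam : fback M j gam <= 1.
Proof.
rewrite -(fback_sum gam) (bigD1 j)//= lerDl sumr_ge0// => i _.
exact: fback_ge0.
Qed.

Lemma upd_ge0 j g u c : ge0_profile c -> ge0_profile (upd j g u c).
Proof.
by move=> c0 s; apply: sumr_ge0 => gam _; rewrite !mulr_ge0 ?fback_ge0 ?chan_ge0.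
Qed.

(** A feedback of probability zero has all its joint probabilities with the
    receptions equal to zero. *)
Lemma upd_null j g u c : fback_marg M j g u = 0 -> upd j g u c = fun=> 0.
Proof.
move=> h0; apply/funext => s; rewrite /upd big1// => gam _.
have : \sum_(b : bool) fback M j b * chan M b g u == 0.
  by rewrite -[X in X == _]/(fback_marg M j g u) h0.
rewrite psumr_eq0 => [/allP/(_ gam)|b _]; last first.
  by rewrite mulr_ge0 ?fback_ge0 ?chan_ge0.
by rewrite mem_index_enum => /(_ isT)/= /eqP ->; rewrite mul0r.
Qed.

Lemma fback_marg_updK j g u c s :
  fback_marg M j g u * ((fback_marg M j g u)^-1 * upd j g u c s) = upd j g u c s.
Proof.
have [h0|h0] := eqVneq (fback_marg M j g u) 0; last by rewrite mulrA divff// mul1r.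
by rewrite upd_null// h0 !mul0r.
Qed.

Lemma upd_le j g u c c' : ge0_profile c -> (forall s, c s <= c' s) ->
  forall s, upd j g u c s <= c' (true :: s) + c' (false :: s).
Proof.
move=> c0 cc' s; rewrite /upd big_bool /=.
have w1 gam : fback M j gam * chan M gam g u <= 1.
  by rewrite mulr_ile1 ?fback_ge0 ?chan_ge0 ?fback_le1 ?chan_le1.
by apply: lerD; apply: (le_trans _ (cc' _)); rewrite ler_piMl.
Qed.

Lemma step_cost_ge0 g u c : ge0_profile c -> 0 <= step_cost g u c.
Proof. by move=> c0; apply: sumr_ge0 => gam _; rewrite mulr_ge0 ?chan_ge0. Qed.

Lemma step_cost_le g u c : ge0_profile c ->
  step_cost g u c <= c [:: true] + c [:: false].
Proof.
move=> c0; rewrite /step_cost big_bool.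
by apply: lerD; apply: ler_piMl => //; exact: chan_le1.
Qed.

Lemma cost_bound_le l c c' : (forall s, c s <= c' s) ->
  cost_bound l c <= cost_bound l c'.
Proof.
elim: l c c' => //= l IH c c' cc'; rewrite !lerD// ler_pM2l// IH// => s.
by rewrite lerD.
Qed.

Let recvp (x : R) : R := recv M (Num.max 0 x).

(** The reception probability is continuous on the half-line only, where the
    maximum with 0 takes its values. *)
Lemma continuous_recv_max : continuous recvp.
Proof.
move=> x; pose A := `[(0 : R), +oo[%classic.
have Ax : A (Num.max 0 x) by rewrite /A/= in_itv/= andbT le_max lexx.
have h : recv M @ within A (nbhs (Num.max 0 x)) --> recv M (Num.max 0 x).
  by rewrite (nbhs_subspace_in Ax); exact: recv_continuous.
have hm : Num.max 0 y @[y --> x] --> Num.max 0 x.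
  by apply: cvg_maxr; [exact: cvg_cst|exact: cvg_id].
move=> P /h hP.
have h3 : nbhs x (fun y => A (Num.max 0 y) -> P (recv M (Num.max 0 y))).
  exact: (hm _ hP).
change (nbhs x (fun y => P (recv M (Num.max 0 y)))).
apply: filterS h3 => y; apply.
by rewrite /A/= in_itv/= andbT le_max lexx.
Qed.

Lemma measurable_chan d (X : measurableType d) (g u : X -> R) gam :
  measurable_fun setT g -> measurable_fun setT u ->
  measurable_fun setT (fun x => chan M gam (g x) (u x)).
Proof.
move=> mg mu; have mr : measurable_fun setT (fun x => recvp (g x * u x)).
  apply: measurableT_comp; last exact: measurable_funM.
  exact: continuous_measurable_fun continuous_recv_max.
by case: gam => //; apply: measurable_funB => //; exact: measurable_cst.
Qed.

Lemma cvg_chan (I : Type) (F : set_system I) (FF : Filter F) (u : I -> R) g gam a :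
  u @ F --> a -> chan M gam g (u i) @[i --> F] --> chan M gam g a.
Proof.
move=> ua; have hr : recvp (g * u i) @[i --> F] --> recvp (g * a).
  by apply: continuous_cvg; [exact: continuous_recv_max|exact: cvgMl_tmp].
by case: gam => //; apply: cvgB => //; exact: cvg_cst.
Qed.

End recursion.

Section recursion_regularity.
Context {R : realType} {n m : nat} (M : model R n m).
Implicit Types (c : seq bool -> R) (g H B u : R).

Local Notation nextK := (kpair (gainK M) (harvK M)).

(** What the induction on the number of stages carries: measurability is
    stated for all measurable parametrisations of the arguments and continuity
    for all sequences, so that no structure on the space of cost profiles is
    involved. *)
Record regular (b : (seq bool -> R) -> R)
    (V : (seq bool -> R) -> R -> R -> R -> \bar R) : Prop := {
  regular_ge0 : forall c g H B, ge0_profile c -> (0 <= V c g H B)%E ;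
  regular_le : forall c g H B, ge0_profile c -> (V c g H B <= (b c)%:E)%E ;
  regular_measurable : forall d (X : measurableType d)
      (c : X -> seq bool -> R) (g H B : X -> R),
    (forall x, ge0_profile (c x)) ->
    (forall s, measurable_fun setT (fun x => c x s)) ->
    measurable_fun setT g -> measurable_fun setT H -> measurable_fun setT B ->
    measurable_fun setT (fun x => V (c x) (g x) (H x) (B x)) ;
  regular_cvg : forall (cn : nat -> seq bool -> R) c c' g H (Bn : nat -> R) B,
    (forall k, ge0_profile (cn k)) -> (forall k s, cn k s <= c' s) ->
    ge0_profile c -> (forall s, cn k s @[k --> \oo] --> c s) ->
    Bn k @[k --> \oo] --> B ->
    V (cn k) g H (Bn k) @[k --> \oo] --> V c g H B }.

Lemma measurable_upd d (X : measurableType d) (c : X -> seq bool -> R)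
    (g u : X -> R) j s :
  (forall s, measurable_fun setT (fun x => c x s)) ->
  measurable_fun setT g -> measurable_fun setT u ->
  measurable_fun setT (fun x => upd M j (g x) (u x) (c x) s).
Proof.
move=> mc mg mu; apply: measurable_sum => gam; apply: measurable_funM => //.
by apply: measurable_funM; [exact: measurable_cst|exact: measurable_chan].
Qed.

Lemma measurable_step_cost d (X : measurableType d) (c : X -> seq bool -> R)
    (g u : X -> R) :
  (forall s, measurable_fun setT (fun x => c x s)) ->
  measurable_fun setT g -> measurable_fun setT u ->
  measurable_fun setT (fun x => step_cost M (g x) (u x) (c x)).
Proof.
move=> mc mg mu; apply: measurable_sum => gam; apply: measurable_funM => //.
exact: measurable_chan.
Qed.

Section step.
Variables (l : nat) (V : (seq bool -> R) -> R -> R -> R -> \bar R).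
Hypothesis rV : regular (@cost_bound R l) V.

Lemma measurable_next d (X : measurableType d) (c : X -> seq bool -> R)
    (g B u : X -> R) j :
  (forall x, ge0_profile (c x)) ->
  (forall s, measurable_fun setT (fun x => c x s)) ->
  measurable_fun setT g -> measurable_fun setT B -> measurable_fun setT u ->
  measurable_fun setT (fun p : X * (R * R) =>
    V (upd M j (g p.1) (u p.1) (c p.1)) p.2.1 p.2.2
      (Num.min (B p.1 - u p.1 + p.2.2) (Bmax M))).
Proof.
move=> c0 mc mg mB mu.
have m1 (f : X -> R) : measurable_fun setT f ->
    measurable_fun setT (fun p : X * (R * R) => f p.1).
  by move=> mf; exact: measurableT_comp mf measurable_fst.
have m22 : measurable_fun setT (fun p : X * (R * R) => p.2.2).
  exact: measurableT_comp measurable_snd measurable_snd.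
apply: (regular_measurable rV) => //.
- by move=> p; exact: upd_ge0.
- move=> s; apply: measurable_upd => [s'| |]; first exact: (m1 (fun x => c x s')).
    exact: m1.
  exact: m1.
- exact: measurableT_comp measurable_fst measurable_snd.
- apply: measurable_minr; last exact: measurable_cst.
  by apply: measurable_funD => //; apply: measurable_funB; exact: m1.
Qed.

Lemma measurable_next_stage c g B u j : ge0_profile c ->
  measurable_fun setT (fun z : R * R =>
    V (upd M j g u c) z.1 z.2 (Num.min (B - u + z.2) (Bmax M))).
Proof.
move=> c0; apply: (regular_measurable rV) => //.
- by move=> p; exact: upd_ge0.
- apply: measurable_minr; last exact: measurable_cst.
  by apply: measurable_funD.
Qed.

Lemma measurable_next_integral d (X : measurableType d) (c : X -> seq bool -> R)
    (g H B u : X -> R) j :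
  (forall x, ge0_profile (c x)) ->
  (forall s, measurable_fun setT (fun x => c x s)) ->
  measurable_fun setT g -> measurable_fun setT H -> measurable_fun setT B ->
  measurable_fun setT u ->
  measurable_fun setT (fun x => \int[kprob nextK (g x, H x)]_z
    V (upd M j (g x) (u x) (c x)) z.1 z.2 (Num.min (B x - u x + z.2) (Bmax M))%R)%E.
Proof.
move=> c0 mc mg mH mB mu.
have mgH : measurable_fun setT (fun x => (g x, H x)) by exact: measurable_fun_pair.
apply: (measurable_integral_kpull nextK mgH (h := fun p : X * (R * R) =>
    V (upd M j (g p.1) (u p.1) (c p.1)) p.2.1 p.2.2
      (Num.min (B p.1 - u p.1 + p.2.2) (Bmax M)))).
  by move=> p; apply: (regular_ge0 rV); exact: upd_ge0.
exact: measurable_next.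
Qed.

Lemma measurable_Qf d (X : measurableType d) (c : X -> seq bool -> R)
    (g H B u : X -> R) :
  (forall x, ge0_profile (c x)) ->
  (forall s, measurable_fun setT (fun x => c x s)) ->
  measurable_fun setT g -> measurable_fun setT H -> measurable_fun setT B ->
  measurable_fun setT u ->
  measurable_fun setT (fun x => Qf M V (c x) (g x) (H x) (B x) (u x)).
Proof.
move=> c0 mc mg mH mB mu; apply: emeasurable_funD.
  by apply/measurable_EFinP; exact: measurable_step_cost.
by apply: emeasurable_sum => j; exact: measurable_next_integral.
Qed.

Lemma Qf_ge0 c g H B u : ge0_profile c -> (0 <= Qf M V c g H B u)%E.
Proof.
move=> c0; apply: adde_ge0; first by rewrite lee_fin step_cost_ge0.
apply: sume_ge0 => j _; apply: integral_ge0 => z _.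
by apply: (regular_ge0 rV); exact: upd_ge0.
Qed.

(** The integrals are with respect to probability measures. *)
Lemma Qf_le c g H B u : ge0_profile c ->
  (Qf M V c g H B u <= (cost_bound l.+1 c)%:E)%E.
Proof.
move=> c0; rewrite /= EFinD; apply: leeD.
  by rewrite lee_fin step_cost_le.
set b := cost_bound l _.
rewrite (_ : (3 * b)%:E = \sum_(j < 3) b%:E)%E; last first.
  by rewrite sumEFin !big_ord_recl big_ord0; congr EFin; ring.
apply: lee_sum => j _.
rewrite -[leRHS]mule1 -(probability_setT (kprob nextK (g, H))) -integral_cst//.
apply: ge0_le_integral => //.
- by move=> z _; apply: (regular_ge0 rV); exact: upd_ge0.
- exact: measurable_next_stage.
- move=> z _; apply: (le_trans (regular_le rV _ _ _ _)); first exact: upd_ge0.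
  rewrite lee_fin; apply: cost_bound_le => s; exact: upd_le.
Qed.

(** Dominated convergence, the constant [cost_bound] of the dominating profile
    being integrable for a probability measure. *)
Lemma cvg_Qf (cn : nat -> seq bool -> R) c c' g H (Bn un : nat -> R) B u :
  (forall k, ge0_profile (cn k)) -> (forall k s, cn k s <= c' s) ->
  ge0_profile c -> (forall s, cn k s @[k --> \oo] --> c s) ->
  Bn k @[k --> \oo] --> B -> un k @[k --> \oo] --> u ->
  Qf M V (cn k) g H (Bn k) (un k) @[k --> \oo] --> Qf M V c g H B u.
Proof.
move=> cn0 cnc c0 cnE BnB unu.
have I0 cc B' u' j : ge0_profile cc -> (0 <= \int[kprob nextK (g, H)]_z
     V (upd M j g u' cc) z.1 z.2 (Num.min (B' - u' + z.2) (Bmax M))%R)%E.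
  move=> cc0; apply: integral_ge0 => z _.
  by apply: (regular_ge0 rV); exact: upd_ge0.
apply: cvgeD.
- by rewrite ge0_adde_def ?inE// ?lee_fin ?step_cost_ge0// sume_ge0// => j _; exact: I0.
- apply: cvg_EFin; first exact: nearW.
  apply: cvg_sum_bool => gam; apply: cvgM => //; exact: cvg_chan.
apply: cvg_nnesum => j _; first by apply: nearW => k; exact: I0.
pose b := cost_bound l (fun s => c' (true :: s) + c' (false :: s)).
have [| | | | |_ _ h] := @dominated_convergence _ _ _ (kprob nextK (g, H)) setT measurableT
  (fun k z => V (upd M j g (un k) (cn k)) z.1 z.2 (Num.min (Bn k - un k + z.2) (Bmax M)))
  (fun z => V (upd M j g u c) z.1 z.2 (Num.min (B - u + z.2) (Bmax M)))
  (cst b%:E).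
- by move=> k; exact: measurable_next_stage.
- exact: measurable_next_stage.
- apply: aeW => z _; apply: (regular_cvg rV) => //.
  + by move=> k; exact: upd_ge0.
  + by move=> k s; exact: upd_le.
  + exact: upd_ge0.
  + move=> s; apply: cvg_sum_bool => gam; apply: cvgM => //.
    by apply: cvgMl_tmp; exact: cvg_chan.
  + apply: cvg_minr; last exact: cvg_cst.
    by apply: cvgD; [exact: cvgB|exact: cvg_cst].
- exact: finite_measure_integrable_cst.
- apply: aeW => z k _.
  rewrite gee0_abs; last by apply: (regular_ge0 rV); exact: upd_ge0.
  apply: (le_trans (regular_le rV _ _ _ _)); first exact: upd_ge0.
  by rewrite lee_fin; apply: cost_bound_le => s; exact: upd_le.
exact: h.
Qed.

Section stage.
Variable c : seq bool -> R.
Hypothesis c0 : ge0_profile c.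
Variables g H B : R.

Let F t := Qf M V c g H B (t * Num.max 0 B).

Lemma stage_ge0 t : (0 <= F t)%E. Proof. exact: Qf_ge0. Qed.

Lemma stage_lty t : (F t < +oo)%E.
Proof. exact: le_lt_trans (Qf_le _ _ _ _ c0) (ltry _). Qed.

Lemma continuous_stage : continuous F.
Proof.
move=> t; apply: continuous_of_sequences => s st.
apply: (@cvg_Qf (fun=> c) c c) => // [s'| |]; first exact: cvg_cst.
  exact: cvg_cst.
by apply: cvgMr_tmp.
Qed.

End stage.

Lemma regular_step : regular (@cost_bound R l.+1)
  (fun c g H B => min01 (fun t => Qf M V c g H B (t * Num.max 0 B))).
Proof.
split.
- by move=> c g H B c0; apply: min01_ge0 => t; exact: stage_ge0.
- move=> c g H B c0; have h0 : unitI (0 : R) by rewrite /unitI/= lexx ler01.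
  by apply: (le_trans (min01_le _ h0)); exact: Qf_le.
- move=> d X c g H B c0 mc mg mH mB.
  apply: (measurable_min01 (F := fun x t => Qf M V (c x) (g x) (H x) (B x) (t * Num.max 0 (B x)))).
  + by move=> x; exact: (continuous_stage (c0 x)).
  + move=> t; apply: measurable_Qf => //.
    apply: measurable_funM; first exact: measurable_cst.
    by apply: measurable_maxr; first exact: measurable_cst.
- move=> cn c c' g H Bn B cn0 cnc c0 cnE BnB.
  apply: (min01_cvg (Fn := fun k t => Qf M V (cn k) g H (Bn k) (t * Num.max 0 (Bn k)))).
  + by move=> k t; exact: (stage_ge0 (cn0 k)).
  + by move=> k t; exact: (stage_lty (cn0 k)).
  + by move=> k; exact: (continuous_stage (cn0 k)).
  + by move=> t; exact: (stage_ge0 c0).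
  + by move=> t; exact: (stage_lty c0).
  + exact: (continuous_stage c0).
  + move=> phi s t kphi st.
    have phioo : phi k @[k --> \oo] --> \oo.
      move=> A [N _ NA]; exists N => // k /= Nk; apply: NA => /=.
      exact: leq_trans (kphi k).
    have Bphi : Bn (phi k) @[k --> \oo] --> B by exact: cvg_comp phioo BnB.
    apply: (@cvg_Qf (fun k => cn (phi k)) c c') => //.
    * by move=> s'; exact: cvg_comp phioo (cnE s').
    * by apply: cvgM => //; apply: cvg_maxr; first exact: cvg_cst.
Qed.

End step.

Lemma regular_W l : regular (@cost_bound R l) (W M l).
Proof.
elim: l => [|l IH]; last exact: regular_step.
by split=> // *; exact: cvg_cst.
Qed.

End recursion_regularity.

Section recursion_order.
Context {R : realType} {n m : nat} (M : model R n m).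
Implicit Types (c : seq bool -> R) (g H B u : R).

Local Notation nextK := (kpair (gainK M) (harvK M)).

Lemma le_Qf l c c' g H B u : ge0_profile c -> ge0_profile c' ->
  (forall s, c s <= c' s) ->
  (forall e e' g H B, ge0_profile e -> ge0_profile e' ->
     (forall s, e s <= e' s) -> (W M l e g H B <= W M l e' g H B)%E) ->
  (Qf M (W M l) c g H B u <= Qf M (W M l) c' g H B u)%E.
Proof.
move=> c0 c0' cc' IH; apply: leeD.
  by rewrite lee_fin; apply: ler_sum => gam _; rewrite ler_wpM2l// chan_ge0.
apply: lee_sum => j _; apply: ge0_le_integral => //.
- by move=> z _; apply: (regular_ge0 (regular_W M l)); exact: upd_ge0.
- exact: (measurable_next_stage M (regular_W M l) g B u j c0).
- exact: (measurable_next_stage M (regular_W M l) g B u j c0').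
- move=> z _; apply: IH; [exact: upd_ge0|exact: upd_ge0|].
  move=> s; apply: ler_sum => gam _; rewrite ler_wpM2l//.
  by rewrite mulr_ge0 ?fback_ge0 ?chan_ge0.
Qed.

Lemma le_W l c c' g H B : ge0_profile c -> ge0_profile c' ->
  (forall s, c s <= c' s) -> (W M l c g H B <= W M l c' g H B)%E.
Proof.
elim: l c c' g H B => // l IH c c' g H B c0 c0' cc'.
apply: le_min01 => t t01; apply: (le_trans (min01_le _ t01)).
exact: le_Qf.
Qed.

(** The bound [cost_bound] vanishes on the zero profile. *)
Lemma W_profile0 l g H B : W M l (fun=> 0) g H B = 0%E.
Proof.
have b0 : cost_bound l (fun=> 0 : R) = 0.
  by elim: l => //= l IH; rewrite addr0 add0r IH mulr0.
apply/eqP; rewrite eq_le (regular_ge0 (regular_W M l)) ?andbT//.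
by rewrite (le_trans (regular_le (regular_W M l) _ _ _ _))// b0.
Qed.

Lemma Qf_scale l a c g H B u : 0 < a -> ge0_profile c ->
  (forall e g H B, ge0_profile e ->
     W M l (fun s => a * e s) g H B = (a%:E * W M l e g H B)%E) ->
  Qf M (W M l) (fun s => a * c s) g H B u = (a%:E * Qf M (W M l) c g H B u)%E.
Proof.
move=> a0 c0 IH; rewrite ge0_muleDr ?lee_fin ?step_cost_ge0//; last first.
  apply: sume_ge0 => j _; apply: integral_ge0 => z _.
  by apply: (regular_ge0 (regular_W M l)); exact: upd_ge0.
congr (_ + _)%E.
  by rewrite -EFinM /step_cost mulr_sumr; under eq_bigr do rewrite mulrCA.
rewrite ge0_sume_distrr; last first.
  move=> j _; apply: integral_ge0 => z _.
  by apply: (regular_ge0 (regular_W M l)); exact: upd_ge0.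
apply: eq_bigr => j _; rewrite -ge0_integralZl//; last 3 first.
- exact: (measurable_next_stage M (regular_W M l)).
- by move=> z _; apply: (regular_ge0 (regular_W M l)); exact: upd_ge0.
- by rewrite lee_fin ltW.
apply: eq_integral => z _; rewrite -IH; last exact: upd_ge0.
congr (W M l _ _ _ _); apply/funext => s.
by rewrite /upd mulr_sumr; apply: eq_bigr => gam _; rewrite mulrCA.
Qed.

(** Homogeneity lets the probability of a feedback value pass inside the profile.
    A minimiser for [c] bounds the minimum for [a c]; exchanging the two, with
    the inverse factor, gives the other inequality. *)
Lemma W_scale l a c g H B : 0 < a -> ge0_profile c ->
  W M l (fun s => a * c s) g H B = (a%:E * W M l c g H B)%E.
Proof.
elim: l a c g H B => [|l IH] a c g H B a0 c0; first by rewrite mule0.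
have half b e : 0 < b -> ge0_profile e ->
    (W M l.+1 (fun s => b * e s)%R g H B <= b%:E * W M l.+1 e g H B)%E.
  move=> b0 e0.
  have [t t01 /= <-] := min01_attained
    (stage_ge0 M (regular_W M l) e0 g H B)
    (stage_lty M (regular_W M l) e0 g H B)
    (continuous_stage (regular_W M l) (c := e) e0 (g := g) (H := H) (B := B)).
  apply: (le_trans (min01_le _ t01)).
  rewrite Qf_scale// => e' g' H' B' e0'; exact: IH.
apply/eqP; rewrite eq_le half//=.
have := half a^-1 (fun s => a * c s).
rewrite invr_gt0 a0 => /(_ isT) h.
have {h} := h (fun s => mulr_ge0 (ltW a0) (c0 s)).
rewrite (_ : (fun s => _) = c); last by apply/funext => s; rewrite mulKf// gt_eqF.
by rewrite -(@lee_pmul2l _ a%:E)// ?lte_fin// muleA -EFinM divff ?gt_eqF// mul1e.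
Qed.

End recursion_order.

(** * Value functions as limits of the recursion on finite profiles *)

Section integral_off_null.
Import HBNNSimple.
Context d (T : measurableType d) {R : realType} (mu : {measure set T -> \bar R}).

(** The integrands may be nonmeasurable, as value functions are not known to be
    measurable: a simple function below one of them becomes, once set to zero on
    the null set, a simple function below the other. *)
Lemma ge0_integral_eq_off_null (f h : T -> \bar R) (N : set T) :
  measurable N -> mu N = 0%E ->
  (forall x, 0 <= f x)%E -> (forall x, 0 <= h x)%E ->
  (forall x, ~ N x -> f x = h x) -> (\int[mu]_x f x = \int[mu]_x h x)%E.
Proof.
move=> mN N0.
suff half (f1 f2 : T -> \bar R) : (forall x, 0 <= f1 x)%E ->
    (forall x, 0 <= f2 x)%E -> (forall x, ~ N x -> f1 x = f2 x) ->
    (\int[mu]_x f1 x <= \int[mu]_x f2 x)%E.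
  move=> f0 h0 fh; apply/eqP; rewrite eq_le half//= half// => x Nx.
  by rewrite fh.
move=> f10 f20 f12; rewrite !ge0_integralTE//.
apply: ge_ereal_sup => _ [k kf <-].
pose k' : {nnsfun T >-> R} := proj_nnsfun k (measurableC mN).
have -> : sintegral mu k = sintegral mu k'.
  rewrite -!integralT_nnsfun; apply: ae_eq_integral => //.
  - exact/measurable_EFinP.
  - exact/measurable_EFinP.
  - exists N; split => // x /= kk'; apply: contrapT => Nx; apply: kk' => _.
    by rewrite /k'/= mindicE mem_set// mulr1.
apply: ereal_sup_ubound; exists k' => // x.
rewrite /k'/= mindicE; have [Nx|Nx] := pselect (N x).
  by rewrite memNset ?mulr0//= => /(_ Nx).
by rewrite mem_set// mulr1 -f12.
Qed.

End integral_off_null.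

Section cost_profiles.
Context {R : realType} {n m : nat} (M : model R n m).

Lemma psd_trace_ge0 p (S : 'M[R]_p) : psd S -> 0 <= \tr S.
Proof.
move=> [_ S0]; apply: sumr_ge0 => i _; have := S0 (delta_mx i 0).
by rewrite trmx_delta -rowE -colE !mxE.
Qed.

Definition kalman_path (s : seq bool) (P : psdmx R n) : psdmx R n :=
  foldl (fun P gam => kalman M gam P) P s.

Definition path_trace (s : seq bool) (P : psdmx R n) : R :=
  \tr (kalman_path s P).

Lemma path_trace_ge0 s P : 0 <= path_trace s P.
Proof. by apply: psd_trace_ge0; exact: psdmxP. Qed.

Lemma measurable_path_trace s : measurable_fun setT (path_trace s).
Proof.
have mtr : measurable_fun setT (fun P : psdmx R n => \tr P).
  by apply: measurable_sum => i; exact: measurable_psdmx_entry.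
elim: s => // gam s IH.
exact: measurableT_comp IH (measurable_kalman M gam).
Qed.

(* The cost profile of a belief; its values may be infinite. *)
Definition belief_profile (pi : probability (psdmx R n) R) (s : seq bool) : \bar R :=
  (\int[pi]_P (path_trace s P)%:E)%E.

Lemma belief_profile_ge0 pi s : (0 <= belief_profile pi s)%E.
Proof. by apply: integral_ge0 => P _; rewrite lee_fin path_trace_ge0. Qed.

Lemma stage_costE pi g u : stage_cost M pi g u =
  (\sum_(gam : bool) (chan M gam g u)%:E * belief_profile pi [:: gam])%E.
Proof. by []. Qed.

(** Integrating against the push-forward by [kalman] prepends a letter to the
    word. *)
Lemma belief_profile_Phi pi j g u s : fback_marg M j g u != 0 ->
  belief_profile (Phi M pi j g u) s =
  (\sum_(gam : bool) (fback M j gam * chan M gam g u / fback_marg M j g u)%:E *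
     belief_profile pi (gam :: s))%E.
Proof.
move=> h0.
have w0 gam : 0 <= fback M j gam * chan M gam g u / fback_marg M j g u.
  by rewrite divr_ge0 ?mulr_ge0 ?fback_ge0 ?chan_ge0 ?fback_marg_ge0.
have mt : measurable_fun setT (fun P => (path_trace s P)%:E).
  by apply/measurable_EFinP; exact: measurable_path_trace.
pose w gam : {nonneg R} := NngNum (w0 gam).
rewrite /belief_profile (eq_measure_integral
  (measure_add (mscale (w true) (distribution pi (kalman M true)))
              (mscale (w false) (distribution pi (kalman M false))))); last first.
  move=> A _ _; transitivity (Phi M pi j g u A) => //.
  rewrite /Phi (negbTE h0); apply: etrans; last by symmetry; exact: measure_addE.
  exact: big_bool.
rewrite ge0_integral_measure_add//; last by move=> P _; rewrite lee_fin path_trace_ge0.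
rewrite big_bool; congr (_ + _)%E;
  rewrite ge0_integral_mscale//; try (by move=> P _; rewrite lee_fin path_trace_ge0);
  congr (_ * _)%E;
  rewrite ge0_integral_pushforward// => P _; by rewrite lee_fin path_trace_ge0.
Qed.

(** Finite profiles increasing to the profile of [pi], which may be infinite. *)
Definition approximates (cN : nat -> seq bool -> R) pi : Prop :=
  [/\ forall N, ge0_profile (cN N),
      forall s N N', (N <= N')%N -> cN N s <= cN N' s &
      forall s, (cN N s)%:E @[N --> \oo] --> belief_profile pi s].

(** The profile of [pi] truncated at [N]. *)
Lemma approximates_exists pi : exists cN, approximates cN pi.
Proof.
pose b s N := mine (belief_profile pi s) N%:R%:E.
have b0 s N : (0 <= b s N)%E.
  by rewrite /b le_min belief_profile_ge0 lee_fin ler0n.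
have bfin s N : b s N \is a fin_num.
  by rewrite ge0_fin_numE// /b; apply: (@le_lt_trans _ _ N%:R%:E);
    rewrite ?ltry// ge_min lexx orbT.
exists (fun N s => fine (b s N)); split.
- by move=> N s; rewrite fine_ge0.
- move=> s N N' NN'; rewrite fine_le// /b le_min ge_min lexx/=.
  by rewrite ge_min lee_fin ler_nat NN' orbT.
- move=> s; under eq_fun do rewrite fineK//.
  have := belief_profile_ge0 pi s; rewrite /b; move: (belief_profile pi s) => [x| |]// x0.
    apply: cvg_near_cst; exists (Num.truncn x).+1 => // N /= xN.
    apply/eqP; rewrite min_l// lee_fin ltW//.
    have /andP[_ h] := truncn_itv x0; apply: (lt_le_trans h).
    by rewrite ler_nat.
  under eq_fun do rewrite min_r ?leey//.
  by apply/cvgenyP; exact: cvg_id.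
Qed.

End cost_profiles.

Section value_limits.
Context {R : realType} {n m : nat} (M : model R n m).
Implicit Types (g H B u : R) (pi : probability (psdmx R n) R).

Local Notation nextK := (kpair (gainK M) (harvK M)).

Lemma approximates_sum cN pi (a : bool -> R) s : approximates M cN pi ->
  (forall gam, 0 <= a gam) ->
  (\sum_(gam : bool) a gam * cN N (gam :: s))%:E @[N --> \oo] -->
  (\sum_(gam : bool) (a gam)%:E * belief_profile M pi (gam :: s))%E.
Proof.
move=> [c0 cnd cl] a0; under eq_fun do rewrite -sumEFin.
apply: cvg_nnesum => gam _.
  by apply: nearW => N; rewrite lee_fin mulr_ge0//; exact: c0.
by under eq_fun do rewrite EFinM; apply: cvgeZl.
Qed.

Lemma approximates_upd cN pi j g u : approximates M cN pi ->
  fback_marg M j g u != 0 ->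
  approximates M (fun N s => (fback_marg M j g u)^-1 * upd M j g u (cN N) s)
    (Phi M pi j g u).
Proof.
move=> /[dup] cpi [c0 cnd cl] h0; split.
- by move=> N s; rewrite mulr_ge0 ?invr_ge0 ?fback_marg_ge0//; exact: upd_ge0.
- move=> s N N' NN'; rewrite ler_wpM2l ?invr_ge0 ?fback_marg_ge0//.
  apply: ler_sum => gam _; rewrite ler_wpM2l ?mulr_ge0 ?fback_ge0 ?chan_ge0//.
  exact: cnd.
- move=> s; rewrite belief_profile_Phi//.
  have h := approximates_sum (s := s) cpi (fun gam => divr_ge0
    (mulr_ge0 (fback_ge0 M j gam) (chan_ge0 M gam g u)) (fback_marg_ge0 M j g u)).
  apply: cvg_trans h; apply: near_eq_cvg; apply: nearW => N /=.
  congr EFin; rewrite /upd mulr_sumr.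
  by apply: eq_bigr => gam _; rewrite [RHS]mulrA (mulrC (_^-1)).
Qed.

Definition objective l pi g H B u : \bar R :=
  if l is l'.+1 then bellman_obj M (value_to_go M l') pi g H B u
  else stage_cost M pi g u.

Lemma bellman_objE V pi g H B u : bellman_obj M V pi g H B u =
  (stage_cost M pi g u +
   \sum_(j < 3) (fback_marg M j g u)%:E *
     \int[kprob nextK (g, H)]_z
       V (Phi M pi j g u) z.1 z.2 (Num.min (B - u + z.2) (Bmax M))%R)%E.
Proof. by []. Qed.

Lemma value_to_goE l pi g H B : value_to_go M l pi g H B =
  ereal_inf [set objective l pi g H B u | u in [set u | 0 <= u <= B]].
Proof. by case: l. Qed.

Lemma stage_cost_ge0 pi g u : (0 <= stage_cost M pi g u)%E.
Proof.
rewrite stage_costE; apply: sume_ge0 => gam _.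
by apply: mule_ge0; [rewrite lee_fin chan_ge0|exact: belief_profile_ge0].
Qed.

Lemma value_to_go_ge0 l pi g H B : (0 <= value_to_go M l pi g H B)%E.
Proof.
rewrite value_to_goE; apply: le_ereal_inf_tmp => _ [u _ <-].
elim: l pi g H B u => [|l IH] pi g H B u; first exact: stage_cost_ge0.
rewrite /objective bellman_objE; apply: adde_ge0; first exact: stage_cost_ge0.
apply: sume_ge0 => j _.
apply: mule_ge0; first by rewrite lee_fin fback_marg_ge0.
apply: integral_ge0 => z _; rewrite value_to_goE.
by apply: le_ereal_inf_tmp => _ [u' _ <-]; exact: IH.
Qed.

Section objective_limit.
Hypothesis Bmax0 : 0 <= Bmax M.

Lemma kpair_null g H : 0 <= g -> 0 <= H ->
  kprob nextK (g, H) (~` [set z : R * R | 0 <= z.1 /\ 0 <= z.2]) = 0%E.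
Proof.
move=> g0 H0; pose A := `[(0 : R), +oo[%classic.
have mA : measurable A by exact: measurable_itv.
rewrite (_ : [set z : R * R | _ /\ _] = A `*` A); last first.
  by apply/seteqP; split=> z /=; rewrite /A/= !in_itv/= !andbT.
transitivity (1 - kprob nextK (g, H) (A `*` A))%E.
  by apply: probability_setC; exact: measurableX.
suff -> : kprob nextK (g, H) (A `*` A) = 1%E by rewrite subee.
transitivity (kprob (gainK M) g A * kprob (harvK M) H A)%E.
  exact: product_measure1E.
rewrite (_ : kprob (gainK M) g A = 1%E); last exact: gainK_ge0.
by rewrite (_ : kprob (harvK M) H A = 1%E) ?mule1//; exact: harvK_ge0.
Qed.

Definition value_limit l := forall pi cN g H B, approximates M cN pi ->
  0 <= g -> 0 <= H -> 0 <= B ->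
  W M l.+1 (cN N) g H B @[N --> \oo] --> value_to_go M l pi g H B.

(** The filter transports approximations, so the induction hypothesis gives the
    limit of the integrands wherever gain and energy are nonnegative. As [W]
    increases with the profile, monotone convergence identifies the limit of the
    integrals; the null set is dealt with by [ge0_integral_eq_off_null]. *)
Lemma objective_limit l pi cN g H B u :
  (forall l', l = l'.+1 -> value_limit l') -> approximates M cN pi ->
  0 <= g -> 0 <= H -> 0 <= u <= B ->
  Qf M (W M l) (cN N) g H B u @[N --> \oo] --> objective l pi g H B u.
Proof.
move=> IH /[dup] cpi [c0 cnd cl] g0 H0 /andP[u0 uB].
have stage : (step_cost M g u (cN N))%:E @[N --> \oo] --> stage_cost M pi g u.
  by rewrite stage_costE; apply: approximates_sum => // gam; exact: chan_ge0.
case: l IH => [_|l /(_ _ erefl) IH].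
  apply: cvg_trans stage; apply: near_eq_cvg; apply: nearW => N /=.
  by rewrite /Qf big1 ?adde0// => j _; rewrite integral0.
have nxt0 j : (0 <= (fback_marg M j g u)%:E *
    \int[kprob nextK (g, H)]_z value_to_go M l (Phi M pi j g u) z.1 z.2
      (Num.min (B - u + z.2) (Bmax M))%R)%E.
  apply: mule_ge0; first by rewrite lee_fin fback_marg_ge0.
  by apply: integral_ge0 => z _; exact: value_to_go_ge0.
rewrite /objective bellman_objE; apply: cvgeD => //.
  by rewrite ge0_adde_def ?inE ?stage_cost_ge0// sume_ge0.
apply: cvg_nnesum => j _.
  apply: nearW => N; apply: integral_ge0 => z _.
  by apply: (regular_ge0 (regular_W M l.+1)); exact: upd_ge0.
have [h0|h0] := eqVneq (fback_marg M j g u) 0.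
  rewrite h0 mul0e; apply: cvg_near_cst; apply: nearW => N.
  rewrite upd_null//; apply/eqP.
  by rewrite (eq_integral (cst 0%E)) ?integral0// => z _; rewrite W_profile0.
pose a := fback_marg M j g u.
have a0 : 0 < a by rewrite lt0r h0 fback_marg_ge0.
pose dN N s := a^-1 * upd M j g u (cN N) s.
have dpi : approximates M dN (Phi M pi j g u) by exact: approximates_upd.
have [d0 dnd _] := dpi.
have dE N : upd M j g u (cN N) = (fun s => a * dN N s).
  by apply/funext => s; rewrite /dN fback_marg_updK.
pose w N (z : R * R) := W M l.+1 (dN N) z.1 z.2 (Num.min (B - u + z.2) (Bmax M)).
have mw N : measurable_fun setT (w N).
  apply: (regular_measurable (regular_W M l.+1)) => //.
  apply: measurable_minr; last exact: measurable_cst.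
  by apply: measurable_funD.
have w0 N z : (0 <= w N z)%E by exact: (regular_ge0 (regular_W M l.+1)).
have wnd z : {homo w^~ z : N N' / (N <= N')%N >-> (N <= N')%E}.
  by move=> N N' NN'; apply: le_W => // s; exact: dnd.
rewrite (_ : (fun N => _) =
    (fun N => a%:E * \int[kprob nextK (g, H)]_z w N z)%E); last first.
  apply/funext => N; rewrite -ge0_integralZl//; last by rewrite lee_fin ltW.
  apply: eq_integral => z _; rewrite dE.
  exact: W_scale.
apply: cvgeZl => //.
rewrite (_ : (\int[_]_z value_to_go _ _ _ _ _ _)%E =
    (\int[kprob nextK (g, H)]_z limn (w^~ z))%E).
  by apply: (@cvg_monotone_convergence _ _ _ (kprob nextK (g, H)) setT _ w).
apply: (@ge0_integral_eq_off_null _ _ _ (kprob nextK (g, H)) _ _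
  (~` [set z : R * R | 0 <= z.1 /\ 0 <= z.2])).
- apply: measurableC; rewrite (_ : [set _ | _] = `[0, +oo[%classic `*` `[0, +oo[%classic).
    exact: measurableX.
  by apply/seteqP; split=> z /=; rewrite !in_itv/= !andbT.
- exact: kpair_null.
- by move=> z; exact: value_to_go_ge0.
- move=> z; apply: lime_ge; last exact: nearW.
  exact: ereal_nondecreasing_is_cvgn.
- move=> z /contrapT/= [z1 z2]; apply/esym/cvg_lim => //.
  apply: IH => //; rewrite le_min Bmax0 andbT addr_ge0// subr_ge0.
  by [].
Qed.

(** Both claims come from exchanging the minimum over the energies with the
    supremum over the approximations, by [min01_sup]. *)
Lemma value_attained l pi cN g H B :
  (forall l', l = l'.+1 -> value_limit l') -> approximates M cN pi ->
  0 <= g -> 0 <= H -> 0 <= B ->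
  (exists2 u, 0 <= u <= B & objective l pi g H B u = value_to_go M l pi g H B) /\
  (W M l.+1 (cN N) g H B @[N --> \oo] --> value_to_go M l pi g H B).
Proof.
move=> IH /[dup] cpi [c0 cnd cl] g0 H0 B0.
have tB t : unitI t -> 0 <= t * B <= B.
  by move=> /andP[t0 t1]; rewrite mulr_ge0//= ler_piMl.
pose F N t := Qf M (W M l) (cN N) g H B (t * Num.max 0 B).
have Fnd t N N' : (N <= N')%N -> (F N t <= F N' t)%E.
  move=> NN'; apply: le_Qf => // [s|]; first exact: cnd.
  by move=> *; exact: le_W.
have supF t : unitI t ->
    ereal_sup [set F N t | N in setT] = objective l pi g H B (t * B).
  move=> t01; apply: (@cvg_unique _ _ (F^~ t @ \oo)) => //.
    by apply: ereal_nondecreasing_cvgn => N N'; exact: Fnd.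
  by rewrite /F max_r//; apply: objective_limit => //; exact: tB.
have [t t01 tE] := min01_sup
  (fun N => stage_ge0 M (regular_W M l) (c0 N) g H B)
  (fun N => stage_lty M (regular_W M l) (c0 N) g H B)
  (fun N => continuous_stage (regular_W M l) (c0 N) (g := g) (H := H) (B := B)) Fnd.
have vE : value_to_go M l pi g H B = ereal_sup [set min01 (F N) | N in setT].
  apply/eqP; rewrite eq_le; apply/andP; split.
    rewrite -tE supF// value_to_goE; apply: ereal_inf_lbound.
    by exists (t * B) => //; exact: tB.
  rewrite value_to_goE; apply: le_ereal_inf_tmp => _ [u /andP[u0 uB] <-].
  (* When B = 0 the quotient is 0 by convention, and u = 0 as well. *)
  pose t' := u / B.
  have uE : u = t' * B.
    have [B00|B00] := eqVneq B 0; last by rewrite /t' divfK.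
    by rewrite B00 mulr0; apply/eqP; rewrite eq_le u0 -B00 uB.
  have t'01 : unitI t'.
    rewrite /unitI /= divr_ge0//=.
    have [B00|B00] := eqVneq B 0; first by rewrite /t' B00 invr0 mulr0 ler01.
    by rewrite ler_pdivrMr ?mul1r// lt0r B00.
  rewrite uE -supF//; apply: ge_ereal_sup => _ [N _ <-].
  apply: (le_trans (min01_le _ t'01)).
  by apply: ereal_sup_ubound; exists N.
split; first by exists (t * B); [exact: tB|rewrite -supF// vE].
rewrite vE; apply: ereal_nondecreasing_cvgn => N N' NN'.
apply: le_min01 => t' t'01; apply: (le_trans (min01_le _ t'01)).
exact: Fnd.
Qed.

Lemma value_limitP l : value_limit l.
Proof.
elim: l => [|l IH] pi cN g H B cpi g0 H0 B0.
  by have [//|_] := @value_attained 0 pi cN g H B _ cpi g0 H0 B0.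
have [|_] := @value_attained l.+1 pi cN g H B _ cpi g0 H0 B0; last by [].
by move=> l' [<-].
Qed.

Lemma value_minimum l pi g H B : 0 <= g -> 0 <= H -> 0 <= B ->
  is_minimum [set objective l pi g H B u | u in [set u | 0 <= u <= B]]
    (value_to_go M l pi g H B).
Proof.
move=> g0 H0 B0; split; last first.
  by move=> v; rewrite value_to_goE; exact: ereal_inf_lbound.
have [cN cpi] := approximates_exists M pi.
have [|[u uB uE] _] := @value_attained l pi cN g H B _ cpi g0 H0 B0.
  by move=> *; exact: value_limitP.
by exists u.
Qed.

End objective_limit.

End value_limits.

Section last_stage.
Context {R : realType} {n m : nat} (M : model R n m).
Implicit Types (g H B u : R) (pi : probability (psdmx R n) R).

(** The matrix subtracted upon reception is [K S K^T], where [S] is the innovation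
    covariance and [K] the gain, hence it is nonnegative definite. *)
Lemma kalman_trace_le (P : psdmx R n) :
  \tr (kalman M true P) <= \tr (kalman M false P).
Proof.
rewrite /kalman /= /riccati scale1r scale0r subr0.
set S := _ + covR M.
have P0 : psd (psdmx_val P) by exact: psdmxP.
have S0 : psd S by exact: (innov_psd _ (covR_psd M) P0).
have Pt : (psdmx_val P)^T = P by case: P0.
have St : S^T = S by case: S0.
pose G := dynA M *m P *m (obsC M)^T; pose K := G *m pinvmx S.
have KS : K *m S = G.
  rewrite /K mulmxKpV// /G -mulmxA.
  by apply: (submx_trans (submxMl _ _)); exact: (innov_range _ (covR_psd M) P0).
have Gt : obsC M *m P *m (dynA M)^T = S *m K^T.
  have -> : S *m K^T = G^T by rewrite -KS [RHS]trmx_mul St.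
  by rewrite /G !trmx_mul trmxK Pt mulmxA.
rewrite raddfB /= lerBlDr lerDl.
have -> : dynA M *m P *m (obsC M)^T *m pinvmx S *m obsC M *m P *m (dynA M)^T =
    K *m S *m K^T.
  by rewrite -[RHS]mulmxA -Gt /K /G !mulmxA.
by apply: psd_trace_ge0; exact: psd_conj.
Qed.

(** The stage cost averages a smaller trace, with the probability of reception,
    and a larger one. The larger one may be infinite, which forces a case
    analysis. *)
Lemma stage_cost_nonincreasing pi g u u' : 0 <= g -> 0 <= u -> u <= u' ->
  (stage_cost M pi g u' <= stage_cost M pi g u)%E.
Proof.
move=> g0 u0 uu'; rewrite !stage_costE !big_bool.
have pp' : chan M true g u <= chan M true g u'.
  rewrite /chan /= !max_r ?mulr_ge0// ?(le_trans u0)//.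
  by apply: recv_nondecreasing; rewrite ?in_itv/= ?andbT ?mulr_ge0 ?ler_wpM2l// (le_trans u0).
have q v : chan M false g v = 1 - chan M true g v by rewrite -(chanD M g v) addrC addKr.
rewrite !q.
have ab : (belief_profile M pi [:: true] <= belief_profile M pi [:: false])%E.
  apply: ge0_le_integral => //.
  - by move=> P _; rewrite lee_fin path_trace_ge0.
  - by apply/measurable_EFinP; exact: measurable_path_trace.
  - by apply/measurable_EFinP; exact: measurable_path_trace.
  - by move=> P _; rewrite lee_fin; exact: kalman_trace_le.
have a0 := belief_profile_ge0 M pi [:: true].
have p0 := chan_ge0 M true g u; have p1 := chan_le1 M true g u.
have p'1 := chan_le1 M true g u'.
move: (belief_profile M pi [:: true]) (belief_profile M pi [:: false]) a0 ab => a [b| |].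
- case: a => [a| |]//; rewrite !lee_fin => a0 ab.
  rewrite -subr_ge0.
  have -> : chan M true g u * a + (1 - chan M true g u) * b -
    (chan M true g u' * a + (1 - chan M true g u') * b) =
    (chan M true g u' - chan M true g u) * (b - a) by ring.
  by rewrite mulr_ge0// subr_ge0.
- move=> a0 _; have [p1'|p1'] := eqVneq (chan M true g u) 1.
    have -> : chan M true g u' = 1 by apply/eqP; rewrite eq_le p'1 -p1' pp'.
    by rewrite p1' subrr.
  have -> : ((1 - chan M true g u)%:E * +oo = +oo)%E.
    by apply: gt0_muley; rewrite lte_fin subr_gt0 lt_neqAle p1' p1.
  rewrite [X in (_ <= X)%E]addey ?leey//.
  by rewrite gt_eqF// (@lt_le_trans _ _ 0%E)// mule_ge0.
- by move=> a0 h; have := le_trans a0 h.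
Qed.

End last_stage.

(** * Integrals and sub-sigma-algebras *)

Section nonnegative_induction.
Import HBNNSimple.
Context d (T : measurableType d) {R : realType}.
Variable Q : (T -> \bar R) -> Prop.
Hypothesis Q_indic : forall A, measurable A -> Q (fun x => (\1_A x)%:E).
Hypothesis Q_scale : forall (a : R) f, 0 <= a -> (forall x, 0 <= f x)%E ->
  measurable_fun setT f -> Q f -> Q (fun x => a%:E * f x)%E.
Hypothesis Q_add : forall f h, (forall x, 0 <= f x)%E -> (forall x, 0 <= h x)%E ->
  measurable_fun setT f -> measurable_fun setT h -> Q f -> Q h ->
  Q (fun x => f x + h x)%E.
Hypothesis Q_lim : forall (f_ : nat -> T -> \bar R) f,
  (forall k x, 0 <= f_ k x)%E -> (forall k, measurable_fun setT (f_ k)) ->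
  (forall x, {homo f_^~ x : k l / (k <= l)%N >-> (k <= l)%E}) ->
  (forall x, f_ k x @[k --> \oo] --> f x) -> (forall k, Q (f_ k)) -> Q f.

(** A nonnegative measurable function is an increasing limit of combinations of
    indicators with nonnegative coefficients. The coefficients are truncated
    at 0 so that their sign is known without referring to the range. *)
Lemma nonnegative_induction f : (forall x, 0 <= f x)%E ->
  measurable_fun setT f -> Q f.
Proof.
move=> f0 mf; pose h := nnsfun_approx measurableT mf.
apply: (Q_lim (f_ := fun k x => (h k x)%:E)).
- by move=> k x; rewrite lee_fin.
- by move=> k; exact/measurable_EFinP.
- by move=> x k l kl; rewrite lee_fin; exact/lefP/nd_nnsfun_approx.
- by move=> x; exact: cvg_nnsfun_approx.
move=> k; set s := finmap.enum_fset (fset_set (range (h k))).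
have hE : (fun x => (h k x)%:E) =
    (fun x => \sum_(r <- s) (Num.max 0 r)%:E * (\1_(h k @^-1` [set r]) x)%:E)%E.
  apply/funext => x; rewrite fimfunE fsbig_finite//= -sumEFin.
  apply: eq_bigr => r _; rewrite EFinM.
  have [r0|r0] := leP 0 r; first by [].
  by rewrite preimage_nnfun0// indic0 !mule0.
rewrite {}hE; elim: s => [|r l IH].
  rewrite (_ : (fun _ => _) = fun x => (\1_(set0 : set T) x)%:E).
    by apply: Q_indic; exact: measurable0.
  by apply/funext => x; rewrite big_nil indic0.
have mi A : measurable A -> measurable_fun setT (fun x : T => (\1_A x : R)%:E).
  by move=> mA; apply/measurable_EFinP; exact: measurable_indic.
have mr y : measurable (h k @^-1` [set y]) by exact: measurable_sfunP.
under eq_fun do rewrite big_cons.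
apply: Q_add => //.
- by move=> x; rewrite mule_ge0 ?lee_fin// le_max lexx.
- by move=> x; apply: sume_ge0 => y _; rewrite mule_ge0 ?lee_fin// le_max lexx.
- by apply: measurable_funeM; exact: mi.
- by apply: emeasurable_sum => y; apply: measurable_funeM; exact: mi.
apply: Q_scale; rewrite ?le_max ?lexx//.
- exact: mi.
- exact: Q_indic.
Qed.

End nonnegative_induction.

Section dynkin.
Context d (T : measurableType d) {R : realType} (mu : {measure set T -> \bar R}).

(** The events on which the two integrals agree are stable under complement, as
    the integrals are finite, and under disjoint countable unions. *)
Lemma dynkin_eq_integral (G : set (set T)) (Y Y' : T -> \bar R) :
  <<s G >> `<=` measurable -> setI_closed G -> G setT ->
  (forall x, 0 <= Y x)%E -> (forall x, 0 <= Y' x)%E ->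
  measurable_fun setT Y -> measurable_fun setT Y' ->
  (\int[mu]_x Y x < +oo)%E ->
  (forall D, G D -> \int[mu]_(x in D) Y x = \int[mu]_(x in D) Y' x)%E ->
  forall D, <<s G >> D -> (\int[mu]_(x in D) Y x = \int[mu]_(x in D) Y' x)%E.
Proof.
move=> Gm GI GT Y0 Y0' mY mY' Yoo GE D sGD.
apply: (@dynkin_induction _ (g_sigma_algebraType G) G
  [set D | (\int[mu]_(x in D) Y x = \int[mu]_(x in D) Y' x)%E]) sGD => //.
- exact: GE.
- move=> A mA AE; have {}mA : @measurable d T A by exact: Gm.
  have split_int (Z : T -> \bar R) : (forall x, 0 <= Z x)%E ->
      measurable_fun setT Z ->
      (\int[mu]_x Z x = \int[mu]_(x in A) Z x + \int[mu]_(x in ~` A) Z x)%E.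
    move=> Z0 mZ; rewrite -ge0_integral_setU// ?setUv//; first exact: measurableC.
    by rewrite disj_set2E setICr.
  have := GE _ GT; rewrite (split_int Y)// (split_int Y')// -AE.
  have Af : (\int[mu]_(x in A) Y x)%E \is a fin_num.
    rewrite ge0_fin_numE ?integral_ge0//; apply: le_lt_trans Yoo.
    exact: ge0_subset_integral.
  by move=> /(congr1 (fun z => z - \int[mu]_(x in A) Y x)%E);
     rewrite !(addeC (\int[mu]_(x in A) Y x)%E) !addeK//.
- move=> F mF tF FE.
  have mF' k : @measurable d T (F k) by exact: (Gm _ (mF k)).
  rewrite /= !ge0_integral_bigcup//; try exact: measurable_funTS.
  by congr (limn _); apply/funext => N; apply: eq_bigr => k _; exact: FE.
Qed.

End dynkin.

Section sub_sigma_algebra.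
Context d (Omega : measurableType d) {R : realType} (P : probability Omega R).

Lemma integral_indicM (A : set Omega) (Y : Omega -> \bar R) :
  (\int[P]_x ((\1_A x)%:E * Y x) = \int[P]_(x in A) Y x)%E.
Proof.
rewrite [RHS]integral_mkcond; apply: eq_integral => x _.
rewrite patchE indicE; case: (x \in A); first by rewrite mul1e.
by rewrite mul0e.
Qed.

Variable G : set (set Omega).
Hypothesis Gm : <<s G >> `<=` measurable.

Lemma measurable_fun_sub d' (S : measurableType d') (f : Omega -> S) :
  measurable_fun (setT : set (g_sigma_algebraType G)) f -> measurable_fun setT f.
Proof.
by move=> mf _ A mA; apply: Gm; apply: mf.
Qed.

(** What is known is taken out of a conditional expectation: the claim holds by
    hypothesis when [Z] is an indicator. *)
Lemma pull_out (Y Y' : Omega -> R) (Z : Omega -> \bar R) :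
  (forall x, 0 <= Y x) -> (forall x, 0 <= Y' x) ->
  measurable_fun setT Y -> measurable_fun setT Y' ->
  (forall D, <<s G >> D -> \int[P]_(x in D) (Y x)%:E = \int[P]_(x in D) (Y' x)%:E)%E ->
  (forall x, 0 <= Z x)%E ->
  measurable_fun (setT : set (g_sigma_algebraType G)) Z ->
  (\int[P]_x (Z x * (Y x)%:E) = \int[P]_x (Z x * (Y' x)%:E))%E.
Proof.
move=> Y0 Y0' /measurable_EFinP mY /measurable_EFinP mY' YE Z0 mZ; move: Z Z0 mZ.
apply: (@nonnegative_induction _ (g_sigma_algebraType G)).
- by move=> A mA; rewrite !integral_indicM; exact: YE.
- move=> a f a0 f0 /measurable_fun_sub mf fE.
  under eq_integral do rewrite -muleA; under [RHS]eq_integral do rewrite -muleA.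
  rewrite !ge0_integralZl ?lee_fin ?fE//.
  + exact: emeasurable_funM.
  + by move=> x _; rewrite mule_ge0 ?lee_fin.
  + exact: emeasurable_funM.
  + by move=> x _; rewrite mule_ge0 ?lee_fin.
- move=> f h f0 h0 /measurable_fun_sub mf /measurable_fun_sub mh fE hE.
  under eq_integral do rewrite ge0_muleDl//.
  under [RHS]eq_integral do rewrite ge0_muleDl//.
  by rewrite !ge0_integralD ?fE ?hE//;
    try (by move=> x _; rewrite mule_ge0 ?lee_fin); exact: emeasurable_funM.
- move=> f_ f f0 mf_ fnd fl fE.
  have lim_int (V : Omega -> R) : (forall x, 0 <= V x) ->
      measurable_fun setT (EFin \o V) ->
      (\int[P]_x (f x * (V x)%:E) = limn (fun k => \int[P]_x (f_ k x * (V x)%:E)))%E.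
    move=> V0 mV; rewrite -monotone_convergence//.
    + apply: eq_integral => x _; apply/esym/cvg_lim => //.
      exact: cvgeZr.
    + by move=> k; apply: emeasurable_funM => //; exact: measurable_fun_sub.
    + by move=> k x _; rewrite mule_ge0 ?lee_fin.
    + by move=> x _ k l kl; rewrite lee_wpmul2r ?lee_fin//; exact: fnd.
  by rewrite !lim_int//; congr (limn _); apply/funext => k; exact: fE.
Qed.

End sub_sigma_algebra.

Lemma integral_probability_cst d (T : measurableType d) (R : realType)
  (P : probability T R) (a : \bar R) : (\int[P]_x a = a)%E.
Proof.
transitivity (a * P setT)%E; first exact: integral_cst.
by rewrite probability_setT mule1.
Qed.

Section freezing.
Context d (Omega : measurableType d) {R : realType} (P : probability Omega R).
Variable G : set (set Omega).
Hypothesis Gm : <<s G >> `<=` measurable.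
Context d0 d1 (S0 : measurableType d0) (S : measurableType d1).
Variables (K : R.-pker S0 ~> S) (X : Omega -> S0) (Y : Omega -> S).
Hypothesis mX : measurable_fun (setT : set (g_sigma_algebraType G)) X.
Hypothesis mY : measurable_fun setT Y.
Hypothesis XY : forall D A, <<s G >> D -> measurable A ->
  P (D `&` Y @^-1` A) = (\int[P]_(x in D) K (X x) A)%E.

Let OmegaG := g_sigma_algebraType G.
Let pair_Y (x : Omega) : OmegaG * S := (x, Y x).

Let measurable_pair_Y : measurable_fun setT pair_Y.
Proof.
apply: measurable_fun_pair => //.
by move=> _ A mA; rewrite setTI; exact: Gm.
Qed.

Let section_measure A (x : Omega) : \bar R := kprob K (X x) (xsection A (x : OmegaG)).

Let measurable_section A : measurable A ->
  measurable_fun setT (section_measure A).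
Proof.
move=> mA; apply: (measurable_fun_sub Gm).
have := @measurable_fun_xsection_finite_kernel _ _ _ _ _ (kpull K mX) A.
by rewrite inE => /(_ mA).
Qed.

Let freezing_set A : measurable A ->
  P (pair_Y @^-1` A) = (\int[P]_x section_measure A x)%E.
Proof.
have mpre B : measurable B -> measurable (pair_Y @^-1` B).
  by move=> mB; rewrite -[X in measurable X]setTI; exact: measurable_pair_Y.
pose C := [set D `*` B | D in (measurable : set (set OmegaG)) & B in (measurable : set (set S))].
move=> mA; have sA : <<s C >> A by rewrite /C -measurable_prod_measurableType.
apply: (@dynkin_induction _ (OmegaG * S)%type C
  [set A | P (pair_Y @^-1` A) = (\int[P]_x section_measure A x)%E]) sA => /=.
- exact: measurable_prod_measurableType.
- move=> _ _ [X1 mX1 [X2 mX2 <-]] [Y1 mY1 [Y2 mY2 <-]].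
  exists (X1 `&` Y1); first exact: measurableI.
  by exists (X2 `&` Y2); [exact: measurableI|rewrite setXI].
- rewrite preimage_setT probability_setT; apply/esym.
  transitivity (\int[P]_x cst 1%E x)%E; last exact: integral_probability_cst.
  apply: eq_integral => x _; rewrite /section_measure (_ : xsection _ _ = setT).
    exact: probability_setT.
  by apply/seteqP; split=> y //= _; rewrite /xsection/= inE.
- move=> _ [D mD [B mB <-]] /=.
  rewrite (_ : pair_Y @^-1` (D `*` B) = D `&` Y @^-1` B)// XY//.
  rewrite integral_mkcond; apply: eq_integral => x _; rewrite patchE /section_measure.
  case: ifPn => xD; first by rewrite in_xsectionX.
  by rewrite notin_xsectionX// measure0.
- move=> B mB BE.
  have e1 : P (pair_Y @^-1` (~` B)) = (1 - P (pair_Y @^-1` B))%E.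
    by rewrite preimage_setC probability_setC//; exact: mpre.
  have e2 : (\int[P]_x section_measure (~` B) x + \int[P]_x section_measure B x = 1)%E.
    rewrite -ge0_integralD//; try (by move=> x _; exact: measure_ge0);
      try exact: measurable_section; last exact: measurable_section (measurableC mB).
    transitivity (\int[P]_x cst 1%E x)%E; last exact: integral_probability_cst.
    apply: eq_integral => x _; rewrite /section_measure.
    rewrite [X in (X + _)%E](_ : _ = (1 - kprob K (X x) (xsection B (x : OmegaG)))%E).
      rewrite subeK// fin_num_measure//; exact: measurable_xsection.
    rewrite -probability_setC; last exact: measurable_xsection.
    by congr (kprob K (X x) _); apply/seteqP; split=> y; rewrite /xsection/= !inE.
  rewrite e1 BE -e2 addeK//.
  rewrite -BE fin_num_measure//; exact: mpre.
- move=> F mF tF FE.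
  rewrite preimage_bigcup measure_semi_bigcup//; last 3 first.
  + by move=> k; exact: mpre.
  + apply/trivIsetP => i j _ _ ij; rewrite -preimage_setI.
    by move/trivIsetP : tF => ->//; exact: preimage_set0.
  + by apply: bigcupT_measurable => k; exact: mpre.
  transitivity (\sum_(k <oo) \int[P]_x section_measure (F k) x)%E.
    by apply: eq_eseriesr => k _; exact: FE.
  rewrite -integral_nneseries//; last by move=> k; exact: measurable_section.
  apply: eq_integral => x _; rewrite /section_measure xsection_bigcup.
  apply/esym; apply: measure_semi_bigcup; last 2 first.
  + exact: trivIset_xsection.
  + by apply: bigcupT_measurable => k; exact: measurable_xsection.
  + by move=> k; exact: measurable_xsection.
Qed.

(** The claim extends the hypothesis [XY], which is the case of the indicator of
    a known event times an event on [Y]; such products generate the measurable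
    sets of pairs and form a pi-system. *)
Lemma freezing (f : OmegaG * S -> \bar R) :
  (forall z, 0 <= f z)%E -> measurable_fun setT f ->
  (\int[P]_x f (x, Y x) = \int[P]_x \int[K (X x)]_y f (x, y))%E.
Proof.
have inner_meas (h : OmegaG * S -> \bar R) : (forall z, 0 <= h z)%E ->
    measurable_fun setT h ->
    measurable_fun setT (fun x : Omega => \int[K (X x)]_y h (x, y))%E.
  move=> h0 mh; apply: (measurable_fun_sub Gm).
  exact: (measurable_integral_kpull K mX h0 mh).
have mpair (h : OmegaG * S -> \bar R) : measurable_fun setT h ->
    measurable_fun setT (fun x : Omega => h (x, Y x)).
  by move=> mh; exact: measurableT_comp mh measurable_pair_Y.
have msec (h : OmegaG * S -> \bar R) (x : OmegaG) : measurable_fun setT h ->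
    measurable_fun setT (fun y => h (x, y)).
  by move=> mh; exact: measurableT_comp mh (measurable_pair1 x).
move: f; apply: (@nonnegative_induction _ (OmegaG * S)%type R
  (fun f => \int[P]_x f (x, Y x) = \int[P]_x \int[K (X x)]_y f (x, y))%E).
- move=> A mA.
  transitivity (P (pair_Y @^-1` A)).
    rewrite (_ : (fun x => _) = (fun x => (\1_(pair_Y @^-1` A) x)%:E))//.
    rewrite integral_indic ?setIT// -[X in measurable X]setTI.
    exact: measurable_pair_Y.
  rewrite freezing_set//; apply: eq_integral => x _; rewrite /section_measure.
  rewrite (_ : (fun y => _) = (fun y => (\1_(xsection A (x : OmegaG)) y)%:E)).
    by rewrite integral_indic ?setIT//; exact: measurable_xsection.
  by apply/funext => y; rewrite !indicE mem_xsection.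
- move=> a f a0 f0 mf fE; rewrite ge0_integralZl//; last exact: mpair.
  rewrite fE -ge0_integralZl//; last 2 first.
  + exact: inner_meas.
  + by move=> x _; exact: integral_ge0.
  by apply: eq_integral => x _; rewrite ge0_integralZl//; exact: msec.
- move=> f h f0 h0 mf mh fE hE; rewrite ge0_integralD//; try exact: mpair.
  rewrite fE hE -ge0_integralD//; try (by move=> x _; exact: integral_ge0);
    try exact: inner_meas.
  by apply: eq_integral => x _; rewrite ge0_integralD//; exact: msec.
- move=> f_ f f0 mf_ fnd fl fE.
  transitivity (limn (fun k => \int[P]_x f_ k (x, Y x)))%E.
    rewrite -monotone_convergence//.
    + by apply: eq_integral => x _; apply/esym/cvg_lim => //; exact: fl.
    + by move=> k; exact: mpair.
  transitivity (limn (fun k => \int[P]_x \int[K (X x)]_y f_ k (x, y)))%E.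
    by congr (limn _); apply/funext => k.
  rewrite -monotone_convergence//.
  + apply: eq_integral => x _; rewrite -monotone_convergence//.
    * by apply: eq_integral => y _; apply/cvg_lim => //; exact: fl.
    * by move=> k; exact: msec.
  + by move=> k; exact: inner_meas.
  + by move=> k x _; exact: integral_ge0.
  + move=> x _ k l kl; apply: ge0_le_integral => //; try exact: msec.
    by move=> y _; exact: fnd.
Qed.

End freezing.

Section independent_extension.
Context d (Omega : measurableType d) {R : realType} (P : probability Omega R).

(** Conditioning also on an independent sigma-algebra changes nothing: the claim
    factorizes on the intersections of an event of [G1] with one of [G2], which
    form a pi-system. *)
Lemma independent_extension (G1 G1' G2 : set (set Omega)) (E : set Omega)
    (p : Omega -> R) :
  <<s G1' >> `<=` measurable -> <<s G2 >> `<=` measurable ->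
  <<s G1 >> `<=` <<s G1' >> ->
  (forall D1 D2, <<s G1' >> D1 -> <<s G2 >> D2 ->
     P (D1 `&` D2) = (P D1 * P D2)%E) ->
  <<s G1' >> E -> (forall x, 0 <= p x) ->
  measurable_fun (setT : set (g_sigma_algebraType G1')) p ->
  (forall D, <<s G1 >> D -> P (D `&` E) = (\int[P]_(x in D) (p x)%:E)%E) ->
  forall D, <<s (G1 `|` G2) >> D -> P (D `&` E) = (\int[P]_(x in D) (p x)%:E)%E.
Proof.
move=> G1m G2m G11 ind GE p0 mp pE D.
have mE : measurable E by exact: G1m.
pose Pi := [set D1 `&` D2 | D1 in <<s G1 >> & D2 in <<s G2 >>].
have T1 : <<s G1 >> setT by exact: (@measurableT _ (g_sigma_algebraType G1)).
have T2 : <<s G2 >> setT by exact: (@measurableT _ (g_sigma_algebraType G2)).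
have Pim : Pi `<=` measurable.
  by move=> _ [D1 /G11 mD1 [D2 mD2 <-]]; apply: measurableI; [exact: G1m|exact: G2m].
have sPim : <<s Pi >> `<=` measurable.
  by apply: smallest_sub => //; exact: sigma_algebra_measurable.
have sub : <<s (G1 `|` G2) >> `<=` <<s Pi >>.
  apply: smallest_sub; first exact: smallest_sigma_algebra.
  move=> A [GA|GA]; apply: sub_sigma_algebra.
    by exists A; [exact: sub_sigma_algebra|exists setT; rewrite ?setIT].
  by exists setT => //; exists A; [exact: sub_sigma_algebra|rewrite setTI].
have mp' : measurable_fun setT p by exact: (measurable_fun_sub G1m).
have ZE A : measurable A -> P (A `&` E) = (\int[P]_(x in A) (\1_E x)%:E)%E.
  by move=> mA; rewrite integral_indic// setIC.
move=> /sub sD; rewrite ZE; last exact: sPim.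
move: D sD; apply: dynkin_eq_integral => //.
- move=> _ _ [X1 mX1 [X2 mX2 <-]] [Y1 mY1 [Y2 mY2 <-]].
  exists (X1 `&` Y1); first exact: (@measurableI _ (g_sigma_algebraType G1)).
  exists (X2 `&` Y2); first exact: (@measurableI _ (g_sigma_algebraType G2)).
  by rewrite setIACA.
- by exists setT => //; exists setT => //; rewrite setIT.
- by apply/measurable_EFinP; exact: measurable_indic.
- by apply/measurable_EFinP.
- by rewrite integral_indic// setIT (le_lt_trans (probability_le1 _ mE))// ltry.
move=> _ [D1 mD1 [D2 mD2 <-]].
have mD1' : measurable D1 by apply: G1m; exact: G11.
have mD2' : measurable D2 by exact: G2m.
rewrite -ZE; last exact: measurableI.
rewrite setIAC ind//; last first.
  by apply: (@measurableI _ (g_sigma_algebraType G1')) => //; exact: G11.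
rewrite pE//.
have fD2 : P D2 = (fine (P D2))%:E by rewrite fineK// fin_num_measure.
transitivity (\int[P]_x (((\1_D1 x)%:E * (p x)%:E) * (fine (P D2))%:E))%E.
  rewrite ge0_integralZr//; last 3 first.
  - by apply: emeasurable_funM; apply/measurable_EFinP => //; exact: measurable_indic.
  - by move=> x _; rewrite mule_ge0 ?lee_fin.
  - by rewrite lee_fin fine_ge0.
  by rewrite -fD2 integral_indicM.
rewrite -(pull_out G1m (Y := \1_D2))//.
- rewrite -[RHS]integral_indicM; apply: eq_integral => x _.
  by rewrite indicI /= EFinM muleAC.
- by rewrite fine_ge0.
- move=> A mA; rewrite integral_indic//; last exact: G1m.
  rewrite integral_cst//; last exact: G1m.
  by rewrite -fD2 setIC; apply: etrans (ind _ _ mA mD2) _; exact: muleC.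
- by move=> x; rewrite mule_ge0 ?lee_fin.
- apply: emeasurable_funM; apply/measurable_EFinP => //.
  by apply: measurable_indic; exact: G11.
Qed.

End independent_extension.

(** * Sigma-algebras generated by random variables *)

Section generated.
Context d {Omega : measurableType d} {R : realType}.
Implicit Types (X : set (Omega -> R)).

Definition generators X : set (set Omega) :=
  \bigcup_(f in X) preimage_set_system setT f measurable.

Definition known X := g_sigma_algebraType (generators X).

Lemma measurable_known X f : X f -> measurable_fun (setT : set (known X)) f.
Proof.
by move=> Xf _ A mA; apply: sub_sigma_algebra; exists f => //; exists A.
Qed.

Lemma sigma_of_sub X (F : set (set Omega)) : sigma_algebra setT F ->
  (forall f, X f -> forall A, measurable A -> F (f @^-1` A)) ->
  sigma_of X `<=` F.
Proof.
move=> sF XF; apply: smallest_sub => // _ [f Xf [A mA <-]].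
by rewrite setTI; exact: XF.
Qed.

Lemma sigma_of_le X X' :
  (forall f, X f -> measurable_fun (setT : set (known X')) f) ->
  sigma_of X `<=` sigma_of X'.
Proof.
move=> XX'; apply: sigma_of_sub; first exact: smallest_sigma_algebra.
by move=> f Xf A mA; rewrite -[_ @^-1` _]setTI; exact: XX'.
Qed.

Lemma sigma_of_subset X X' : X `<=` X' -> sigma_of X `<=` sigma_of X'.
Proof. by move=> XX'; apply: sigma_of_le => f /XX'; exact: measurable_known. Qed.

Lemma sigma_of_measurable X :
  (forall f, X f -> measurable_fun setT f) -> sigma_of X `<=` measurable.
Proof.
move=> mX; apply: sigma_of_sub; first exact: sigma_algebra_measurable.
by move=> f Xf A mA; rewrite -[_ @^-1` _]setTI; exact: mX.
Qed.

Lemma measurable_known_le d' (S : measurableType d') X X' (f : Omega -> S) :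
  sigma_of X `<=` sigma_of X' ->
  measurable_fun (setT : set (known X)) f ->
  measurable_fun (setT : set (known X')) f.
Proof. by move=> XX' mf _ A mA; apply: XX'; exact: mf. Qed.

Lemma sigma_of_preimage d' (S : measurableType d') X (f : Omega -> S) A :
  measurable_fun (setT : set (known X)) f -> measurable A ->
  sigma_of X (f @^-1` A).
Proof. by move=> mf mA; rewrite -[_ @^-1` _]setTI; exact: mf. Qed.

(** The events of this form are a sigma-algebra that contains the generators. *)
Lemma sigma_of_fibres X p (h : Omega -> 'I_p) (D : set Omega) :
  sigma_of (X `|` [set fun om => (h om)%:R]) D ->
  exists2 E : 'I_p -> set Omega, (forall j, sigma_of X (E j)) &
    D = [set om | E (h om) om].
Proof.
pose F := [set D : set Omega | exists2 E : 'I_p -> set Omega,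
  (forall j, sigma_of X (E j)) & D = [set om | E (h om) om]].
move: D; apply: (sigma_of_sub (F := F)).
  split.
  - by exists (fun=> set0) => // j; exact: (@measurable0 _ (known X)).
  - move=> A [E sE ->]; exists (fun j => ~` E j) => [j|].
      by apply: (@measurableC _ (known X)); exact: sE.
    by rewrite setTD.
  - move=> A AF.
    have AF' k : exists E : 'I_p -> set Omega,
        (forall j, sigma_of X (E j)) /\ A k = [set om | E (h om) om].
      by have [E e1 e2] := AF k; exists E.
    have [E EP] := choice AF'.
    exists (fun j => \bigcup_k E k j) => [j|].
      by apply: (@bigcupT_measurable _ (known X)) => k; exact: (EP k).1.
    apply/seteqP; split=> om [k _].
      by have [_ ->] := EP k; exists k.
    by move=> Ek; exists k => //; have [_ ->] := EP k.
move=> f [Xf|->] A mA.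
  by exists (fun=> f @^-1` A) => // j; apply: sigma_of_preimage => //; exact: measurable_known.
exists (fun j : 'I_p => [set om : Omega | A j%:R]) => // j.
have [Aj|Aj] := pselect (A j%:R).
  rewrite (_ : [set _ | _] = setT); first exact: (@measurableT _ (known X)).
  by apply/seteqP; split.
rewrite (_ : [set _ | _] = set0); first exact: (@measurable0 _ (known X)).
by apply/seteqP; split.
Qed.

Lemma measurable_fibres d0 (T : measurableType d0) d' (S : measurableType d')
    (I : finType) (h : T -> I) (F : I -> T -> S) :
  (forall i, measurable (h @^-1` [set i])) ->
  (forall i, measurable_fun setT (F i)) ->
  measurable_fun setT (fun t => F (h t) t).
Proof.
move=> mh mF _ A mA; rewrite setTI.
rewrite (_ : _ @^-1` _ = \bigcup_(i in [set: I]) (h @^-1` [set i] `&` F i @^-1` A)).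
  apply: fin_bigcup_measurable; first exact: finite_finset.
  move=> i _; apply: measurableI => //.
  by rewrite -[X in measurable X]setTI; exact: mF.
apply/seteqP; split=> t /=; first by move=> At; exists (h t).
by case=> i _ /= [<-].
Qed.

Lemma measurable_finite X (I : finType) (h : Omega -> I) (F : I -> R) :
  (forall i, sigma_of X (h @^-1` [set i])) ->
  measurable_fun (setT : set (known X)) (fun om => F (h om)).
Proof.
by move=> mh; apply: (@measurable_fibres _ (known X) _ _ I h (fun i _ => F i)).
Qed.

Lemma fibre_natr (b : Omega -> bool) c :
  b @^-1` [set c] = (fun om => (b om)%:R : R) @^-1` [set c%:R].
Proof.
apply/seteqP; split=> om /=; first by move=> ->.
by case: (b om) c => -[]// /eqP; rewrite ?oner_eq0// eq_sym oner_eq0.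
Qed.

Lemma known_fibre X p (h : Omega -> 'I_p) j :
  measurable_fun (setT : set (known X)) (fun om => (h om)%:R : R) ->
  sigma_of X (h @^-1` [set j]).
Proof.
move=> mh; rewrite (_ : _ @^-1` _ = (fun om => (h om)%:R : R) @^-1` [set (j%:R : R)]).
  exact: sigma_of_preimage.
apply/seteqP; split=> om /=; first by move=> ->.
by move/eqP; rewrite eqr_nat => /eqP/val_inj.
Qed.

End generated.

(** * The closed loop under an admissible control *)

Lemma integral_complement d (T : measurableType d) (R : realType)
    (P : probability T R) (D : set T) (a a' : T -> R) : measurable D ->
  (forall t, 0 <= a t) -> (forall t, 0 <= a' t) ->
  measurable_fun setT a -> measurable_fun setT a' ->
  (forall t, a t + a' t = 1) ->
  (\int[P]_(t in D) (a t)%:E + \int[P]_(t in D) (a' t)%:E = P D)%E.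
Proof.
move=> mD a0 a0' ma ma' aa; rewrite -ge0_integralD//; last 4 first.
- by move=> t _; rewrite lee_fin.
- by apply: measurable_funTS; exact/measurable_EFinP.
- by move=> t _; rewrite lee_fin.
- by apply: measurable_funTS; exact/measurable_EFinP.
transitivity (\int[P]_(t in D) cst 1%E t)%E.
  by apply: eq_integral => t _; rewrite -EFinD aa.
by rewrite integral_cst// mul1e.
Qed.

Lemma measurable_inv d (T : measurableType d) (R : realType) (f : T -> R) :
  measurable_fun setT f -> measurable_fun setT (fun t => (f t)^-1).
Proof.
suff mi : measurable_fun setT (@GRing.inv R) by exact: measurableT_comp.
rewrite (_ : @GRing.inv R = fun y => \1_(~` [set 0 : R]) y * (y + \1_[set 0 : R] y)^-1).
  apply: measurable_funM; first by apply: measurable_indic; exact: measurableC.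
  apply: measurable_fun_invr => [y|].
    rewrite indicE; have [->|y0] := eqVneq y 0; first by rewrite mem_set// add0r oner_neq0.
    by rewrite memNset ?addr0//= => /eqP; rewrite (negbTE y0).
  by apply: measurable_funD => //; exact: measurable_indic.
apply/funext => y; rewrite !indicE; have [->|y0] := eqVneq y 0.
  by rewrite memNset/= ?mul0r ?invr0//; exact.
by rewrite mem_set ?memNset/= ?mul1r ?addr0// => /eqP; rewrite (negbTE y0).
Qed.

Section closed_loop.
Context {R : realType} {n m : nat} (M : model R n m).
Context d {Omega : measurableType d} (P : probability Omega R).
Variables (P0 : psdmx R n) (B0 : R).
Variables (x w : nat -> Omega -> 'cV[R]_n) (v : nat -> Omega -> 'cV[R]_m).
Variables (g H : nat -> Omega -> R).
Hypotheses (mg : forall k, measurable_fun setT (g k))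
  (mH : forall k, measurable_fun setT (H k)).
Variables (gam : nat -> Omega -> bool) (hgam : nat -> Omega -> 'I_3).
Variables (u : nat -> Omega -> R) (T : nat).

Local Notation nextK := (kpair (gainK M) (harvK M)).
Local Notation batt := (battery M B0 H u).
Local Notation Pk := (error_cov M P0 gam).
Local Notation info := (info M P0 B0 g H hgam u).
Local Notation past := (past x w v g H gam hgam).

Hypothesis mplant : forall f,
  (coords (x 0%N) `|` (\bigcup_t coords (w t)) `|` (\bigcup_t coords (v t))) f ->
  measurable_fun setT f.
Hypothesis adm : admissible M P P0 B0 x w v g H gam hgam u T.

Let rgam k : Omega -> R := fun om => (gam k om)%:R.
Let rhgam k : Omega -> R := fun om => (hgam k om)%:R.

(** Two times are distinguished because the gains and energies of the next stages
    enter while the feedback stays at that of stage [k]. *)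
Definition observed (k t : nat) : set (Omega -> R) :=
  [set f : Omega -> R | exists2 i, (i < k)%N & f = rhgam i] `|`
  [set f : Omega -> R | exists2 i, (i <= t)%N & f = g i \/ f = H i].

Lemma observed_le k k' t t' : (k <= k')%N -> (t <= t')%N ->
  sigma_of (observed k t) `<=` sigma_of (observed k' t').
Proof.
move=> kk' tt'; apply: sigma_of_subset => f [[i ik ->]|[i it fE]].
  by left; exists i => //; exact: leq_trans kk'.
by right; exists i => //; exact: leq_trans tt'.
Qed.

Lemma observed_past k t : sigma_of (observed k t) `<=` sigma_of (past k).
Proof.
apply: sigma_of_subset => f [[i ik ->]|[i it [->|->]]].
- by right; exists i => //; right.
- by left; left; right; exists i.
- by left; right; exists i.
Qed.

Lemma past_measurable k : (k <= T.+1)%N -> sigma_of (past k) `<=` measurable.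
Proof.
move=> kT; apply: sigma_of_measurable => f [[[xwv|[i _ <-]]|[i _ <-]]|].
- exact: mplant.
- exact: mg.
- exact: mH.
case=> t tk [->|->].
  by apply: (adm_gam adm); rewrite -ltnS (leq_trans tk).
by apply: (adm_hgam adm); rewrite -ltnS (leq_trans tk).
Qed.

Lemma past_gam_measurable k : (k <= T)%N ->
  sigma_of (past k `|` [set rgam k]) `<=` measurable.
Proof.
move=> kT; apply: sigma_of_measurable => f [pf|->]; last exact: (adm_gam adm).
move=> _ A mA; rewrite setTI; apply: (@past_measurable k); first exact: leqW.
by apply: sigma_of_preimage mA; exact: measurable_known.
Qed.

Lemma observed_measurable k t : (k <= T.+1)%N ->
  sigma_of (observed k t) `<=` measurable.
Proof. by move=> kT; apply: subset_trans (past_measurable kT); exact: observed_past. Qed.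

Lemma measurable_observed_gH k t i : (i <= t)%N ->
  measurable_fun (setT : set (known (observed k t))) (g i) /\
  measurable_fun (setT : set (known (observed k t))) (H i).
Proof.
by move=> it; split; apply: measurable_known; right; exists i => //; [left|right].
Qed.

(** The energies depend on the earlier battery levels, which depend on the energies
    spent before, whence a strong induction. *)
Lemma measurable_battery k : (k <= T.+1)%N ->
  measurable_fun (setT : set (known (observed k k))) (batt k).
Proof.
elim/ltn_ind: k => -[|k] IH kT; first exact: measurable_cst.
have IHk i : (i <= k)%N -> measurable_fun (setT : set (known (observed k.+1 k.+1))) (batt i).
  move=> ik; apply: measurable_known_le (IH i _ _) => //.
    by apply: observed_le; exact: leqW.
  by rewrite (leq_trans ik)// ltnW.
have uk : measurable_fun (setT : set (known (observed k.+1 k.+1))) (u k).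
  move=> _ A mA; rewrite setTI.
  have : sigma_of (info k) (u k @^-1` A) by exact: (adm_u adm).
  apply: sigma_of_le => f [|].
    case=> [->|->|->|[i [j ->]]].
    - exact: (measurable_observed_gH _ _).1.
    - exact: (measurable_observed_gH _ _).2.
    - exact: IHk.
    - exact: measurable_cst.
  case=> t /andP[t0 tk] [->|->|->|->].
  - apply: measurable_known; left; exists t.-1 => //.
    by rewrite prednK// leqW.
  - by apply: (measurable_observed_gH _ _).1; exact: leqW.
  - by apply: (measurable_observed_gH _ _).2; exact: leqW.
  - exact: IHk.
rewrite /=; apply: measurable_minr; last exact: measurable_cst.
apply: measurable_funD; last exact: (measurable_observed_gH _ _).2.
by apply: measurable_funB => //; exact: IHk.
Qed.

Lemma measurable_control k t : (k <= T)%N -> (k <= t)%N ->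
  measurable_fun (setT : set (known (observed k t))) (u k).
Proof.
move=> kT kt; apply: (measurable_known_le (observed_le (leqnn k) kt)).
move=> _ A mA; rewrite setTI.
have : sigma_of (info k) (u k @^-1` A) by exact: (adm_u adm).
apply: sigma_of_le => f [|].
  case=> [->|->|->|[i [j ->]]].
  - exact: (measurable_observed_gH _ _).1.
  - exact: (measurable_observed_gH _ _).2.
  - exact: measurable_cst.
  - exact: measurable_cst.
case=> i /andP[i0 ik] [->|->|->|->].
- by apply: measurable_known; left; exists i.-1 => //; rewrite prednK.
- exact: (measurable_observed_gH _ _).1.
- exact: (measurable_observed_gH _ _).2.
- apply: (measurable_known_le (observed_le ik ik)); apply: measurable_battery.
  by rewrite (leq_trans ik)// ltnW.
Qed.

Let G1 (k : nat) (b : bool) : Omega -> R := \1_[set om | gam k om = b].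
Let H1 (k : nat) (j : 'I_3) : Omega -> R := \1_[set om | hgam k om = j].

Let G1E k b om : G1 k b om = (gam k om == b)%:R.
Proof.
by rewrite /G1 indicE; congr (nat_of_bool _)%:R; apply/idP/eqP; rewrite inE.
Qed.

Let H1E k j om : H1 k j om = (hgam k om == j)%:R.
Proof.
by rewrite /H1 indicE; congr (nat_of_bool _)%:R; apply/idP/eqP; rewrite inE.
Qed.

Lemma measurable_gam_event k b : (k <= T)%N -> measurable [set om | gam k om = b].
Proof.
move=> kT; rewrite (_ : [set _ | _] = rgam k @^-1` [set b%:R]).
  by rewrite -[X in measurable X]setTI; apply: (adm_gam adm).
exact: (fibre_natr (gam k)).
Qed.

Lemma measurable_hgam_event k j : (k <= T)%N -> measurable [set om | hgam k om = j].
Proof.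
move=> kT; rewrite (_ : [set _ | _] = rhgam k @^-1` [set (j : nat)%:R]).
  by rewrite -[X in measurable X]setTI; apply: (adm_hgam adm).
apply/seteqP; split=> om /=; rewrite /rhgam; first by move=> ->.
by move/eqP; rewrite eqr_nat => /eqP/val_inj.
Qed.

Lemma measurable_chan_past k b : (k <= T)%N ->
  measurable_fun (setT : set (known (past k))) (fun om => chan M b (g k om) (u k om)).
Proof.
move=> kT; apply: (measurable_known_le (@observed_past k k)).
apply: measurable_chan; last exact: measurable_control.
exact: (measurable_observed_gH _ _).1.
Qed.

(** The hypothesis [adm_channel] speaks of receptions; the case of a loss follows
    by complementation. *)
Lemma channel_pull k b (Z : Omega -> \bar R) : (k <= T)%N ->
  (forall om, 0 <= Z om)%E ->
  measurable_fun (setT : set (known (past k))) Z ->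
  (\int[P]_om (Z om * (G1 k b om)%:E) =
   \int[P]_om (Z om * (chan M b (g k om) (u k om))%:E))%E.
Proof.
move=> kT Z0 mZ; have kT1 : (k <= T.+1)%N by exact: leqW.
have pm := past_measurable kT1.
have mchan b' : measurable_fun setT (fun om => chan M b' (g k om) (u k om)).
  by apply: (measurable_fun_sub pm); exact: measurable_chan_past.
have condT D : sigma_of (past k) D -> (\int[P]_(om in D) (G1 k true om)%:E =
    \int[P]_(om in D) (chan M true (g k om) (u k om))%:E)%E.
  move=> sD; have [_ <-//] := adm_channel adm kT.
  by rewrite integral_indic ?(setIC D)//; [exact: pm|exact: measurable_gam_event].
apply: (pull_out pm) => //.
- by move=> om; exact: chan_ge0.
- by apply: measurable_indic; exact: measurable_gam_event.
case: b => // D sD; have mD : measurable D by exact: pm.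
have mG b : measurable_fun setT (G1 k b).
  by apply: measurable_indic; exact: measurable_gam_event.
have chan0 b om : 0 <= chan M b (g k om) (u k om) by exact: chan_ge0.
have e1 : (\int[P]_(om in D) (G1 k false om)%:E + \int[P]_(om in D) (G1 k true om)%:E = P D)%E.
  apply: integral_complement => // om; rewrite !G1E.
  by case: (gam k om); rewrite (addr0, add0r).
have e2 : (\int[P]_(om in D) (chan M false (g k om) (u k om))%:E +
    \int[P]_(om in D) (chan M true (g k om) (u k om))%:E = P D)%E.
  by apply: integral_complement => // om; rewrite addrC chanD.
have fG : (\int[P]_(om in D) (G1 k true om)%:E)%E \is a fin_num.
  rewrite integral_indic//; last exact: measurable_gam_event.
  by rewrite fin_num_measure//; apply: measurableI => //; exact: measurable_gam_event.
move: e2; rewrite -condT// -e1 => /(congr1 (fun z => z - \int[P]_(om in D) (G1 k true om)%:E)%E).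
by rewrite !addeK.
Qed.

Lemma measurable_G1 k b : (k <= T)%N -> measurable_fun setT (G1 k b).
Proof. by move=> kT; apply: measurable_indic; exact: measurable_gam_event. Qed.

Lemma measurable_H1 k j : (k <= T)%N -> measurable_fun setT (H1 k j).
Proof. by move=> kT; apply: measurable_indic; exact: measurable_hgam_event. Qed.

(** Conditioning successively on the past together with the reception, and on the
    past alone. *)
Lemma feedback_pull k b j (Z : Omega -> \bar R) : (k <= T)%N ->
  (forall om, 0 <= Z om)%E ->
  measurable_fun (setT : set (known (past k))) Z ->
  (\int[P]_om (Z om * (G1 k b om)%:E * (H1 k j om)%:E) =
   \int[P]_om (Z om * (fback M j b * chan M b (g k om) (u k om))%:E))%E.
Proof.
move=> kT Z0 mZ; have pm := past_gam_measurable kT.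
have psub : sigma_of (past k) `<=` sigma_of (past k `|` [set rgam k]).
  by apply: sigma_of_subset => f; left.
have mrg : measurable_fun (setT : set (known (past k `|` [set rgam k]))) (rgam k).
  by apply: measurable_known; right.
have mGk b' : measurable_fun (setT : set (known (past k `|` [set rgam k]))) (G1 k b').
  apply: (@measurable_indic _ (known _)).
  rewrite (_ : [set _ | _] = rgam k @^-1` [set b'%:R]).
    exact: (sigma_of_preimage mrg).
  exact: (fibre_natr (gam k)).
have mfb : measurable_fun (setT : set (known (past k `|` [set rgam k])))
    (fun om => fback M j (gam k om)).
  rewrite (_ : (fun _ => _) = (fun om => \sum_(b' : bool) fback M j b' * G1 k b' om)).
    by apply: measurable_sum => b'; apply: measurable_funM.
  apply/funext => om; rewrite big_bool !G1E.
  by case: (gam k om); rewrite /= !(mulr1, mulr0, addr0, add0r).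
rewrite (pull_out pm (Y' := fun om => fback M j (gam k om))) //.
- have step : (\int[P]_om (Z om * (G1 k b om)%:E * (fback M j (gam k om))%:E) =
      \int[P]_om ((fback M j b)%:E * (Z om * (G1 k b om)%:E)))%E.
    apply: eq_integral => om _; rewrite muleC G1E.
    by have [->//|nb] := eqVneq (gam k om) b; rewrite mulr0n !mule0.
  rewrite step.
  have mZ' : measurable_fun setT Z.
    by apply: (measurable_fun_sub (past_measurable (leqW kT))).
  have mc : measurable_fun setT (fun om => (chan M b (g k om) (u k om))%:E).
    apply/measurable_EFinP; apply: (measurable_fun_sub (past_measurable (leqW kT))).
    exact: measurable_chan_past.
  rewrite ge0_integralZl ?lee_fin ?fback_ge0//; last 2 first.
  + by apply: emeasurable_funM => //; apply/measurable_EFinP; exact: measurable_G1.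
  + by move=> om _; rewrite mule_ge0 ?lee_fin.
  rewrite channel_pull// -ge0_integralZl ?lee_fin ?fback_ge0//; last 2 first.
  + exact: emeasurable_funM.
  + by move=> om _; rewrite mule_ge0 ?lee_fin ?chan_ge0.
  by apply: eq_integral => om _; rewrite EFinM muleCA.
- by move=> om; exact: fback_ge0.
- exact: measurable_H1.
- exact: (measurable_fun_sub pm).
- move=> D sD; have [_ <-//] := adm_feedback adm kT j.
  by rewrite integral_indic ?(setIC D)//; [exact: pm|exact: measurable_hgam_event].
- by move=> om; rewrite mule_ge0 ?lee_fin.
- apply: emeasurable_funM; last by apply/measurable_EFinP; exact: mGk.
  exact: measurable_known_le psub mZ.
Qed.

Lemma feedback_marg_pull k j (Z : Omega -> \bar R) : (k <= T)%N ->
  (forall om, 0 <= Z om)%E ->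
  measurable_fun (setT : set (known (past k))) Z ->
  (\int[P]_om (Z om * (H1 k j om)%:E) =
   \int[P]_om (Z om * (fback_marg M j (g k om) (u k om))%:E))%E.
Proof.
move=> kT Z0 mZ.
have mZ' : measurable_fun setT Z.
  by apply: (measurable_fun_sub (past_measurable (leqW kT))).
transitivity (\sum_(b : bool) \int[P]_om (Z om * (G1 k b om)%:E * (H1 k j om)%:E))%E.
  rewrite -ge0_integral_sum//; last 2 first.
  - move=> b; apply: emeasurable_funM; last by apply/measurable_EFinP; exact: measurable_H1.
    by apply: emeasurable_funM => //; apply/measurable_EFinP; exact: measurable_G1.
  - by move=> b om _; rewrite !mule_ge0 ?lee_fin.
  apply: eq_integral => om _; rewrite big_bool /= !G1E.
  by case: (gam k om); rewrite /= !(mule1, mule0, mul0e, adde0, add0e).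
under eq_bigr do rewrite feedback_pull//.
rewrite -ge0_integral_sum//; last 2 first.
- move=> b; apply: emeasurable_funM => //; apply/measurable_EFinP.
  apply: measurable_funM; first exact: measurable_cst.
  apply: (measurable_fun_sub (past_measurable (leqW kT))).
  exact: measurable_chan_past.
- by move=> b om _; rewrite mule_ge0 ?lee_fin ?mulr_ge0 ?fback_ge0 ?chan_ge0.
apply: eq_integral => om _; rewrite -ge0_sume_distrr ?sumEFin// => b _.
by rewrite lee_fin mulr_ge0 ?fback_ge0 ?chan_ge0.
Qed.

(** The profile of the belief obtained by iterating [Phi] along the feedback from
    the point mass at [P0]. On a feedback value of probability zero it is the zero
    profile, which has no effect almost surely. *)
Fixpoint belief_cost (k : nat) (om : Omega) : seq bool -> R :=
  if k is k'.+1 then fun s =>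
    (fback_marg M (hgam k' om) (g k' om) (u k' om))^-1 *
    upd M (hgam k' om) (g k' om) (u k' om) (belief_cost k' om) s
  else fun s => path_trace M s P0.

Lemma belief_cost_ge0 k om : ge0_profile (belief_cost k om).
Proof.
elim: k => [|k IH] s /=; first exact: path_trace_ge0.
by rewrite mulr_ge0 ?invr_ge0 ?fback_marg_ge0//; exact: upd_ge0.
Qed.

Let after (k : nat) (j : 'I_3) (om : Omega) : seq bool -> R := fun s =>
  (fback_marg M j (g k om) (u k om))^-1 *
  upd M j (g k om) (u k om) (belief_cost k om) s.

Let after_ge0 k j om : ge0_profile (after k j om).
Proof.
move=> s; rewrite /after mulr_ge0 ?invr_ge0 ?fback_marg_ge0//.
by apply: upd_ge0; exact: belief_cost_ge0.
Qed.

Let measurable_marg k t j : (k <= T)%N -> (k <= t)%N ->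
  measurable_fun (setT : set (known (observed k t)))
    (fun om => fback_marg M j (g k om) (u k om)).
Proof.
move=> kT kt; apply: measurable_sum => b; apply: measurable_funM => //.
apply: measurable_chan; last exact: measurable_control.
exact: (measurable_observed_gH _ _).1.
Qed.

Let measurable_after k t j s : (k <= T)%N -> (k <= t)%N ->
  (forall s, measurable_fun (setT : set (known (observed k t)))
     (fun om => belief_cost k om s)) ->
  measurable_fun (setT : set (known (observed k t))) (fun om => after k j om s).
Proof.
move=> kT kt mb; apply: measurable_funM.
  by apply: measurable_inv; exact: measurable_marg.
apply: measurable_upd => //; last exact: measurable_control.
exact: (measurable_observed_gH _ _).1.
Qed.

Lemma measurable_belief_cost k t s : (k <= T.+1)%N -> (k <= t)%N ->
  measurable_fun (setT : set (known (observed k t))) (fun om => belief_cost k om s).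
Proof.
elim: k s => [|k IH] s kT kt; first exact: measurable_cst.
apply: (@measurable_fibres _ (known (observed k.+1 t)) _ _ 'I_3 (hgam k)
  (fun j om => after k j om s)).
  move=> j; apply: known_fibre; apply: measurable_known.
  by left; exists k.
move=> j; apply: (measurable_known_le (observed_le (leqnSn k) (leqnn t))).
apply: measurable_after => //; first exact: ltnW.
by move=> s'; apply: IH; [exact: ltnW|exact: ltnW].
Qed.

Lemma past_le k k' : (k <= k')%N -> sigma_of (past k) `<=` sigma_of (past k').
Proof.
move=> kk'; apply: sigma_of_subset => f [pf|[t tk fE]]; first by left.
by right; exists t => //; exact: leq_trans kk'.
Qed.

Lemma measurable_error_cov k : measurable_fun (setT : set (known (past k))) (Pk k).
Proof.
elim: k => [|k IH]; first exact: measurable_cst.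
apply: (@measurable_fibres _ (known (past k.+1)) _ _ bool (gam k)
  (fun b om => kalman M b (Pk k om))).
  move=> b; rewrite (_ : _ @^-1` _ = rgam k @^-1` [set b%:R]).
    apply: sigma_of_preimage => //; apply: measurable_known.
    by right; exists k => //; left.
  exact: (fibre_natr (gam k)).
move=> b; apply: (@measurableT_comp _ _ _ (known (past k.+1)) _ _ (kalman M b)).
  exact: measurable_kalman.
exact: (measurable_known_le (past_le (leqnSn k))).
Qed.

Lemma measurable_error_trace k s :
  measurable_fun (setT : set (known (past k))) (fun om => path_trace M s (Pk k om)).
Proof.
apply: (@measurableT_comp _ _ _ (known (past k)) _ _ (path_trace M s)).
  exact: measurable_path_trace.
exact: measurable_error_cov.
Qed.

(* An event known after the feedback of stage [k] is cut along its values. *)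
Let fibre_integral k t (Y Y' : Omega -> R) : (k <= T)%N ->
  (forall om, 0 <= Y om) -> (forall om, 0 <= Y' om) ->
  measurable_fun setT Y -> measurable_fun setT Y' ->
  (forall j E, sigma_of (observed k t) E ->
     \int[P]_om ((\1_E om)%:E * (Y om)%:E * (H1 k j om)%:E) =
     \int[P]_om ((\1_E om)%:E * (Y' om)%:E * (H1 k j om)%:E))%E ->
  forall D, sigma_of (observed k.+1 t) D ->
  (\int[P]_(om in D) (Y om)%:E = \int[P]_(om in D) (Y' om)%:E)%E.
Proof.
move=> kT Y0 Y0' mY mY' YY' D sD.
have [E sE DE] : exists2 E : 'I_3 -> set Omega,
    (forall j, sigma_of (observed k t) (E j)) & D = [set om | E (hgam k om) om].
  apply: sigma_of_fibres; move: D sD; apply: sigma_of_subset => f [[i ik ->]|fgH].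
    have [->|ik'] := eqVneq i k; first by right.
    by left; left; exists i => //; rewrite ltn_neqAle ik' -ltnS.
  by left; right.
have mE j : measurable (E j) by exact: (observed_measurable (leqW kT)).
have split_sum (V : Omega -> R) : (forall om, 0 <= V om) -> measurable_fun setT V ->
    (\int[P]_(om in D) (V om)%:E =
     \sum_(j < 3) \int[P]_om ((\1_(E j) om)%:E * (V om)%:E * (H1 k j om)%:E))%E.
  move=> V0 mV; rewrite -ge0_integral_sum//; last 2 first.
  - move=> j; apply: emeasurable_funM; last by apply/measurable_EFinP; exact: measurable_H1.
    by apply: emeasurable_funM; apply/measurable_EFinP => //; exact: measurable_indic.
  - by move=> j om _; rewrite !mule_ge0 ?lee_fin.
  rewrite -integral_indicM; apply: eq_integral => om _.
  rewrite (bigD1 (hgam k om))//= big1 ?adde0; last first.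
    by move=> j jh; rewrite H1E eq_sym (negbTE jh) mule0.
  rewrite H1E eqxx mule1 DE !indicE.
  rewrite (_ : (om \in [set om0 | E (hgam k om0) om0]) = (om \in E (hgam k om))); last first.
    by apply/idP/idP; rewrite !inE.
  by [].
by rewrite !split_sum//; apply: eq_bigr => j _; exact: YY'.
Qed.

(** By induction: on an event with feedback [j] at stage [k], the reception is replaced by its
    joint probability with [j], then the trace at stage [k] by its conditional
    expectation; the result is [upd], and multiplying it by the inverse of the
    probability of [j] compensates for the indicator of [j]. *)
Lemma belief_costP k t s D : (k <= T.+1)%N -> (k <= t)%N ->
  sigma_of (observed k t) D ->
  (\int[P]_(om in D) (path_trace M s (Pk k om))%:E =
   \int[P]_(om in D) (belief_cost k om s)%:E)%E.
Proof.
elim: k s D => [//|k IH] s D kT kt sD.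
have kT' : (k <= T)%N by [].
have kt' : (k <= t)%N by exact: ltnW.
have mpt i s' : (i <= T.+1)%N -> measurable_fun setT (fun om => path_trace M s' (Pk i om)).
  by move=> iT; apply: (measurable_fun_sub (past_measurable iT)); exact: measurable_error_trace.
have om_past := @measurable_known_le _ _ _ _ _ _ _ _ (@observed_past k t).
apply: (@fibre_integral k t _ _ kT' _ _ _ _ _ D sD) => //.
- by move=> om; exact: path_trace_ge0.
- by move=> om; exact: belief_cost_ge0.
- exact: mpt.
  apply: (measurable_fun_sub (observed_measurable (t := t) kT)).
  exact: measurable_belief_cost.
move=> j E sE.
have mE : measurable_fun (setT : set (known (observed k t))) (\1_E : Omega -> R).
  exact: (@measurable_indic _ (known _)).
have mchan b : measurable_fun (setT : set (known (observed k t)))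
    (fun om => chan M b (g k om) (u k om)).
  apply: measurable_chan; last exact: measurable_control.
  exact: (measurable_observed_gH _ _).1.
have mb s' : measurable_fun (setT : set (known (observed k t)))
    (fun om => belief_cost k om s').
  by apply: measurable_belief_cost => //; exact: ltnW.
have bfsub := @measurable_fun_sub _ _ _ (observed_measurable (t := t) (ltnW kT)).
transitivity (\int[P]_om ((\1_E om)%:E *
    (upd M j (g k om) (u k om) (belief_cost k om) s)%:E))%E; last first.
  transitivity (\int[P]_om ((\1_E om)%:E * (after k j om s)%:E * (H1 k j om)%:E))%E; last first.
    apply: eq_integral => om _; rewrite !H1E /=.
    by have [<-//|_] := eqVneq (hgam k om) j; rewrite !mule0.
  rewrite feedback_marg_pull//; last 2 first.
  - by move=> om; rewrite mule_ge0 ?lee_fin//; exact: after_ge0.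
  - apply: (measurable_known_le (@observed_past k t)).
    apply: emeasurable_funM; apply/measurable_EFinP => //.
    exact: measurable_after.
  apply: eq_integral => om _; rewrite -muleA; congr (_ * _)%E.
  by rewrite -EFinM mulrC /after fback_marg_updK.
transitivity (\sum_(b : bool) \int[P]_om ((\1_E om)%:E *
    (path_trace M (b :: s) (Pk k om))%:E * (G1 k b om)%:E * (H1 k j om)%:E))%E.
  rewrite -ge0_integral_sum//; last 2 first.
  - move=> b; apply: emeasurable_funM; last by apply/measurable_EFinP; exact: measurable_H1.
    apply: emeasurable_funM; last by apply/measurable_EFinP; exact: measurable_G1.
    apply: emeasurable_funM; apply/measurable_EFinP; first exact: bfsub.
    by apply: mpt; exact: ltnW.
  - by move=> b om _; rewrite !mule_ge0 ?lee_fin ?path_trace_ge0.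
  apply: eq_integral => om _; rewrite big_bool /= !G1E.
  by case: (gam k om); rewrite /= !(mule1, mule0, mul0e, adde0, add0e).
transitivity (\sum_(b : bool) \int[P]_om ((\1_E om)%:E *
    (fback M j b * chan M b (g k om) (u k om))%:E * (belief_cost k om (b :: s))%:E))%E.
  apply: eq_bigr => b _; rewrite feedback_pull//; last 2 first.
  - by move=> om; rewrite !mule_ge0 ?lee_fin ?path_trace_ge0.
  - apply: emeasurable_funM; apply/measurable_EFinP; first exact: om_past.
    exact: measurable_error_trace.
  under eq_integral do rewrite muleAC.
  apply: (pull_out (observed_measurable (t := t) (ltnW kT))
    (Y := fun om => path_trace M (b :: s) (Pk k om))
    (Y' := fun om => belief_cost k om (b :: s))) => //.
  - by move=> om; exact: path_trace_ge0.
  - by move=> om; exact: belief_cost_ge0.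
  - by apply: mpt; exact: ltnW.
  - exact: bfsub.
  - by move=> D' sD'; apply: IH => //; exact: ltnW.
  - by move=> om; rewrite mule_ge0 ?lee_fin ?mulr_ge0 ?fback_ge0 ?chan_ge0.
  - apply: emeasurable_funM; apply/measurable_EFinP => //.
    by apply: measurable_funM.
rewrite -ge0_integral_sum//; last 2 first.
- move=> b; apply: emeasurable_funM; last by apply/measurable_EFinP; exact: bfsub.
  apply: emeasurable_funM; apply/measurable_EFinP; first exact: bfsub.
  by apply: bfsub; apply: measurable_funM.
- by move=> b om _; rewrite !mule_ge0 ?lee_fin ?mulr_ge0 ?fback_ge0 ?chan_ge0// belief_cost_ge0.
apply: eq_integral => om _.
under eq_bigr do rewrite -muleA.
rewrite -ge0_sume_distrr; last first.
  by move=> b _; rewrite mule_ge0 ?lee_fin ?mulr_ge0 ?fback_ge0 ?chan_ge0// belief_cost_ge0.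
by congr (_ * _)%E; rewrite -sumEFin.
Qed.

Let gH (t : nat) (om : Omega) : R * R := (g t om, H t om).

Let measurable_gH k t : (k <= T.+1)%N ->
  measurable_fun (setT : set (known (observed k t))) (gH t).
Proof.
by move=> kT; apply: measurable_fun_pair; [exact: (measurable_observed_gH _ _).1|exact: (measurable_observed_gH _ _).2].
Qed.

Let measurable_gH0 t : measurable_fun setT (gH t).
Proof. exact: measurable_fun_pair. Qed.

Hypothesis markov0 : forall t D A, sigma_of (observed 0 t) D -> measurable A ->
  P (D `&` gH t.+1 @^-1` A) = (\int[P]_(om in D) kprob nextK (gH t om) A)%E.

(** Receptions and feedback are drawn given the whole trajectories of gains and
    energies. The indicator of a feedback value can therefore be replaced by its
    probability, which depends on earlier observations only. *)
Lemma markov k t D A : (k <= T.+1)%N -> (k <= t)%N ->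
  sigma_of (observed k t) D -> measurable A ->
  P (D `&` gH t.+1 @^-1` A) = (\int[P]_(om in D) kprob nextK (gH t om) A)%E.
Proof.
elim: k D => [|k IH] D kT kt sD mA; first exact: markov0.
have kT' : (k <= T)%N by [].
have kt' : (k <= t)%N by exact: ltnW.
have mgA : measurable (gH t.+1 @^-1` A).
  by rewrite -[X in measurable X]setTI; exact: measurable_gH0.
pose Y : Omega -> R := \1_(gH t.+1 @^-1` A).
pose Y' om := fine (kprob nextK (gH t om) A).
have Y'E om : (Y' om)%:E = kprob nextK (gH t om) A.
  by rewrite fineK// fin_num_measure.
have mK i : (i <= T.+1)%N -> measurable_fun (setT : set (known (observed i t))) Y'.
  move=> iT; apply/measurable_EFinP.
  rewrite (_ : EFin \o Y' = fun om => kprob nextK (gH t om) A); last by apply/funext.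
  by apply: (@measurableT_comp _ _ _ (known (observed i t)) _ _ (kprob nextK ^~ A));
    [exact: (measurable_kernel nextK)|exact: measurable_gH].
have mD : measurable D by apply: (observed_measurable kT); exact: sD.
transitivity (\int[P]_(om in D) (Y om)%:E)%E; first by rewrite integral_indic// setIC.
transitivity (\int[P]_(om in D) (Y' om)%:E)%E; last exact: eq_integral.
have mY : measurable_fun setT Y by exact: measurable_indic.
have mY' : measurable_fun setT Y'.
  by apply: (measurable_fun_sub (observed_measurable (t := t) kT)); exact: mK.
have Y'0 om : 0 <= Y' om by rewrite fine_ge0.
apply: (@fibre_integral k t _ _ kT' _ _ _ _ _ D sD) => //.
move=> j E sE.
have mE : measurable_fun (setT : set (known (observed k t))) (\1_E : Omega -> R).
  exact: (@measurable_indic _ (known _)).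
have mY_past : measurable_fun (setT : set (known (past k))) Y.
  apply: (@measurable_indic _ (known _)).
  apply: (@sigma_of_preimage _ _ _ _ _ (past k) (gH t.+1)) => //.
  apply: measurable_fun_pair; apply: measurable_known.
    by left; left; right; exists t.+1.
  by left; right; exists t.+1.
rewrite !feedback_marg_pull//.
- rewrite (eq_integral (fun om => (\1_E om)%:E * (fback_marg M j (g k om) (u k om))%:E * (Y om)%:E)%E); last first.
    by move=> om _; rewrite muleAC.
  rewrite [RHS](eq_integral (fun om => (\1_E om)%:E * (fback_marg M j (g k om) (u k om))%:E * (Y' om)%:E)%E); last first.
    by move=> om _; rewrite muleAC.
  apply: (pull_out (observed_measurable (t := t) (ltnW kT)) (Y := Y) (Y' := Y')) => //.
  + move=> D' sD'; have mD' : measurable D' by apply: (observed_measurable (ltnW kT)); exact: sD'.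
    transitivity (P (D' `&` gH t.+1 @^-1` A)); first by rewrite integral_indic// setIC.
    rewrite (IH D')//; last exact: ltnW.
    by apply: eq_integral => om _; rewrite Y'E.
  + by move=> om; rewrite mule_ge0 ?lee_fin ?fback_marg_ge0.
  + apply: emeasurable_funM; apply/measurable_EFinP => //.
    exact: measurable_marg.
- by move=> om; rewrite mule_ge0 ?lee_fin.
- apply: (measurable_known_le (@observed_past k t)).
  by apply: emeasurable_funM; apply/measurable_EFinP => //; apply: mK; exact: ltnW.
- by move=> om; rewrite mule_ge0 ?lee_fin.
- apply: emeasurable_funM; apply/measurable_EFinP => //.
  exact: (measurable_known_le (@observed_past k t)).
Qed.

Definition expected_value l k : \bar R :=
  (\int[P]_om W M l (belief_cost k om) (g k om) (H k om) (batt k om))%E.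

Lemma expected_stage_cost k : (k <= T)%N ->
  ('E_P[fun om => \tr (Pk k.+1 om)] =
   \int[P]_om (step_cost M (g k om) (u k om) (belief_cost k om))%:E)%E.
Proof.
move=> kT; have kT1 := leqW kT; rewrite unlock.
have mpt i s : (i <= T.+1)%N -> measurable_fun setT (fun om => path_trace M s (Pk i om)).
  by move=> iT; apply: (measurable_fun_sub (past_measurable iT)); exact: measurable_error_trace.
have bfsub := @measurable_fun_sub _ _ _ (observed_measurable (t := k) kT1).
have mchan b : measurable_fun (setT : set (known (observed k k)))
    (fun om => chan M b (g k om) (u k om)).
  apply: measurable_chan; last exact: measurable_control.
  exact: (measurable_observed_gH _ _).1.
transitivity (\sum_(b : bool) \int[P]_om
    ((path_trace M [:: b] (Pk k om))%:E * (G1 k b om)%:E))%E.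
  rewrite -ge0_integral_sum//; last 2 first.
  - move=> b; apply: emeasurable_funM; apply/measurable_EFinP; first exact: mpt.
    exact: measurable_G1.
  - by move=> b om _; rewrite !mule_ge0 ?lee_fin ?path_trace_ge0.
  apply: eq_integral => om _; rewrite big_bool /= !G1E.
  by case: (gam k om); rewrite /= !(mule1, mule0, mul0e, adde0, add0e).
transitivity (\sum_(b : bool) \int[P]_om
    ((chan M b (g k om) (u k om))%:E * (belief_cost k om [:: b])%:E))%E.
  apply: eq_bigr => b _; rewrite channel_pull//; last 2 first.
  - by move=> om; rewrite lee_fin path_trace_ge0.
  - by apply/measurable_EFinP; exact: measurable_error_trace.
  under eq_integral do rewrite muleC.
  apply: (pull_out (observed_measurable (t := k) kT1)
    (Y := fun om => path_trace M [:: b] (Pk k om))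
    (Y' := fun om => belief_cost k om [:: b])) => //.
  - by move=> om; exact: path_trace_ge0.
  - by move=> om; exact: belief_cost_ge0.
  - exact: mpt.
  - by apply: bfsub; exact: measurable_belief_cost.
  - by move=> D sD; apply: belief_costP sD.
  - by move=> om; rewrite lee_fin chan_ge0.
  - exact/measurable_EFinP.
rewrite -ge0_integral_sum//; last 2 first.
- move=> b; apply: emeasurable_funM; apply/measurable_EFinP; apply: bfsub => //.
  exact: measurable_belief_cost.
- by move=> b om _; rewrite mule_ge0 ?lee_fin ?chan_ge0 ?belief_cost_ge0.
by apply: eq_integral => om _; rewrite /step_cost -sumEFin.
Qed.

(** The indicator of each feedback value is replaced by its probability given the
    past, which homogeneity moves inside [W]; then the next gain and energy are
    integrated out with [freezing]. *)
Lemma expected_next_value l k : (k <= T)%N ->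
  expected_value l k.+1 = (\int[P]_om \sum_(j < 3)
    \int[kprob nextK (g k om, H k om)]_z
      W M l (upd M j (g k om) (u k om) (belief_cost k om)) z.1 z.2
        (Num.min (batt k om - u k om + z.2) (Bmax M))%R)%E.
Proof.
move=> kT; have kT1 := leqW kT.
have rW := regular_W M l.
have bfsub := @measurable_fun_sub _ _ _ (observed_measurable (t := k) kT1).
have mb s : measurable_fun (setT : set (known (observed k k)))
    (fun om => belief_cost k om s) by exact: measurable_belief_cost.
have mgk : measurable_fun (setT : set (known (observed k k))) (g k).
  exact: (measurable_observed_gH _ _).1.
have muk : measurable_fun (setT : set (known (observed k k))) (u k).
  exact: measurable_control.
have mbk : measurable_fun (setT : set (known (observed k k))) (batt k).
  exact: measurable_battery.
have to_past := @measurable_known_le _ _ _ _ _ _ _ _ (@observed_past k k).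
have mg_past i : measurable_fun (setT : set (known (past k))) (g i).
  by apply: measurable_known; left; left; right; exists i.
have mH_past i : measurable_fun (setT : set (known (past k))) (H i).
  by apply: measurable_known; left; right; exists i.
have mbatt_past : measurable_fun (setT : set (known (past k)))
    (fun om => Num.min (batt k om - u k om + H k.+1 om) (Bmax M)).
  apply: measurable_minr; last exact: measurable_cst.
  by apply: measurable_funD => //; apply: measurable_funB; exact: to_past.
have mupd j s : measurable_fun (setT : set (known (observed k k)))
    (fun om => upd M j (g k om) (u k om) (belief_cost k om) s).
  exact: measurable_upd.
have upd0 j om : ge0_profile (upd M j (g k om) (u k om) (belief_cost k om)).
  by apply: upd_ge0; exact: belief_cost_ge0.
pose f j (p : known (observed k k) * (R * R)) :=
  W M l (upd M j (g k p.1) (u k p.1) (belief_cost k p.1)) p.2.1 p.2.2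
    (Num.min (batt k p.1 - u k p.1 + p.2.2) (Bmax M)).
have f0 j p : (0 <= f j p)%E by exact: (regular_ge0 rW).
have mf j : measurable_fun setT (f j).
  by apply: (measurable_next M rW) => // om; exact: belief_cost_ge0.
pose Z j om := W M l (after k j om) (g k.+1 om) (H k.+1 om)
    (Num.min (batt k om - u k om + H k.+1 om) (Bmax M)).
have Z0 j om : (0 <= Z j om)%E by apply: (regular_ge0 rW); exact: after_ge0.
have mZ j : measurable_fun (setT : set (known (past k))) (Z j).
  apply: (@regular_measurable _ _ _ rW _ (known (past k))) => //.
  - by move=> s; apply: to_past; exact: measurable_after.
have mZ' j : measurable_fun setT (Z j).
  by apply: (measurable_fun_sub (past_measurable kT1)).
transitivity (\sum_(j < 3) \int[P]_om (Z j om * (H1 k j om)%:E))%E.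
  rewrite -ge0_integral_sum//; last 2 first.
  - by move=> j; apply: emeasurable_funM => //; apply/measurable_EFinP; exact: measurable_H1.
  - by move=> j om _; rewrite mule_ge0 ?lee_fin.
  apply: eq_integral => om _; rewrite (bigD1 (hgam k om))//= big1 ?adde0.
    by rewrite H1E eqxx mule1.
  by move=> j jh; rewrite H1E eq_sym (negbTE jh) mule0.
rewrite ge0_integral_sum//; last 2 first.
- move=> j; apply: bfsub; apply: (measurable_next_integral M rW) => // [om|].
    exact: belief_cost_ge0.
  exact: (measurable_observed_gH _ _).2.
- by move=> j om _; apply: integral_ge0 => z _; exact: (f0 j (om, z)).
apply: eq_bigr => j _; rewrite feedback_marg_pull//.
transitivity (\int[P]_om f j (om, gH k.+1 om))%E.
  apply: eq_integral => om _; rewrite /Z /f /=.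
  set a := fback_marg M j (g k om) (u k om).
  have [a00|a0] := eqVneq a 0.
    by rewrite a00 mule0 upd_null// W_profile0.
  rewrite muleC -W_scale; last 2 first.
  - by rewrite lt0r a0 fback_marg_ge0.
  - exact: after_ge0.
  by congr (W M l _ _ _ _); apply/funext => s; rewrite /after fback_marg_updK.
apply: (freezing (observed_measurable (t := k) kT1) (@measurable_gH k k kT1) (measurable_gH0 k.+1)) => //.
by move=> D A sD mA; exact: (markov kT1 (leqnn k) sD mA).
Qed.

Lemma expected_recursion l k : (k <= T)%N ->
  ('E_P[fun om => \tr (Pk k.+1 om)] + expected_value l k.+1 =
   \int[P]_om Qf M (W M l) (belief_cost k om) (g k om) (H k om) (batt k om) (u k om))%E.
Proof.
move=> kT; have kT1 := leqW kT.
have bfsub := @measurable_fun_sub _ _ _ (observed_measurable (t := k) kT1).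
have b0 om := belief_cost_ge0 k om.
have mb s : measurable_fun (setT : set (known (observed k k)))
    (fun om => belief_cost k om s) by exact: measurable_belief_cost.
have [mgk mHk] := @measurable_observed_gH k k k (leqnn k).
have muk := measurable_control kT (leqnn k).
rewrite expected_stage_cost// expected_next_value// -ge0_integralD//.
- by move=> om _; rewrite lee_fin step_cost_ge0.
- by apply/measurable_EFinP; apply: bfsub; exact: measurable_step_cost.
- move=> om _; apply: sume_ge0 => j _; apply: integral_ge0 => z _.
  by apply: (regular_ge0 (regular_W M l)); exact: upd_ge0.
- apply: bfsub; apply: emeasurable_sum => j.
  by apply: (measurable_next_integral M (regular_W M l)) => //; exact: measurable_battery.
Qed.

(** One stage at a time: [W] is below the function that it minimises at the energy
    actually spent, which lies in [0, B] almost surely. *)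
Lemma expected_value_le l k : (k + l = T.+1)%N ->
  (expected_value l k <= \sum_(i < l) 'E_P[fun om => \tr (Pk (k + i).+1 om)])%E.
Proof.
elim: l k => [|l IH] k klT.
  by rewrite big_ord0 /expected_value integral0.
have kT : (k <= T)%N by rewrite -ltnS -klT addnS ltnS leq_addr.
rewrite big_ord_recl addn0.
apply: (@le_trans _ _ ('E_P[fun om => \tr (Pk k.+1 om)] + expected_value l k.+1)%E); last first.
  rewrite leeD2l//; apply: (le_trans (IH k.+1 _)); first by rewrite addSnnS.
  by apply: lee_sum => i _; rewrite addSnnS.
rewrite expected_recursion// /expected_value.
have b0 om := belief_cost_ge0 k om.
have mb s : measurable_fun (setT : set (known (observed k k)))
    (fun om => belief_cost k om s) by exact: (measurable_belief_cost _ (leqW kT)).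
have [mgk mHk] := @measurable_observed_gH k k k (leqnn k).
have muk := measurable_control kT (leqnn k).
have mbk := measurable_battery (leqW kT).
have bfsub := @measurable_fun_sub _ _ _ (observed_measurable (t := k) (leqW kT)).
apply: ae_ge0_le_integral => //.
- by move=> om _; exact: (regular_ge0 (regular_W M l.+1)).
- by apply: bfsub; exact: (regular_measurable (regular_W M l.+1)).
- by move=> om _; exact: (Qf_ge0 M (regular_W M l)).
- by apply: bfsub; exact: (measurable_Qf M (regular_W M l)).
apply: filterS (adm_energy adm kT) => om /andP[u0 uB] _.
have B0' : 0 <= batt k om by exact: le_trans uB.
pose t := u k om / batt k om.
have uE : u k om = t * Num.max 0 (batt k om).
  rewrite max_r//; have [B00|B00] := eqVneq (batt k om) 0; last by rewrite /t divfK.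
  by rewrite B00 mulr0; apply/eqP; rewrite eq_le u0 -B00 uB.
have t01 : unitI t.
  rewrite /unitI /= divr_ge0//=.
  have [B00|B00] := eqVneq (batt k om) 0; first by rewrite /t B00 invr0 mulr0 ler01.
  by rewrite ler_pdivrMr ?mul1r// lt0r B00.
by rewrite uE; exact: (min01_le _ t01).
Qed.

Lemma expected_value_eq l k : (k + l = T.+1)%N ->
  (forall i l' om, (i + l' = T)%N ->
     Qf M (W M l') (belief_cost i om) (g i om) (H i om) (batt i om) (u i om) =
     W M l'.+1 (belief_cost i om) (g i om) (H i om) (batt i om)) ->
  (expected_value l k = \sum_(i < l) 'E_P[fun om => \tr (Pk (k + i).+1 om)])%E.
Proof.
move=> + opt; elim: l k => [|l IH] k klT.
  by rewrite big_ord0 /expected_value integral0.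
have kT : (k <= T)%N by rewrite -ltnS -klT addnS ltnS leq_addr.
rewrite big_ord_recl addn0.
transitivity ('E_P[fun om => \tr (Pk k.+1 om)] + expected_value l k.+1)%E.
  rewrite expected_recursion//; apply: eq_integral => om _.
  by rewrite opt//; apply: succn_inj; rewrite -klT addnS.
rewrite IH; last by rewrite addSnnS.
by congr (_ + _)%E; apply: eq_bigr => i _; rewrite addSnnS.
Qed.

End closed_loop.

(** * Independence of the primitive random elements *)

Section independent_sources.
Context d {Omega : measurableType d} {R : realType} (P : probability Omega R).
Variables (I : Type) (V : I -> set (Omega -> R)).
Hypothesis mV : forall s f, V s f -> measurable_fun setT f.
Hypothesis indV : mutually_independent P (fun s => sigma_of (V s)).

Let I' := {classic I}.

Lemma independent_seq (L : seq I') (E : I' -> set Omega) : uniq L ->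
  (forall s, sigma_of (V s) (E s)) ->
  P (\bigcap_(s in [set s | s \in L]) E s) = (\prod_(s <- L) P (E s))%E.
Proof.
move=> uL sE; rewrite big_tnth -(indV (s := fun i => tnth (in_tuple L) i)); last 2 first.
- by move=> i j /(tuple_uniqP (in_tuple L)) ; exact.
- by move=> i; exact: sE.
congr (P _); apply/seteqP; split=> om /= h.
  by move=> i _; apply: h; exact: mem_tnth.
move=> s sL; have /tnthP[i ->] : s \in in_tuple L by [].
exact: h.
Qed.

(** The finite intersections of events of the other sources form a pi-system, on
    which the product rule is the mutual independence. *)
Lemma independent_rest (s0 : I) D E :
  sigma_of (\bigcup_(s in [set s | s <> s0]) V s) D -> sigma_of (V s0) E ->
  P (D `&` E) = (P D * P E)%E.
Proof.
move=> sD sE.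
have mF s A : sigma_of (V s) A -> measurable A by apply: sigma_of_measurable; exact: mV.
have mE := mF _ _ sE; pose s1 : I' := s0.
pose Pi := [set A | exists L : seq I', exists F : I' -> set Omega,
  [/\ uniq L, s1 \notin L, forall s, sigma_of (V s) (F s) &
      A = \bigcap_(s in [set s | s \in L]) F s]].
have FT s : sigma_of (V s) setT by exact: (@measurableT _ (known (V s))).
have Pim : Pi `<=` measurable.
  move=> _ [L [F [uL _ sF ->]]]; rewrite bigcap_seq.
  by apply: bigsetI_measurable => s _; exact: mF (sF s).
have sPim : <<s Pi >> `<=` measurable.
  by apply: smallest_sub => //; exact: sigma_algebra_measurable.
have sub : sigma_of (\bigcup_(s in [set s | s <> s0]) V s) `<=` <<s Pi >>.
  apply: sigma_of_sub; first exact: smallest_sigma_algebra.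
  move=> f [s /= ss0 Vf] A mA; apply: sub_sigma_algebra.
  exists [:: (s : I')], (fun s' : I' => if s' == (s : I') then f @^-1` A else setT); split=> //.
  - by rewrite mem_seq1; apply/eqP => ss; exact: ss0.
  - move=> s'; case: eqP => [->|_]; last exact: FT.
    by apply: sigma_of_preimage mA; exact: measurable_known.
  - apply/seteqP; split=> om /=.
      by move=> fA s' /=; rewrite mem_seq1 => /eqP ->; rewrite eqxx.
    by move/(_ (s : I')); rewrite /= mem_seq1 eqxx; exact.
have fE : P E = (fine (P E))%:E by rewrite fineK// fin_num_measure.
suff : (\int[P]_(om in D) (\1_E om)%:E = \int[P]_(om in D) (fine (P E))%:E)%E.
  have mD : measurable D by apply: sPim; exact: sub.
  rewrite integral_indic// setIC => ->.
  by rewrite integral_cst// -fE muleC.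
move/sub: sD => sD; move: D sD; apply: dynkin_eq_integral => //.
- move=> _ _ [L1 [F1 [u1 n1 sF1 ->]]] [L2 [F2 [u2 n2 sF2 ->]]].
  exists (undup (L1 ++ L2)), (fun s => (if s \in L1 then F1 s else setT) `&`
    (if s \in L2 then F2 s else setT)); split.
  + exact: undup_uniq.
  + by rewrite mem_undup mem_cat negb_or n1.
  + by move=> s; apply: (@measurableI _ (known (V s))); case: ifP => _; (exact: FT || exact: sF1 || exact: sF2).
  + apply/seteqP; split=> om /=.
      by move=> [h1 h2] s _; split; case: ifP => // sL; [exact: h1|exact: h2].
    move=> h; split=> s /= sL.
      by have := h s; rewrite /= mem_undup mem_cat sL => /(_ isT)[].
    by have := h s; rewrite /= mem_undup mem_cat sL orbT => /(_ isT)[].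
- exists [::], (fun=> setT); split => //.
  by apply/seteqP; split.
- by move=> om; rewrite lee_fin fine_ge0.
- by apply/measurable_EFinP; exact: measurable_indic.
- by rewrite integral_indic// setIT (le_lt_trans (probability_le1 _ mE))// ltry.
move=> A PA; have mA := Pim _ PA; case: PA => L [F [uL nL sF AE]].
rewrite integral_indic// integral_cst// -fE.
pose F' (s : I') := if s == s1 then E else F s.
have sF' s : sigma_of (V s) (F' s) by rewrite /F'; case: eqP => [->|].
have AF : A = \bigcap_(s in [set s | s \in L]) F' s.
  rewrite AE; apply: eq_bigcapr => s /= sL; rewrite /F' ifN//.
  by apply: contraNneq nL => <-.
have EAE : E `&` A = \bigcap_(s in [set s | s \in s1 :: L]) F' s.
  rewrite AF; apply/seteqP; split=> om /=.
    by move=> [Eom h] s /=; rewrite in_cons => /orP[/eqP ->|sL]; [rewrite /F' eqxx|exact: h].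
  move=> h; split; last by move=> s sL; apply: h; rewrite /= in_cons sL orbT.
  by have := h s1; rewrite /F' /= eqxx in_cons eqxx; exact.
have u1L : uniq (s1 :: L) by rewrite /= nL.
rewrite EAE; apply: etrans (independent_seq u1L sF') _.
rewrite big_cons {1}/F' eqxx; congr (_ * _)%E; rewrite AF.
exact/esym/(independent_seq uL sF').
Qed.

End independent_sources.

(** * Two independent Markov chains *)

Section markov_pair.
Context d {Omega : measurableType d} {R : realType} (P : probability Omega R).
Implicit Types (X Y : nat -> Omega -> R) (K : R.-pker R ~> R).

Definition upto X t : set (Omega -> R) :=
  [set f : Omega -> R | exists2 i, (i <= t)%N & f = X i].

Definition markov_steps K X := forall t A, measurable A ->
  cond_prob P (sigma_of (upto X t)) (X t.+1 @^-1` A) (fun om => K (X t om) A).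

Definition independent_sequences X Y := forall D E,
  sigma_of (range X) D -> sigma_of (range Y) E -> P (D `&` E) = (P D * P E)%E.

Lemma sigma_of_range_measurable X : (forall k, measurable_fun setT (X k)) ->
  sigma_of (range X) `<=` measurable.
Proof. by move=> mX; apply: sigma_of_measurable => f [k _ <-]. Qed.

Lemma markov_independent K X Y t : (forall k, measurable_fun setT (X k)) ->
  (forall k, measurable_fun setT (Y k)) -> markov_steps K X ->
  independent_sequences X Y ->
  forall D A, sigma_of (upto X t `|` range Y) D -> measurable A ->
  P (D `&` X t.+1 @^-1` A) = (\int[P]_(om in D) K (X t om) A)%E.
Proof.
move=> mX mY XP XY D A + mA.
have KE om : K (X t om) A = (fine (kprob K (X t om) A))%:E.
  by rewrite fineK// fin_num_measure.
rewrite /sigma_of bigcup_setU => sD.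
rewrite (independent_extension (G1 := generators (upto X t))
  (G1' := generators (range X)) (G2 := generators (range Y))
  (E := X t.+1 @^-1` A) (p := fun om => fine (kprob K (X t om) A)) (P := P)).
- by apply: eq_integral => om _; rewrite KE.
- exact: sigma_of_range_measurable.
- exact: sigma_of_range_measurable.
- by apply: sigma_of_subset => f [i _ ->]; exists i.
- exact: XY.
- by apply: sigma_of_preimage mA; apply: measurable_known; exists t.+1.
- by move=> om; rewrite fine_ge0.
- apply: (@measurableT_comp _ _ _ _ _ _ (@fine R)) => //.
  have mK : measurable_fun setT (fun x => K x A) by exact: measurable_kernel.
  apply: (measurableT_comp mK).
  by apply: measurable_known; exists t.
- move=> D1 sD1; have [_ ->//] := XP t A mA.
  by apply: eq_integral => om _; rewrite KE.
- exact: sD.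
Qed.

(** The next states are integrated out one after the other: that of [Y] given the
    whole trajectory of [X], then that of [X] given the whole trajectory of [Y]. *)
Lemma markov_pair K1 K2 X Y t : (forall k, measurable_fun setT (X k)) ->
  (forall k, measurable_fun setT (Y k)) ->
  markov_steps K1 X -> markov_steps K2 Y -> independent_sequences X Y ->
  forall D A, sigma_of (upto X t `|` upto Y t) D -> measurable A ->
  P (D `&` (fun om => (X t.+1 om, Y t.+1 om)) @^-1` A) =
  (\int[P]_(om in D) kprob (kpair K1 K2) (X t om, Y t om) A)%E.
Proof.
move=> mX mY XP YP XY D A sD mA.
have YX : independent_sequences Y X.
  by move=> D1 E1 s1 s2; rewrite setIC XY// muleC.
pose S1 := upto X t `|` range Y; pose S2 := upto Y t `|` range X.
have mS (Z Z' : nat -> Omega -> R) : (forall k, measurable_fun setT (Z k)) ->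
    (forall k, measurable_fun setT (Z' k)) ->
    sigma_of (upto Z t `|` range Z') `<=` measurable.
  by move=> mZ mZ'; apply: sigma_of_measurable => f [[i _ ->]|[i _ <-]].
have mS1 := mS _ _ mX mY; have mS2 := mS _ _ mY mX.
have sD1 : sigma_of S1 D.
  move: D sD; apply: sigma_of_subset => f [|[i _ ->]]; first by left.
  by right; exists i.
have sD2 : sigma_of S2 D.
  move: D sD {sD1}; apply: sigma_of_subset => f [[i _ ->]|]; last by left.
  by right; exists i.
have mD : measurable D by exact: mS1.
have mXt : measurable_fun (setT : set (known S1)) (X t).
  by apply: measurable_known; left; exists t.
have mYt : measurable_fun (setT : set (known S2)) (Y t).
  by apply: measurable_known; left; exists t.
have mYt1 : measurable_fun (setT : set (known S1)) (Y t).
  by apply: measurable_known; right; exists t.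
have mXt2 : measurable_fun (setT : set (known S2)) (X t.+1).
  by apply: measurable_known; right; exists t.+1.
pose f2 (z : known S2 * R) : \bar R :=
  ((\1_D z.1 : R)%:E * (\1_A (X t.+1 z.1, z.2) : R)%:E)%E.
have mf2 : measurable_fun setT f2.
  apply: emeasurable_funM; apply/measurable_EFinP.
    apply: (measurableT_comp (f := \1_D : known S2 -> R)).
      by apply: measurable_indic; exact: sD2.
    exact: measurable_fst.
  apply: (measurableT_comp (f := \1_A : R * R -> R)) => //.
  by apply: measurable_fun_pair => //; exact: (measurableT_comp mXt2).
pose f1 (z : known S1 * R) : \bar R :=
  (\int[K2 (Y t z.1)]_h ((\1_D z.1 : R)%:E * (\1_A (z.2, h) : R)%:E))%E.
have mf1 : measurable_fun setT f1.
  have mY1 : measurable_fun (setT : set (known S1 * R)) (fun z => Y t z.1).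
    exact: (measurableT_comp mYt1).
  apply: (measurable_integral_kpull K2 mY1 (h := fun p : (known S1 * R) * R =>
    ((\1_D p.1.1 : R)%:E * (\1_A (p.1.2, p.2) : R)%:E)%E)) => [z|].
    by rewrite mule_ge0 ?lee_fin.
  apply: emeasurable_funM; apply/measurable_EFinP.
    apply: (measurableT_comp (f := \1_D : known S1 -> R)).
      by apply: measurable_indic; exact: sD1.
    exact: measurableT_comp.
  apply: (measurableT_comp (f := \1_A : R * R -> R)) => //.
  by apply: measurable_fun_pair => //; exact: measurableT_comp.
have mXY : measurable_fun setT (fun om => (X t.+1 om, Y t.+1 om)).
  exact: measurable_fun_pair.
have mXYA : measurable ((fun om => (X t.+1 om, Y t.+1 om)) @^-1` A).
  by rewrite -[X in measurable X]setTI; exact: mXY.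
transitivity (\int[P]_om f2 (om, Y t.+1 om))%E.
  transitivity (\int[P]_om (\1_(D `&` (fun om => (X t.+1 om, Y t.+1 om)) @^-1` A) om)%:E)%E.
    by rewrite integral_indic ?setIT//; exact: measurableI.
  by apply: eq_integral => om _; rewrite indicI /f2 /= EFinM.
rewrite (freezing (K := K2) mS2 mYt (mY t.+1)); last 3 first.
- by move=> D' A' sD' mA'; exact: (markov_independent mY mX YP YX).
- by move=> z; rewrite mule_ge0 ?lee_fin.
- exact: mf2.
transitivity (\int[P]_om f1 (om, X t.+1 om))%E; first by [].
rewrite (freezing (K := K1) mS1 mXt (mX t.+1)); last 3 first.
- by move=> D' A' sD' mA'; exact: (markov_independent mX mY XP XY).
- by move=> z; apply: integral_ge0 => h _; rewrite mule_ge0 ?lee_fin.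
- exact: mf1.
rewrite [RHS]integral_mkcond; apply: eq_integral => om _.
rewrite patchE /f1 /=; case: ifPn => omD.
  transitivity (\int[kprob K1 (X t om)]_y kprob K2 (Y t om) (xsection A y))%E; last by [].
  apply: eq_integral => y _.
  transitivity (\int[kprob K2 (Y t om)]_h (\1_(xsection A y) h)%:E)%E; last first.
    by rewrite integral_indic ?setIT//; exact: measurable_xsection.
  apply: eq_integral => h _; rewrite [X in (X%:E * _)%E]indicE omD mul1e !indicE.
  by rewrite mem_xsection.
rewrite integral0_eq// => y _; rewrite integral0_eq// => h _.
by rewrite indicE (negbTE omD) mul0e.
Qed.

End markov_pair.

(** * Randomization by a uniform variable *)

Lemma uniform_prob_le (R : realType) (q : R) : 0 <= q <= 1 ->
  uniform_prob (@ltr01 R) [set t | t <= q] = q%:E.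
Proof.
move=> /andP[q0 q1].
have mq : measurable [set t : R | t <= q].
  by rewrite (_ : [set _ | _] = `]-oo, q]%classic)//.
transitivity (\int[uniform_prob (@ltr01 R)]_t (\1_[set t : R | t <= q] t)%:E)%E.
  by rewrite integral_indic ?setIT.
rewrite integral_uniform//; last first.
  by apply/measurable_EFinP; exact: measurable_indic.
rewrite subr0 invr1 mul1e integral_indic//.
rewrite (_ : [set t | t <= q] `&` _ = `[0, q]%classic); last first.
  apply/seteqP; split=> t /=; rewrite !in_itv/=.
    by move=> [tq /andP[->]].
  by move=> /andP[t0 tq]; rewrite t0 (le_trans tq).
apply: etrans (lebesgue_measure_itv `[0, q]) _; rewrite /= lte_fin.
have [_|q0'] := ltP; first by rewrite -EFinD subr0.
by congr EFin; apply/eqP; rewrite eq_le q0.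
Qed.

Section uniform_threshold.
Context d {Omega : measurableType d} {R : realType} (P : probability Omega R).
Variables (X : set (Omega -> R)) (U : {RV P >-> R}).
Hypothesis mX : forall f, X f -> measurable_fun setT f.
Let mU : measurable_fun setT U. Proof. exact: measurable_funPT. Qed.
Hypothesis UP : forall A, measurable A ->
  P (U @^-1` A) = uniform_prob (@ltr01 R) A.
Hypothesis indU : forall D E, sigma_of X D -> sigma_of [set (U : Omega -> R)] E ->
  P (D `&` E) = (P D * P E)%E.

Lemma measurable_threshold (q : Omega -> R) :
  measurable_fun setT q -> measurable [set om | U om <= q om].
Proof.
move=> mq; rewrite -[X in measurable X]setTI; exact: measurable_fun_le.
Qed.

(** A known threshold is frozen when integrating the independent variable [U]. *)
Lemma uniform_threshold (q : Omega -> R) D :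
  measurable_fun (setT : set (known X)) q -> (forall om, 0 <= q om <= 1) ->
  sigma_of X D ->
  P (D `&` [set om | U om <= q om]) = (\int[P]_(om in D) (q om)%:E)%E.
Proof.
move=> mq q01 sD.
have Xm : sigma_of X `<=` measurable by exact: sigma_of_measurable.
pose u1 : pprobability R R := distribution P U.
have mK : measurable_fun (setT : set R) (fun _ : R => u1) by exact: measurable_cst.
pose f (z : known X * R) : \bar R :=
  ((\1_D z.1 : R)%:E * (\1_[set p : known X * R | p.2 <= q p.1] z : R)%:E)%E.
have mq' : measurable_fun (setT : set (known X * R)) (fun p => q p.1).
  exact: (measurableT_comp mq).
have mf : measurable_fun setT f.
  apply: emeasurable_funM; apply/measurable_EFinP.
    apply: (measurableT_comp (f := \1_D : known X -> R)).
      by apply: measurable_indic.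
    exact: measurable_fst.
  apply: measurable_indic; rewrite -[X in measurable X]setTI.
  exact: measurable_fun_le.
have mE : measurable [set om | U om <= q om].
  by apply: measurable_threshold; exact: (measurable_fun_sub Xm).
have mD : measurable D by exact: Xm.
transitivity (\int[P]_om f (om, U om))%E.
  transitivity (\int[P]_om (\1_(D `&` [set om | U om <= q om]) om)%:E)%E.
    by rewrite integral_indic ?setIT//; exact: measurableI.
  apply: eq_integral => om _; rewrite indicI /f /= EFinM.
  by congr (_ * _%:E)%E; rewrite !indicE; congr (nat_of_bool _)%:R; apply/idP/idP; rewrite !inE.
rewrite (freezing (K := kprobability mK) (X := fun=> 0) Xm _ mU); last 4 first.
- exact: measurable_cst.
- move=> D' A sD' mA; rewrite indU//; last first.
    by apply: sigma_of_preimage mA; exact: measurable_known.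
  transitivity (\int[P]_(om in D') cst (P (U @^-1` A)) om)%E; last by [].
  rewrite integral_cst; last exact: Xm.
  exact: muleC.
- by move=> z; rewrite mule_ge0 ?lee_fin.
- exact: mf.
rewrite [RHS]integral_mkcond; apply: eq_integral => om _; rewrite patchE.
case: ifPn => omD; last first.
  by rewrite integral0_eq// => t _; rewrite /f /= indicE (negbTE omD) mul0e.
have mqo : measurable [set t : R | t <= q om].
  by rewrite (_ : [set _ | _] = `]-oo, q om]%classic).
transitivity (\int[distribution P U]_t (\1_[set t | t <= q om] t)%:E)%E.
  apply: eq_integral => t _; rewrite /f /= indicE omD mul1e.
  by congr (_%:E)%E; rewrite !indicE; congr (nat_of_bool _)%:R; apply/idP/idP; rewrite !inE.
rewrite integral_indic// setIT.
by apply: etrans (UP mqo) _; exact: uniform_prob_le.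
Qed.

(** The value whose cell contains [t] when the unit interval is cut into
    consecutive cells of lengths [a], [b] and the rest. *)
Definition pick3 (a b t : R) : 'I_3 :=
  inord (if t <= a then 0%N else if t <= a + b then 1%N else 2).

Lemma pick3E a b t (j : 'I_3) : (pick3 a b t = j) <->
  (if t <= a then 0%N else if t <= a + b then 1%N else 2%N) = j :> nat.
Proof.
have lt3 : ((if (t <= a)%R then 0 else if (t <= a + b)%R then 1 else 2) < 3)%N by case: ifP => // _; case: ifP.
split=> [<-|e]; first by rewrite inordK.
by apply/val_inj; rewrite /= inordK.
Qed.

(** Each cell is a difference of two thresholds. *)
Lemma uniform_pick (p : 'I_3 -> Omega -> R) D j :
  (forall i, measurable_fun (setT : set (known X)) (p i)) ->
  (forall i om, 0 <= p i om) -> (forall om, \sum_(i < 3) p i om = 1) ->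
  sigma_of X D ->
  P (D `&` [set om | pick3 (p (inord 0) om) (p (inord 1) om) (U om) = j]) =
  (\int[P]_(om in D) (p j om)%:E)%E.
Proof.
move=> mp p0 p1 sD; set a := p (inord 0); set b := p (inord 1); pose c := p (inord 2).
have ma : measurable_fun (setT : set (known X)) a by exact: mp.
have a0 om : 0 <= a om by exact: p0.
have b0 om : 0 <= b om by exact: p0.
have c0 om : 0 <= c om by exact: p0.
have psum om : a om + b om + c om = 1.
  rewrite -(p1 om) !big_ord_recl big_ord0 addr0 addrA /a /b /c.
  by congr (p _ _ + p _ _ + p _ _); apply/val_inj; rewrite /= inordK.
have Xm : sigma_of X `<=` measurable by exact: sigma_of_measurable.
have mD := Xm _ sD.
have mab : measurable_fun (setT : set (known X)) (fun om => a om + b om).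
  by apply: measurable_funD; exact: mp.
have mO (q : Omega -> R) : measurable_fun (setT : set (known X)) q -> measurable_fun setT q.
  by move=> mq; exact: (measurable_fun_sub Xm).
set E0 := [set om | U om <= a om]; set E01 := [set om | U om <= a om + b om].
have mE0 : measurable E0 by apply: measurable_threshold; apply: mO; exact: mp.
have mE01 : measurable E01 by apply: measurable_threshold; exact: mO.
have E0P : P (D `&` E0) = (\int[P]_(om in D) (a om)%:E)%E.
  apply: uniform_threshold => // om; rewrite a0 -(psum om) -addrA lerDl.
  by rewrite addr_ge0.
have E01P : P (D `&` E01) = (\int[P]_(om in D) (a om)%:E + \int[P]_(om in D) (b om)%:E)%E.
  rewrite uniform_threshold//; last first.
    by move=> om; rewrite addr_ge0//= -(psum om) lerDl.
  under eq_integral do rewrite EFinD.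
  rewrite ge0_integralD//; try (by move=> om _; rewrite lee_fin);
    by apply: measurable_funTS; apply/measurable_EFinP; apply: mO; exact: mp.
have E0fin : P (D `&` E0) \is a fin_num.
  by rewrite fin_num_measure//; exact: measurableI.
case: j => -[|[|[|//]]] j3.
- rewrite (_ : Ordinal j3 = inord 0); last by apply/val_inj; rewrite /= inordK.
  rewrite -E0P; congr (P (_ `&` _)); apply/seteqP; split=> om /=.
    by move/pick3E => /=; rewrite /E0 inordK//=; case: ifP => //; case: ifP.
  by rewrite /E0 /= => h; apply/pick3E; rewrite h inordK.
- rewrite (_ : Ordinal j3 = inord 1); last by apply/val_inj; rewrite /= inordK.
  rewrite -/b -[RHS](addeK _ E0fin) [X in (_ = X - _)%E](_ : _ = P (D `&` E01)); last first.
    by rewrite E01P E0P addeC.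
  rewrite (_ : D `&` E01 = (D `&` E0) `|` (D `&` (E01 `\` E0))); last first.
    rewrite -setIUr; congr (_ `&` _); apply/seteqP; split=> om /=.
      by move=> h; have [h0|h0] := pselect (E0 om); [left|right].
    by case=> [|[]//]; rewrite /E0 /E01 /= => h; rewrite (le_trans h)// lerDl.
  rewrite measureU//; last 3 first.
  + exact: measurableI.
  + by apply: measurableI => //; exact: measurableD.
  + by apply/seteqP; split=> om //= [[_ h] [_ [_]]].
  rewrite addeAC subee// add0e; congr (P (_ `&` _)); apply/seteqP; split=> om /=.
    move/pick3E; rewrite /E0 /E01 inordK//=.
    by case: ifP => // /negP h; case: ifP.
  rewrite /E0 /E01 /= => -[h1 h0]; apply/pick3E; rewrite inordK// h1.
  by case: ifP => // /h0.
- rewrite (_ : Ordinal j3 = inord 2); last by apply/val_inj; rewrite /= inordK.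
  have tot : (P (D `&` E01) + \int[P]_(om in D) (c om)%:E = P D)%E.
    rewrite E01P -ge0_integralD//; last 4 first.
    + by move=> om _; rewrite lee_fin.
    + by apply: measurable_funTS; apply/measurable_EFinP; apply: mO; exact: mp.
    + by move=> om _; rewrite lee_fin.
    + by apply: measurable_funTS; apply/measurable_EFinP; apply: mO; exact: mp.
    rewrite -ge0_integralD//; last 4 first.
    + by move=> om _; rewrite -EFinD lee_fin addr_ge0.
    + by apply: measurable_funTS; apply/measurable_EFinP; exact: mO.
    + by move=> om _; rewrite lee_fin.
    + by apply: measurable_funTS; apply/measurable_EFinP; apply: mO; exact: mp.
    transitivity (\int[P]_(om in D) cst 1%E om)%E; last by rewrite integral_cst// mul1e.
    by apply: eq_integral => om _; rewrite -!EFinD psum.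
  have E01fin : P (D `&` E01) \is a fin_num.
    by rewrite fin_num_measure//; exact: measurableI.
  rewrite -/c -[RHS](addeK _ E01fin) [X in (_ = X - _)%E](_ : _ = P D); last first.
    by rewrite -tot addeC.
  rewrite (_ : [set om | _] = ~` E01); last first.
    apply/seteqP; split=> om /=.
      move/pick3E; rewrite /E01 inordK//=; case: ifP => // _.
      by case: ifP => // /negP.
    rewrite /E01 /= => /negP h; apply/pick3E; rewrite inordK// (negbTE h) ifN//.
    by apply: contra h => h; rewrite (le_trans h)// lerDl.
  rewrite -setDE measureD//; last by rewrite (le_lt_trans (probability_le1 _ mD))// ltry.
Qed.

End uniform_threshold.

(** * The optimal control *)

Section greedy.
Context {R : realType} {n m : nat} (M : model R n m).

Definition greedy l (c : seq bool -> R) (g H B : R) : R :=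
  arg01 (fun t => Qf M (W M l) c g H B (t * Num.max 0 B)) * Num.max 0 B.

Variables (l : nat) (c : seq bool -> R).
Hypothesis c0 : ge0_profile c.

Let argP g H B := arg01P (stage_ge0 M (regular_W M l) c0 g H B)
  (stage_lty M (regular_W M l) c0 g H B)
  (continuous_stage (regular_W M l) c0 (g := g) (H := H) (B := B)).

Lemma greedy_ge0 g H B : 0 <= greedy l c g H B.
Proof.
by have [/andP[t0 _] _] := argP g H B; rewrite mulr_ge0// le_max lexx.
Qed.

Lemma greedy_le g H B : greedy l c g H B <= Num.max 0 B.
Proof.
have [/andP[_ t1] _] := argP g H B.
by rewrite /greedy ler_piMl// le_max lexx.
Qed.

Lemma greedyP g H B : Qf M (W M l) c g H B (greedy l c g H B) = W M l.+1 c g H B.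
Proof. by have [_] := argP g H B. Qed.

End greedy.

Lemma measurable_greedy (R : realType) (n m : nat) (M : model R n m) l d
    (X : measurableType d) (c : X -> seq bool -> R) (g H B : X -> R) :
  (forall x, ge0_profile (c x)) ->
  (forall s, measurable_fun setT (c ^~ s)) -> measurable_fun setT g ->
  measurable_fun setT H -> measurable_fun setT B ->
  measurable_fun setT (fun x => greedy M l (c x) (g x) (H x) (B x)).
Proof.
move=> c0 mc mg mH mB.
have mB' : measurable_fun setT (fun x => Num.max 0 (B x)) by exact: measurable_maxr.
apply: measurable_funM => //.
apply: (measurable_arg01 (F := fun x t =>
  Qf M (W M l) (c x) (g x) (H x) (B x) (t * Num.max 0 (B x)))) => [x|x|x|t].
- exact: (stage_ge0 M (regular_W M l)).
- exact: (stage_lty M (regular_W M l)).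
- exact: (continuous_stage (regular_W M l)).
- by apply: (measurable_Qf M (regular_W M l)) => //; exact: measurable_funM.
Qed.

Section optimal_control.
Context {R : realType} {n m : nat} (M : model R n m).
Context d {Omega : measurableType d}.
Variables (P0 : psdmx R n) (B0 : R) (T : nat) (g H U : nat -> Omega -> R).

(* Even auxiliary variables draw the receptions, odd ones the feedback. *)
Definition received k om u : bool := U k.*2 om <= chan M true (g k om) u.

Definition feedback k om (b : bool) : 'I_3 :=
  pick3 (fback M (inord 0) b) (fback M (inord 1) b) (U k.*2.+1 om).

(** The cost profile of the belief and the battery level. The control is defined by
    recursion from them, and they depend on the earlier controls. *)
Fixpoint state (k : nat) (om : Omega) : (seq bool -> R) * R :=
  if k is k'.+1 then
    let cB := state k' om in
    let u := greedy M (T - k') cB.1 (g k' om) (H k' om) cB.2 in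
    let j := feedback k' om (received k' om u) in
    (fun s => (fback_marg M j (g k' om) u)^-1 * upd M j (g k' om) u cB.1 s,
     Num.min (cB.2 - u + H k om) (Bmax M))
  else (fun s => path_trace M s P0, B0).

Definition opt_u k om : R :=
  greedy M (T - k) (state k om).1 (g k om) (H k om) (state k om).2.
Definition opt_gam k om := received k om (opt_u k om).
Definition opt_hgam k om := feedback k om (opt_gam k om).

Lemma stateE k om : state k om =
  (belief_cost M P0 g opt_hgam opt_u k om, battery M B0 H opt_u k om).
Proof.
elim: k => [//|k IH] /=; rewrite -/(opt_u k om) -/(opt_gam k om) -/(opt_hgam k om).
by rewrite IH.
Qed.

Lemma opt_uE k om : opt_u k om =
  greedy M (T - k) (belief_cost M P0 g opt_hgam opt_u k om) (g k om) (H k om)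
    (battery M B0 H opt_u k om).
Proof. by rewrite {1}/opt_u stateE. Qed.

Lemma opt_profile_ge0 k om : ge0_profile (belief_cost M P0 g opt_hgam opt_u k om).
Proof. exact: belief_cost_ge0. Qed.

Lemma opt_u_ge0 k om : 0 <= opt_u k om.
Proof. by rewrite opt_uE; apply: greedy_ge0; exact: opt_profile_ge0. Qed.

Lemma opt_u_le k om : opt_u k om <= Num.max 0 (battery M B0 H opt_u k om).
Proof. by rewrite {1}opt_uE; apply: greedy_le; exact: opt_profile_ge0. Qed.

Lemma opt_uP k l om : (k + l)%N = T ->
  Qf M (W M l) (belief_cost M P0 g opt_hgam opt_u k om) (g k om) (H k om)
    (battery M B0 H opt_u k om) (opt_u k om) =
  W M l.+1 (belief_cost M P0 g opt_hgam opt_u k om) (g k om) (H k om)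
    (battery M B0 H opt_u k om).
Proof.
move=> klT; have -> : l = (T - k)%N by rewrite -klT addKn.
by rewrite opt_uE; apply: greedyP; exact: opt_profile_ge0.
Qed.

(** The set [X] stands for the information of an observer; the lemma is applied
    to the controller, to the past, and to the variables drawn so far. *)
Lemma measurable_opt (X : set (Omega -> R)) k :
  (forall i, (i <= k)%N -> measurable_fun (setT : set (known X)) (g i)) ->
  (forall i, (i <= k)%N -> measurable_fun (setT : set (known X)) (H i)) ->
  (forall i j, (i < k)%N -> sigma_of X (opt_hgam i @^-1` [set j])) ->
  [/\ forall s, measurable_fun (setT : set (known X))
        (fun om => belief_cost M P0 g opt_hgam opt_u k om s),
      measurable_fun (setT : set (known X)) (battery M B0 H opt_u k) &
      measurable_fun (setT : set (known X)) (opt_u k)].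
Proof.
elim: k => [|k IH] mg mH mh.
  have mc s : measurable_fun (setT : set (known X))
      (fun om => belief_cost M P0 g opt_hgam opt_u 0 om s) by exact: measurable_cst.
  have mb : measurable_fun (setT : set (known X)) (battery M B0 H opt_u 0).
    exact: measurable_cst.
  split=> //; rewrite (funext (opt_uE 0)); apply: measurable_greedy => //.
  - by move=> om; exact: opt_profile_ge0.
  - exact: mg.
  - exact: mH.
have [mc mb mu] : [/\ forall s, measurable_fun (setT : set (known X))
        (fun om => belief_cost M P0 g opt_hgam opt_u k om s),
      measurable_fun (setT : set (known X)) (battery M B0 H opt_u k) &
      measurable_fun (setT : set (known X)) (opt_u k)].
  by apply: IH => i; [move=> ?; apply: mg; exact: leqW|move=> ?; apply: mH; exact: leqW|
    move=> j ik; apply: mh; exact: leqW].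
have mgk : measurable_fun (setT : set (known X)) (g k) by exact: mg.
have mc' s : measurable_fun (setT : set (known X))
    (fun om => belief_cost M P0 g opt_hgam opt_u k.+1 om s).
  apply: (@measurable_fibres _ (known X) _ _ 'I_3 (opt_hgam k)
    (fun j om => (fback_marg M j (g k om) (opt_u k om))^-1 *
      upd M j (g k om) (opt_u k om) (belief_cost M P0 g opt_hgam opt_u k om) s)).
    by move=> j; exact: mh.
  move=> j; apply: measurable_funM; last exact: measurable_upd.
  apply: measurable_inv; apply: measurable_sum => b.
  apply: measurable_funM; first exact: measurable_cst.
  exact: measurable_chan.
have mb' : measurable_fun (setT : set (known X)) (battery M B0 H opt_u k.+1).
  apply: measurable_minr; last exact: measurable_cst.
  apply: measurable_funD; last exact: mH.
  exact: measurable_funB.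
split=> //; rewrite (funext (opt_uE k.+1)); apply: measurable_greedy => //.
- by move=> om; exact: opt_profile_ge0.
- exact: mg.
- exact: mH.
Qed.

End optimal_control.

(** * Admissibility of the optimal control *)

Lemma measurable_Prop d (S : measurableType d) (Q : Prop) :
  measurable [set _ : S | Q].
Proof.
have [q|q] := pselect Q.
  by rewrite (_ : [set _ | _] = setT)//; apply/seteqP; split.
by rewrite (_ : [set _ | _] = set0)//; apply/seteqP; split.
Qed.

Lemma measurable_pick3 (R : realType) (a b : R) j :
  measurable [set t : R | pick3 a b t = j].
Proof.
have mle (c : R) : measurable [set t : R | t <= c].
  by rewrite (_ : [set _ | _] = `]-oo, c]%classic).
rewrite (_ : [set t | _] = ([set t | t <= a] `&` [set _ | 0%N = j :> nat]) `|`
    (~` [set t | t <= a] `&` (([set t | t <= a + b] `&` [set _ | 1%N = j :> nat]) `|`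
    (~` [set t | t <= a + b] `&` [set _ | 2%N = j :> nat])))).
  apply: measurableU; first by apply: measurableI => //; exact: measurable_Prop.
  apply: measurableI; first exact: measurableC.
  apply: measurableU; apply: measurableI => //; try exact: measurable_Prop.
  exact: measurableC.
apply/seteqP; split=> t /=; rewrite pick3E.
  case: ifP => [ta <-|/negP ta]; first by left.
  by case: ifP => [tb <-|/negP tb <-]; right; split => //; [left|right].
by move=> [[-> //]|[/negP/negbTE -> [[-> //]|[/negP/negbTE -> //]]]].
Qed.

Section admissible_control.
Context {R : realType} {n m : nat} (M : model R n m).
Context d {Omega : measurableType d} (P : probability Omega R).
Variables (T : nat) (H0 B0 : R) (P0 : psdmx R n).
Variables (x w : nat -> Omega -> 'cV[R]_n) (y v : nat -> Omega -> 'cV[R]_m).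
Variables (g H U : nat -> {RV P >-> R}).
Hypotheses (H0_ge0 : 0 <= H0) (B0_range : 0 <= B0 <= Bmax M).
Hypothesis plantP : plant M P P0 x w y v.
Hypothesis HP : markov_chain (harvK M) H0 H.
Hypothesis UP : forall k A, measurable A ->
  P (U k @^-1` A) = uniform_prob (@ltr01 R) A.
Hypothesis indep : mutually_independent P
  (fun s => sigma_of (source_vars x w v g H U s)).

Local Notation opt_u := (opt_u M P0 B0 T g H U).
Local Notation opt_gam := (opt_gam M P0 B0 T g H U).
Local Notation opt_hgam := (opt_hgam M P0 B0 T g H U).
Local Notation batt := (battery M B0 H opt_u).
Local Notation past := (past x w v g H opt_gam opt_hgam).
Local Notation info := (info M P0 B0 g H opt_hgam opt_u).

Lemma measurable_plant (f : Omega -> R) :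
  (coords (x 0%N) `|` (\bigcup_t coords (w t)) `|` (\bigcup_t coords (v t))) f ->
  measurable_fun setT f.
Proof.
case=> [[fx|[t _ ft]]|[t _ ft]].
- by have [mu [+ _]] := plant_init plantP; exact.
- by have [+ _] := plant_w plantP t; exact.
- by have [+ _] := plant_v plantP t; exact.
Qed.

(** With [j = 2 k] this determines all that precedes the reception at stage [k],
    and with [j = 2 k + 1] all that precedes the feedback; it is independent of
    [U j]. *)
Definition drawn j : set (Omega -> R) :=
  coords (x 0%N) `|` (\bigcup_t coords (w t)) `|` (\bigcup_t coords (v t)) `|`
  range (fun k => g k : Omega -> R) `|` range (fun k => H k : Omega -> R) `|`
  [set f : Omega -> R | exists2 i, (i < j)%N & f = U i].

Lemma measurable_drawn j f : drawn j f -> measurable_fun setT f.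
Proof.
case=> [[[xwv|[i _ <-]]|[i _ <-]]|[i _ ->]]; try exact: measurable_funPT.
exact: measurable_plant.
Qed.

Lemma drawn_measurable j : sigma_of (drawn j) `<=` measurable.
Proof. by apply: sigma_of_measurable => f; exact: measurable_drawn. Qed.

Lemma drawn_le j j' : (j <= j')%N -> sigma_of (drawn j) `<=` sigma_of (drawn j').
Proof.
move=> jj'; apply: sigma_of_subset => f [?|[i ij fE]]; first by left.
by right; exists i => //; exact: leq_trans jj'.
Qed.

Lemma measurable_source s f : source_vars x w v g H U s f -> measurable_fun setT f.
Proof.
case: s => [|k|k|||k] /=.
- by move=> fx; apply: measurable_plant; left; left.
- by move=> fw; apply: measurable_plant; left; right; exists k.
- by move=> fv; apply: measurable_plant; right; exists k.
- by move=> [i _ <-]; exact: measurable_funPT.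
- by move=> [i _ <-]; exact: measurable_funPT.
- by move=> ->; exact: measurable_funPT.
Qed.

Lemma drawn_independent j D E : sigma_of (drawn j) D ->
  sigma_of [set (U j : Omega -> R)] E -> P (D `&` E) = (P D * P E)%E.
Proof.
move=> sD sE; apply: (independent_rest measurable_source indep (s0 := Aux j)) => //.
apply: sigma_of_subset sD => f [[[[[fx|[t _ ft]]|[t _ ft]]|fg]|fH]|[i ij ->]].
- by exists Init.
- by exists (ProcNoise t).
- by exists (MeasNoise t).
- by exists Gain.
- by exists Harvest.
- by exists (Aux i) => //= -[ij']; rewrite ij' ltnn in ij.
Qed.

Lemma measurable_drawn_gH j i :
  measurable_fun (setT : set (known (drawn j))) (g i) /\
  measurable_fun (setT : set (known (drawn j))) (H i).
Proof.
by split; apply: measurable_known; [left; left; right|left; right]; exists i.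
Qed.

Lemma measurable_drawn_U j i : (i < j)%N ->
  measurable_fun (setT : set (known (drawn j))) (U i).
Proof. by move=> ij; apply: measurable_known; right; exists i. Qed.

Lemma drawn_gam k :
  measurable_fun (setT : set (known (drawn k.*2))) (opt_u k) ->
  forall b, sigma_of (drawn k.*2.+1) (opt_gam k @^-1` [set b]).
Proof.
move=> mu b.
have mu1 : measurable_fun (setT : set (known (drawn k.*2.+1))) (opt_u k).
  by apply: measurable_known_le mu; exact: drawn_le.
have mt : sigma_of (drawn k.*2.+1) [set om | U k.*2 om <= chan M true (g k om) (opt_u k om)].
  rewrite -[X in sigma_of _ X]setTI.
  apply: (@measurable_fun_le _ (known (drawn k.*2.+1))); first exact: measurableT.
    exact: measurable_drawn_U.
  apply: measurable_chan => //; exact: (measurable_drawn_gH _ _).1.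
case: b.
  exact: mt.
rewrite (_ : _ @^-1` _ = ~` [set om | U k.*2 om <= chan M true (g k om) (opt_u k om)]).
  exact: (@measurableC _ (known (drawn k.*2.+1))).
by apply/seteqP; split=> om /=; [move=> h /= h'; move: h; rewrite /opt_gam /received h'
  |move/negP/negbTE].
Qed.

Lemma drawn_hgam k :
  measurable_fun (setT : set (known (drawn k.*2))) (opt_u k) ->
  forall j, sigma_of (drawn k.+1.*2) (opt_hgam k @^-1` [set j]).
Proof.
move=> mu j.
have mb b : sigma_of (drawn k.+1.*2) (opt_gam k @^-1` [set b]).
  have := drawn_gam mu b; apply: drawn_le.
  by rewrite doubleS.
have mf b : sigma_of (drawn k.+1.*2) [set om | feedback M U k om b = j].
  apply: (sigma_of_preimage (f := U k.*2.+1) (A := [set t | _ = j])).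
    by apply: measurable_drawn_U; rewrite doubleS.
  exact: measurable_pick3.
rewrite (_ : _ @^-1` _ =
  (opt_gam k @^-1` [set true] `&` [set om | feedback M U k om true = j]) `|`
  (opt_gam k @^-1` [set false] `&` [set om | feedback M U k om false = j])).
  by apply: (@measurableU _ (known (drawn k.+1.*2)));
    apply: (@measurableI _ (known (drawn k.+1.*2))); (exact: mb || exact: mf).
apply/seteqP; split=> om /=.
  rewrite /opt_hgam; case: (opt_gam k om); first by left.
  by right.
by rewrite /opt_hgam => -[[-> //]|[-> //]].
Qed.

Lemma drawn_u k : measurable_fun (setT : set (known (drawn k.*2))) (opt_u k).
Proof.
elim/ltn_ind: k => k IH.
have [||i j ik|_ _] := @measurable_opt _ _ _ M _ _ P0 B0 T g H U (drawn k.*2) k.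
- by move=> i _; exact: (measurable_drawn_gH _ _).1.
- by move=> i _; exact: (measurable_drawn_gH _ _).2.
- have := drawn_hgam (IH i ik) j; apply: drawn_le.
  by rewrite leq_double.
- exact.
Qed.

Lemma past_drawn k : sigma_of (past k) `<=` sigma_of (drawn k.*2).
Proof.
apply: sigma_of_le => f [pf|[t tk [->|->]]].
- by apply: measurable_known; left.
- apply: (measurable_finite (h := opt_gam t) (fun b => b%:R)) => b.
  have := drawn_gam (@drawn_u t) b; apply: drawn_le.
  by rewrite ltn_double.
- apply: (measurable_finite (h := opt_hgam t) (fun b => b%:R)) => b.
  have := drawn_hgam (@drawn_u t) b; apply: drawn_le.
  by rewrite leq_double.
Qed.

Lemma past_gam_drawn k :
  sigma_of (past k `|` [set fun om => (opt_gam k om)%:R]) `<=` sigma_of (drawn k.*2.+1).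
Proof.
apply: sigma_of_le => f [pf|->].
  apply: (@measurable_known_le _ _ _ _ _ (past k)); last exact: measurable_known.
  apply: subset_trans (drawn_le (leqnSn _)); exact: past_drawn.
apply: (measurable_finite (h := opt_gam k) (fun b => b%:R)) => b.
exact: drawn_gam (@drawn_u k) b.
Qed.

Lemma measurable_opt_u (X : set (Omega -> R)) k :
  (forall i, (i <= k)%N -> X (g i)) -> (forall i, (i <= k)%N -> X (H i)) ->
  (forall i, (i < k)%N -> X (fun om => (opt_hgam i om)%:R)) ->
  measurable_fun (setT : set (known X)) (opt_u k).
Proof.
move=> Xg XH Xh.
have [||i j ik|_ _] := @measurable_opt _ _ _ M _ _ P0 B0 T g H U X k.
- by move=> i ik; apply: measurable_known; exact: Xg.
- by move=> i ik; apply: measurable_known; exact: XH.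
- by apply: known_fibre; apply: measurable_known; exact: Xh.
- exact.
Qed.

Lemma info_u k : measurable_fun (setT : set (known (info k))) (opt_u k).
Proof.
apply: measurable_opt_u => i ik.
- case: i ik => [|i] ik; first by left; apply: Or41.
  by right; exists i.+1 => //; apply: Or42.
- case: i ik => [|i] ik; first by left; apply: Or42.
  by right; exists i.+1 => //; apply: Or43.
- by right; exists i.+1 => //; apply: Or41.
Qed.

Lemma past_u k : measurable_fun (setT : set (known (past k))) (opt_u k).
Proof.
apply: measurable_opt_u => i ik.
- by left; left; right; exists i.
- by left; right; exists i.
- by right; exists i => //; right.
Qed.

Lemma harvested_ge0 k : {ae P, forall om, 0 <= H k om}.
Proof.
have mI : measurable (`[0, +oo[%classic : set R) by [].
elim: k => [|k IH].
  by apply/aeW => om; rewrite HP.1.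
have PH : P (H k.+1 @^-1` `[0, +oo[%classic) = 1%E.
  have [_ /(_ setT)] := HP.2 k _ mI; rewrite setTI => ->; last first.
    exact: (@measurableT _ (known _)).
  transitivity (\int[P]_om cst 1%E om)%E; last exact: integral_probability_cst.
  apply: ae_eq_integral => //.
    have mK : measurable_fun setT (fun z => harvK M z `[0, +oo[%classic).
      exact: measurable_kernel.
    exact: (measurableT_comp mK).
  by apply: filterS IH => om Hk _; exact: harvK_ge0.
have mH : measurable (H k.+1 @^-1` `[0, +oo[%classic).
  by rewrite -[X in measurable X]setTI; exact: measurable_funPT.
exists (~` (H k.+1 @^-1` `[0, +oo[%classic)); split.
- exact: measurableC.
- by rewrite probability_setC// PH subee.
- by move=> om /= h /=; rewrite in_itv/= andbT.
Qed.

(** At most [max 0 B] is spent, and what is harvested is almost surely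
    nonnegative. *)
Lemma opt_battery_ge0 k : {ae P, forall om, 0 <= batt k om}.
Proof.
have /andP[B00 B01] := B0_range; elim: k => [|k IH]; first exact: aeW.
apply: filterS2 IH (harvested_ge0 k.+1) => om b0 Hk.
rewrite /= le_min (le_trans B00 B01) andbT addr_ge0// subr_ge0.
by have := opt_u_le M P0 B0 T g H U k om; rewrite max_r.
Qed.

Lemma opt_admissible :
  admissible M P P0 B0 x w v g H opt_gam opt_hgam opt_u T.
Proof.
split=> k kT.
- apply: (measurable_fun_sub (drawn_measurable (j := k.*2.+1))).
  apply: (measurable_finite (h := opt_gam k) (fun b => b%:R)) => b.
  exact: drawn_gam (@drawn_u k) b.
- apply: (measurable_fun_sub (drawn_measurable (j := k.+1.*2))).
  apply: (measurable_finite (h := opt_hgam k) (fun b => b%:R)) => b.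
  exact: drawn_hgam (@drawn_u k) b.
- by move=> A mA; apply: sigma_of_preimage mA; exact: info_u.
- apply: filterS (opt_battery_ge0 k) => om b0; rewrite opt_u_ge0/=.
  by have := opt_u_le M P0 B0 T g H U k om; rewrite max_r.
- split.
    move=> A mA; apply: sigma_of_preimage mA; apply/measurable_EFinP.
    apply: measurable_chan; last exact: past_u.
    by apply: measurable_known; left; left; right; exists k.
  move=> D sD.
  apply: (@uniform_threshold _ _ _ P (drawn k.*2) (U k.*2)
    (@measurable_drawn _) (@UP _) (@drawn_independent _)
    (fun om => chan M true (g k om) (opt_u k om))).
  + apply: measurable_chan; last exact: drawn_u.
    exact: (measurable_drawn_gH _ _).1.
  + by move=> om; rewrite chan_ge0 chan_le1.
  + exact: past_drawn.
- move=> j; have mgam X : X (fun om => (opt_gam k om)%:R : R) -> forall b,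
      sigma_of X (opt_gam k @^-1` [set b]).
    move=> Xk b; rewrite (fibre_natr (R := R)).
    by apply: sigma_of_preimage => //; exact: measurable_known.
  split.
    move=> A mA; apply: sigma_of_preimage mA; apply/measurable_EFinP.
    set X := past k `|` _.
    apply: (measurable_finite (h := opt_gam k) (fun b => fback M j b)) => b.
    by apply: mgam; right.
  move=> D sD.
  apply: (@uniform_pick _ _ _ P (drawn k.*2.+1) (U k.*2.+1)
    (@measurable_drawn _) (@UP _) (@drawn_independent _)
    (fun i om => fback M i (opt_gam k om))).
  + move=> i; apply: (measurable_finite (h := opt_gam k) (fun b => fback M i b)) => b.
    exact: drawn_gam (@drawn_u k) b.
  + by move=> i om; exact: fback_ge0.
  + by move=> om; exact: fback_sum.
  + exact: past_gam_drawn.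
Qed.

End admissible_control.

(** * The value of the control problem *)

(** A point mass has a finite profile, which approximates itself. *)
Lemma value_to_go_dirac (R : realType) (n m : nat) (M : model R n m) l
    (P0 : psdmx R n) (g H B : R) : 0 <= Bmax M -> 0 <= g -> 0 <= H -> 0 <= B ->
  value_to_go M l (dirac P0) g H B = W M l.+1 (fun s => path_trace M s P0) g H B.
Proof.
move=> Bmax0 g0 H0 B0.
have app : approximates M (fun _ s => path_trace M s P0) (dirac P0).
  split=> [_ s|//|s]; first exact: path_trace_ge0.
  rewrite /belief_profile integral_dirac//; last first.
    by apply/measurable_EFinP; exact: measurable_path_trace.
  by rewrite diracT mul1e; exact: cvg_cst.
have lim := value_limitP Bmax0 (l := l) app g0 H0 B0.
by rewrite -(cvg_lim _ lim)// lim_cst.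
Qed.

Section control_problem.
Context {R : realType} {n m : nat} (M : model R n m).
Context d {Omega : measurableType d} (P : probability Omega R).
Variables (T : nat) (g0 H0 B0 : R) (P0 : psdmx R n).
Variables (x w : nat -> Omega -> 'cV[R]_n) (y v : nat -> Omega -> 'cV[R]_m).
Variables (g H U : nat -> {RV P >-> R}).
Hypotheses (g0_ge0 : 0 <= g0) (H0_ge0 : 0 <= H0) (B0_range : 0 <= B0 <= Bmax M).
Hypothesis plantP : plant M P P0 x w y v.
Hypothesis gP : markov_chain (gainK M) g0 g.
Hypothesis HP : markov_chain (harvK M) H0 H.
Hypothesis UP : forall k A, measurable A ->
  P (U k @^-1` A) = uniform_prob (@ltr01 R) A.
Hypothesis indep : mutually_independent P
  (fun s => sigma_of (source_vars x w v g H U s)).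

Let mg k : measurable_fun setT (g k). Proof. exact: measurable_funPT. Qed.
Let mH k : measurable_fun setT (H k). Proof. exact: measurable_funPT. Qed.

(** Before any feedback, only the two independent chains are observed. *)
Lemma gain_energy_markov hgam t D A : sigma_of (observed g H hgam 0 t) D ->
  measurable A -> P (D `&` (fun om => (g t.+1 om, H t.+1 om)) @^-1` A) =
    (\int[P]_(om in D) kprob (kpair (gainK M) (harvK M)) (g t om, H t om) A)%E.
Proof.
move=> sD; apply: (markov_pair mg mH gP.2 HP.2).
  move=> D1 E1 sD1 sE1.
  apply: (independent_rest (measurable_source plantP) indep (s0 := Harvest)) => //.
  by apply: sigma_of_subset sD1 => f fg; exists Gain.
apply: sigma_of_subset sD => f [[//]|[i it [->|->]]]; first by left; exists i.
by right; exists i.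
Qed.

Lemma expected_initial_value hgam u :
  expected_value M P P0 B0 g H hgam u T.+1 0 = value M T 0 (dirac P0) g0 H0 B0.
Proof.
have /andP[B00 B01] := B0_range.
rewrite /value subn0 value_to_go_dirac//; last exact: le_trans B01.
transitivity (\int[P]_om W M T.+1 (fun s => path_trace M s P0) g0 H0 B0)%E.
  by apply: eq_integral => om _ /=; rewrite gP.1 HP.1.
exact: integral_probability_cst.
Qed.

Lemma value_le_cost gam hgam u :
  admissible M P P0 B0 x w v g H gam hgam u T ->
  (value M T 0 (dirac P0) g0 H0 B0 <= total_cost M P P0 gam T)%E.
Proof.
move=> adm; rewrite -(expected_initial_value hgam u).
exact: (expected_value_le mg mH (measurable_plant plantP) adm
  (@gain_energy_markov hgam) (add0n _)).
Qed.

Lemma optimal_cost :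
  total_cost M P P0 (opt_gam M P0 B0 T g H U) T = value M T 0 (dirac P0) g0 H0 B0.
Proof.
rewrite -(expected_initial_value (opt_hgam M P0 B0 T g H U) (opt_u M P0 B0 T g H U)).
apply/esym; apply: (expected_value_eq mg mH (measurable_plant plantP)
  (opt_admissible T H0_ge0 B0_range plantP HP UP indep)
  (@gain_energy_markov _) (add0n _)).
by move=> k l om klT; exact: opt_uP.
Qed.

End control_problem.

Theorem mainTheorem2 (R : realType) (n m : nat) (M : model R n m)
    (d : measure_display) (Omega : measurableType d) (P : probability Omega R)
    (T : nat) (g0 H0 B0 : R) (P0 : psdmx R n)
    (x w : nat -> Omega -> 'cV[R]_n) (y v : nat -> Omega -> 'cV[R]_m)
    (g H U : nat -> {RV P >-> R})
    (g0_ge0 : 0 <= g0) (H0_ge0 : 0 <= H0) (B0_range : 0 <= B0 <= Bmax M)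
    (plantP : plant M P P0 x w y v)
    (gP : markov_chain (gainK M) g0 g)
    (HP : markov_chain (harvK M) H0 H)
    (UP : forall k A, measurable A ->
       P (U k @^-1` A) = uniform_prob (@ltr01 R) A)
    (indep : mutually_independent P
       (fun s => sigma_of (source_vars x w v g H U s))) :
  [/\ forall k, (k < T)%N ->
        forall (pi : probability (psdmx R n) R) (g1 H1 B1 : R),
          0 <= g1 -> 0 <= H1 -> 0 <= B1 <= Bmax M ->
          is_minimum
            [set bellman_obj M (value M T k.+1) pi g1 H1 B1 u1
               | u1 in [set u1 | 0 <= u1 <= B1]]
            (value M T k pi g1 H1 B1),
      forall (pi : probability (psdmx R n) R) (g1 H1 B1 : R),
        0 <= g1 -> 0 <= H1 -> 0 <= B1 <= Bmax M ->
        is_minimum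
          [set stage_cost M pi g1 u1 | u1 in [set u1 | 0 <= u1 <= B1]]
          (value M T T pi g1 H1 B1) /\
        value M T T pi g1 H1 B1 = stage_cost M pi g1 B1
    & is_minimum
        [set c | exists (gam : nat -> Omega -> bool)
                        (hgam : nat -> Omega -> 'I_3) (u : nat -> Omega -> R),
           admissible M P P0 B0 x w v g H gam hgam u T /\
           c = total_cost M P P0 gam T]
        (value M T 0 (dirac P0) g0 H0 B0)].
Proof.
have Bmax0 : 0 <= Bmax M by have /andP[/le_trans] := B0_range; exact.
split.
- move=> k kT pi g1 H1 B1 g1_ge0 H1_ge0 /andP[B1_ge0 _].
  have -> : value M T k = value_to_go M (T - k.+1).+1 by rewrite /value subnSK.
  exact: (value_minimum Bmax0 (T - k.+1).+1 pi g1_ge0 H1_ge0 B1_ge0).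
- move=> pi g1 H1 B1 g1_ge0 H1_ge0 /andP[B1_ge0 _].
  have -> : value M T T = value_to_go M 0 by rewrite /value subnn.
  have vmin := value_minimum Bmax0 0 pi g1_ge0 H1_ge0 B1_ge0.
  split=> //; apply/eqP; rewrite eq_le; apply/andP; split.
    by apply: vmin.2; exists B1 => //=; rewrite B1_ge0 lexx.
  have [[u /andP[u0 uB] <-] _] := vmin.
  exact: stage_cost_nonincreasing.
- split.
    exists (opt_gam M P0 B0 T g H U), (opt_hgam M P0 B0 T g H U), (opt_u M P0 B0 T g H U).
    split; first exact: (opt_admissible T H0_ge0 B0_range plantP HP UP indep).
    by rewrite (optimal_cost T g0_ge0 H0_ge0 B0_range plantP gP HP UP indep).
  move=> _ [gam [hgam [u [adm ->]]]].
  exact: (value_le_cost g0_ge0 H0_ge0 B0_range plantP gP HP indep adm).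
Qed.
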